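(* Let $\alpha,\beta\in\mathbb{R}$ be such that $\alpha,\beta,1$ are linearly independent over $\mathbb{Q}$, and let $h:\mathbb{T}^2\to\mathbb{T}^1$ be Lipschitz continuous. Let $X=G/\Gamma$ be the 3-dimensional Heisenberg nilmanifold and let $T:X\to X$ be the skew product map $T:\mathbf{x}\mapsto(\alpha,\beta,h(x,y))\,\mathbf{x}$ for $\mathbf{x}=(x,y,z)\Gamma$ (as defined in the context). Then for every $\mathbf{x}\in X$ and every continuous function $f\in C(X)$ (complex-valued), $$\lim_{N\to\infty}\frac1N\sum_{n=1}^N f(T^n\mathbf{x})\,\mu(n)=0.$$
   Context: $\mathbb{T}^d=\mathbb{R}^d/\mathbb{Z}^d$. The Möbius function $\mu:\mathbb{N}\to\{-1,0,1\}$ is given by $\mu(n)=(-1)^k$ if $n$ is the product of $k$ distinct primes, and $\mu(n)=0$ otherwise. The Heisenberg group is $G=\{(x,y,z):x,y,z\in\mathbb{R}\}\cong\mathbb{R}^3$ with group rule $(x,y,z)(x',y',z')=(x+x',\,y+y',\,z+z'+(xy'-x'y))$. Let $\Gamma=\{(x,y,z)\in G:x,y,z\in\mathbb{Z}\}$ and $X=G/\Gamma$, a compact nilmanifold on which $G$ acts by left translation; the coordinates $(x,y)$ modulo $\mathbb{Z}^2$ give a projection $X\to\mathbb{T}^2$. For $\alpha,\beta\in\mathbb{R}$ and $h:\mathbb{T}^2\to\mathbb{T}^1$ continuous (regarded as a $\mathbb{Z}^2$-periodic function on $\mathbb{R}^2$), $T:X\to X$ is $T\mathbf{x}=(\alpha,\beta,\widetilde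 h(x,y))\,\mathbf{x}$ for $\mathbf{x}=(x,y,z)\Gamma$, where $\widetilde h(x,y)\in\mathbb{R}$ is any lift of $h(x,y)\in\mathbb{T}^1$. The result does not depend on the lift, because $\{(0,0,m):m\in\mathbb{Z}\}$ is central in $G$ and contained in $\Gamma$; hence one writes $h$ in place of $\widetilde h$. *)

(* Defs.v *)
From HB Require Import structures.
From mathcomp Require Import all_boot all_order all_algebra.
From mathcomp Require Import complex.
From mathcomp Require Import ring.
From mathcomp Require Import all_classical all_reals all_analysis.

Set Implicit Arguments.
Unset Strict Implicit.
Unset Printing Implicit Defensive.

Import Order.TTheory GRing.Theory Num.Theory.
Import numFieldNormedType.Exports.

Local Open Scope classical_set_scope.
Local Open Scope quotient_scope.
Local Open Scope ring_scope.

(* A natural number is a product of distinct primes iff it is the product of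
   its prime divisors; mobiusE and mobius_eq0 confirm this reading.  As
   primes 0 = [::], the value at 0 is 0. *)
Definition mobius (n : nat) : int :=
  if n == (\prod_(p <- primes n) p)%N then (-1) ^+ size (primes n) else 0.

Lemma prod_primes_uniq (s : seq nat) : uniq s -> all prime s ->
  perm_eq (primes (\prod_(p <- s) p)%N) s.
Proof.
elim: s => [|p s IHs] /=; first by rewrite big_nil.
move=> /andP[ps us] /andP[pp prs].
have s0 : (0 < \prod_(q <- s) q)%N.
  by rewrite big_seq prodn_cond_gt0// => q qs; apply: prime_gt0 (allP prs q qs).
rewrite uniq_perm ?primes_uniq//=; first by rewrite ps us.
move=> q; have p0 := prime_gt0 pp.
by rewrite big_cons primesM// (perm_mem (IHs us prs)) primes_prime// !inE.
Qed.

Lemma mobiusE (s : seq nat) : uniq s -> all prime s ->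
  mobius (\prod_(p <- s) p)%N = (-1) ^+ size s.
Proof.
move=> us ps; have pe := prod_primes_uniq us ps.
by rewrite /mobius (perm_big _ pe) eqxx (perm_size pe).
Qed.

Lemma mobius_eq0 (n : nat) :
  ~ (exists s : seq nat, [/\ uniq s, all prime s & n = (\prod_(p <- s) p)%N]) ->
  mobius n = 0.
Proof.
rewrite /mobius; case: eqP => // nE; case; exists (primes n).
rewrite primes_uniq -nE; split=> //.
by apply/allP => p; rewrite mem_primes => /and3P[].
Qed.

Section torus.
Variables (R : realType) (d : nat).
Implicit Types u v w : 'rV[R]_d.

Definition torus_rel u v := (u - v) \is a mxOver Num.int.

Lemma torus_rel_equiv : equiv_class_of torus_rel.
Proof.
rewrite /torus_rel; split=> [u|u v|v u w].
- by apply/mxOverP => i j; rewrite subrr mxE int_num0.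
- by apply/mxOverP/mxOverP => uv i j; have := uv i j;
    rewrite !mxE -rpredN opprB.
- move=> /mxOverP uv /mxOverP vw; apply/mxOverP => i j.
  by have := rpredD (uv i j) (vw i j); rewrite !mxE addrA subrK.
Qed.

Canonical torus_equiv := EquivRelPack torus_rel_equiv.

Definition torus := quotient_topology {eq_quot torus_rel}.

(* The quotient metric on R^d / Z^d.  The norm on 'rV[R]_d is the sup norm, so
   for d > 1 this agrees with the Euclidean one up to a constant factor. *)
Definition torus_dist (p q : torus) : R :=
  inf [set `|u - v| | u in [set u | \pi_torus u = p]
                    & v in [set v | \pi_torus v = q]].

End torus.

Definition torus_lipschitz (R : realType) (d e : nat)
    (h : torus R d -> torus R e) :=
  exists L : R, forall p q, torus_dist (h p) (h q) <= L * torus_dist p q.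

Definition heisenberg (R : realType) : Type := (R * R * R)%type.

HB.instance Definition _ (R : realType) := Choice.on (heisenberg R).
HB.instance Definition _ (R : realType) :=
  Topological.copy (heisenberg R) (R * R * R)%type.

Section heisenberg_group.
Variable R : realType.
Local Notation G := (heisenberg R).
Implicit Types g k : G.

Definition heis_mul g k : G :=
  let: (x, y, z) := g in
  let: (x', y', z') := k in
  (x + x', y + y', z + z' + (x * y' - x' * y)).

Definition heis_one : G := (0, 0, 0).

Definition heis_inv g : G := let: (x, y, z) := g in (- x, - y, - z).

Lemma heis_mulA : associative heis_mul.
Proof. by move=> [[x y] z] [[a b] c] [[p q] r] /=; congr (_, _, _); ring. Qed.

Lemma heis_mul1g : left_id heis_one heis_mul.
Proof. by move=> [[x y] z] /=; congr (_, _, _); ring. Qed.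

Lemma heis_mulg1 : right_id heis_one heis_mul.
Proof. by move=> [[x y] z] /=; congr (_, _, _); ring. Qed.

Lemma heis_mulVg : left_inverse heis_one heis_inv heis_mul.
Proof. by move=> [[x y] z] /=; congr (_, _, _); ring. Qed.

Lemma heis_mulgV : right_inverse heis_one heis_inv heis_mul.
Proof. by move=> [[x y] z] /=; congr (_, _, _); ring. Qed.

HB.instance Definition _ := isGroup.Build G
  heis_mulA heis_mul1g heis_mulg1 heis_mulVg heis_mulgV.

Definition heis_lattice : {pred G} :=
  [pred g : G | [&& g.1.1 \is a Num.int, g.1.2 \is a Num.int
                  & g.2 \is a Num.int]].

Lemma heis_lattice1 : 1%g \in heis_lattice.
Proof. by rewrite inE /= !int_num0. Qed.

Lemma heis_latticeM g k : g \in heis_lattice -> k \in heis_lattice ->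
  (g * k)%g \in heis_lattice.
Proof.
case: g k => [[x y] z] [[a b] c]; rewrite !inE /=.
move=> /and3P[xi yi zi] /and3P[ai bi ci].
by rewrite !rpredD// ?rpredN ?rpredM//.
Qed.

Lemma heis_latticeV g : g \in heis_lattice -> (g^-1)%g \in heis_lattice.
Proof. by case: g => [[x y] z]; rewrite !inE /= !rpredN. Qed.

Definition lcoset_rel g k := (g^-1 * k)%g \in heis_lattice.

Lemma lcoset_rel_equiv : equiv_class_of lcoset_rel.
Proof.
rewrite /lcoset_rel; split=> [g|g k|k g l].
- by rewrite mulVg heis_lattice1.
- by apply/idP/idP => /heis_latticeV; rewrite invgM invgK.
- by move=> gk kl; rewrite -(mulgK k (g^-1)%g) -mulgA heis_latticeM.
Qed.

Canonical lcoset_equiv := EquivRelPack lcoset_rel_equiv.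

Definition nilmanifold := quotient_topology {eq_quot lcoset_rel}.

End heisenberg_group.

Section skew_product.
Variable R : realType.
Local Notation X := (nilmanifold R).
Local Notation T1 := (torus R 1).
Local Notation T2 := (torus R 2).

Definition plane_pt (x y : R) : 'rV[R]_2 := \row_i (if i == 0 then x else y).

Definition heis_xy (g : heisenberg R) : T2 := \pi_T2 (plane_pt g.1.1 g.1.2).

(* Both the representative of the coset and the lift of h (x, y) are chosen by
   repr; skew_productE shows that neither choice matters. *)
Definition skew_product (alpha beta : R) (h : T2 -> T1) (x : X) : X :=
  let g := repr x in
  \pi_X (((alpha, beta, repr (h (heis_xy g)) 0 0) : heisenberg R) * g)%g.

Lemma pi_torusP (d : nat) (u v : 'rV[R]_d) :
  reflect (\pi_(torus R d) u = \pi_(torus R d) v)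
          ((u - v) \is a mxOver Num.int).
Proof. exact: (@eqmodP _ (torus_equiv R d) u v). Qed.

Lemma pi_nilmanifoldP (g k : heisenberg R) :
  reflect (\pi_X g = \pi_X k) ((g^-1 * k)%g \in @heis_lattice R).
Proof. exact: (@eqmodP _ (lcoset_equiv R) g k). Qed.

Lemma skew_productE (alpha beta : R) (h : T2 -> T1) (g : heisenberg R)
    (t : R) :
  \pi_T1 (const_mx t) = h (heis_xy g) ->
  skew_product alpha beta h (\pi_X g)
  = \pi_X (((alpha, beta, t) : heisenberg R) * g)%g.
Proof.
move=> ht; rewrite /skew_product; set k := repr (\pi_X g).
have /pi_nilmanifoldP kg : \pi_X k = \pi_X g by rewrite reprK.
have xyE : heis_xy k = heis_xy g.
  apply/pi_torusP/mxOverP => i j; rewrite !mxE -rpredN opprB.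
  case: g k kg {ht} => [[x y] z] [[a b] c] /=; rewrite inE /=.
  by rewrite ![- _ + _]addrC => /and3P[? ? _]; case: ifP.
rewrite xyE; set s := repr (h _) 0 0.
have ts : t - s \is a Num.int.
  have /pi_torusP/mxOverP/(_ 0 0) :
    \pi_T1 (const_mx t) = \pi_T1 (repr (h (heis_xy g))) by rewrite reprK.
  by rewrite !mxE.
apply/pi_nilmanifoldP; move: s ts => s ts {ht xyE}.
case: g k kg => [[x y] z] [[a b] c]; rewrite !inE /= => /and3P[xa yb zc].
apply/and3P; split.
- by rewrite (_ : _ + _ = - a + x)//; ring.
- by rewrite (_ : _ + _ = - b + y)//; ring.
- have -> : - (s + c + (alpha * b - a * beta))
      + (t + z + (alpha * y - x * beta))
      + (- (alpha + a) * (beta + y) - (alpha + x) * - (beta + b))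
    = (- c + z + (- a * y - x * - b)) + (t - s) by ring.
  by rewrite rpredD.
Qed.

End skew_product.

Definition rat_independent3 (R : realType) (a b c : R) :=
  forall p q r : rat, ratr p * a + ratr q * b + ratr r * c = 0 ->
  [/\ p = 0, q = 0 & r = 0].

(* Main.v *)
(* Katai's criterion: a bounded F satisfies sum_{n <= N} F(n) mu(n) = o(N) as
   soon as sum_{n <= N} F(pn) conj(F(qn)) = o(N) for all primes p <> q.  By Fejer
   summation in the central variable, f may be replaced by its vertical Fourier
   coefficients, i.e. by functions with f(x, y, z + s) = e(ms) f(x, y, z).

   If m = 0, then f lives on T^2, and trigonometric polynomials reduce the claim
   to characters: nontrivial ones are handled by Katai's criterion, the constant
   one is the prime number theorem, proved through Selberg's formula.

   If m <> 0, let a(n) = F(pn) conj(F(qn)), and let t be such that t(alpha, beta)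
   is within d of an integer point (A, B).  Then a(n + t) is close to
   e(theta(n alpha, n beta)) a(n), where the phase theta is a circle-valued
   O(t)-Lipschitz function that hardly changes along n -> n + 1.  Its winding
   number along the first coordinate is m (t (p K - q K') - 2 (p^2 - q^2) B) with
   integers K, K'; as B is close to t beta and beta is irrational, this is at
   least c t in absolute value.  Hence e(theta) spends a definite proportion of
   its time away from 1, independently of t, and every bound s for the long
   averages of a improves to s (1 - c'); iterating, they tend to 0. *)
Require Import Defs.
From mathcomp Require Import all_boot all_order all_algebra.
From mathcomp Require Import complex zify ring lra.
From mathcomp Require Import all_classical all_reals all_analysis.
Set Implicit Arguments.
Unset Strict Implicit.
Unset Printing Implicit Defensive.
Import Order.TTheory GRing.Theory Num.Theory.
Import numFieldNormedType.Exports.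
Local Open Scope classical_set_scope.
Local Open Scope ring_scope.
Local Notation Re := (@complex.Re _).
Local Notation Im := (@complex.Im _).

(** The obstacle is that [h] is merely Lipschitz and may have nonzero degree: it need not have a
    continuous real lift on the torus, and its sums along the orbit cannot be computed. The winding
    number is blind to their size: a sum of translates of one circle-valued function winds as often
    as that function times the number of terms, so [h] contributes an integer multiple of [t]. The
    group law contributes a linear phase which, at times [r n], is proportional to [r ^ 2]; the two
    primes therefore leave [2 (p ^ 2 - q ^ 2) t beta], and no multiple of [t] comes closer to it
    than [t] times the distance of [2 (p ^ 2 - q ^ 2) beta] from the integers. Winding number and
    Lipschitz constant of the phase both scale like [t], which is why the gain is free of [t],
    although nothing controls [t] as [d] shrinks. Both iterations, for the correlations and for the
    Mertens function, are run as infimum arguments, so only a gain uniform in the current bound is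
    needed. Integrals are avoided: averages over circles are finite sums over equally spaced points,
    exact for trigonometric polynomials of low degree. *)

(** * Divisor sums and the Moebius function *)

Lemma sum_multiples (V : nmodType) (d N : nat) (G : nat -> V) : (0 < d)%N ->
  \sum_(1 <= k < N.+1 | (d %| k)%N) G k
  = \sum_(1 <= m < (N %/ d).+1) G (d * m)%N.
Proof.
move=> d0; elim: N => [|N IH]; first by rewrite div0n !big_geq.
rewrite divnS// big_mkcond big_nat_recr//= -big_mkcond IH.
case: ifPn => dN /=; rewrite ?add0n ?add1n ?addr0//.
rewrite [RHS]big_nat_recr//=; congr (_ + G _).
by rewrite -(addn1 (N %/ d)) addnC -[1%N]/(nat_of_bool true) -dN -divnS// mulnC divnK.
Qed.

(** Both sides run over the pairs [(d, m)] with [d * m <= N]; on the left they are grouped by their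
    product. *)
Lemma sum_divisors (V : nmodType) (N : nat) (F : nat -> nat -> V) :
  \sum_(1 <= k < N.+1) \sum_(1 <= d < k.+1 | (d %| k)%N) F d (k %/ d)%N
  = \sum_(1 <= d < N.+1) \sum_(1 <= m < (N %/ d).+1) F d m.
Proof.
have -> : \sum_(1 <= k < N.+1) \sum_(1 <= d < k.+1 | (d %| k)%N) F d (k %/ d)%N
  = \sum_(1 <= k < N.+1) \sum_(1 <= d < N.+1 | (d %| k)%N) F d (k %/ d)%N.
  apply: eq_big_nat => k /andP[k1 kN].
  rewrite [RHS](big_cat_nat (n := k.+1))//= [X in _ + X]big1_seq ?addr0// => d.
  rewrite mem_index_iota => /andP[dk /andP[kd _]].
  by have := dvdn_leq k1 dk; lia.
rewrite (exchange_big_dep_nat predT)//=; apply: eq_big_nat => d /andP[d1 _].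
rewrite sum_multiples//; apply: eq_big_nat => m _.
by rewrite mulKn.
Qed.

Lemma sum_divisors_weight (V : nmodType) (N : nat) (F : nat -> nat -> V) :
  \sum_(1 <= d < N.+1) \sum_(1 <= m < (N %/ d).+1) F d (d * m)%N
  = \sum_(1 <= k < N.+1) \sum_(1 <= d < k.+1 | (d %| k)%N) F d k.
Proof.
rewrite -(sum_divisors N (fun d m => F d (d * m)%N)).
apply: eq_big_nat => k _; apply: eq_bigr => d dk.
by rewrite mulnC divnK.
Qed.

(** [H] brings both sides to a sum over the pairs with [d * e] dividing [n]; this is the
    rearrangement behind Dirichlet convolution. *)
Lemma sum_divisors_pairs (V : nmodType) (n : nat) (F : nat -> nat -> V) :
  (0 < n)%N ->
  \sum_(1 <= d < n.+1 | (d %| n)%N) \sum_(1 <= e < (n %/ d).+1 | (e %| n %/ d)%N)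
     F d e
  = \sum_(1 <= e < n.+1 | (e %| n)%N)
     \sum_(1 <= d < (n %/ e).+1 | (d %| n %/ e)%N) F d e.
Proof.
move=> n0.
have H (G : nat -> nat -> V) :
  \sum_(1 <= d < n.+1 | (d %| n)%N)
    \sum_(1 <= e < (n %/ d).+1 | (e %| n %/ d)%N) G d e
  = \sum_(1 <= d < n.+1) \sum_(1 <= e < n.+1 | (d * e %| n)%N) G d e.
  rewrite big_mkcond; apply: eq_big_nat => d /andP[d1 dn].
  case: ifPn => [dvd|ndvd]; last first.
    by rewrite big1// => e /(dvdn_trans (dvdn_mulr _ (dvdnn d))); rewrite (negPf ndvd).
  rewrite [RHS](big_cat_nat (n := (n %/ d).+1))//=; last by rewrite ltnS leq_div.
  rewrite [X in _ = _ + X]big1_seq ?addr0//=; last first.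
    move=> e; rewrite mem_index_iota => /andP[de /andP[e1 _]].
    move: e1; rewrite ltn_divLR//; have := dvdn_leq n0 de; lia.
  by apply: eq_bigl => e; rewrite dvdn_divRL// mulnC.
rewrite H [RHS](H (fun e d => F d e)) (exchange_big_dep_nat predT)//=.
by apply: eq_bigr => e _; apply: eq_bigl => d; rewrite mulnC.
Qed.

Lemma mobius1 : mobius 1 = 1.
Proof. by rewrite /mobius /= big_nil. Qed.

Lemma mobius_abs n : `|mobius n| <= 1.
Proof. by rewrite /mobius; case: ifP => _; rewrite ?normr0// normrX normrN1 expr1n. Qed.

Lemma primesMprime p e : prime p -> (0 < e)%N -> ~~ (p %| e)%N ->
  perm_eq (primes (p * e)) (p :: primes e).
Proof.
move=> pp e0 pe; apply: uniq_perm; rewrite ?primes_uniq//=.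
  by rewrite mem_primes (negPf pe) !andbF primes_uniq.
move=> q; by rewrite primesM ?(prime_gt0 pp)// primes_prime// mem_seq1 in_cons.
Qed.

Lemma mobius_primeM p e : prime p -> ~~ (p %| e)%N ->
  mobius (p * e) = - mobius e.
Proof.
move=> pp pe.
have e0 : (0 < e)%N by case: e pe => //; rewrite dvdn0.
have pr := primesMprime pp e0 pe.
rewrite /mobius (perm_big _ pr) (perm_size pr) /= big_cons.
rewrite eqn_pmul2l ?prime_gt0//; case: ifP => _; by rewrite ?oppr0// exprS mulN1r.
Qed.

(** [p * e] has the same prime divisors as [e], so their product is at most [e], too small to equal
    [p * e]. *)
Lemma mobius_sq p e : prime p -> (p %| e)%N -> mobius (p * e) = 0.
Proof.
move=> pp pe; case: (posnP e) => [->|e0]; first by rewrite muln0 /mobius big_nil.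
have rad : (\prod_(q <- primes e) q <= e)%N.
  have E := prod_prime_decomp e0.
  apply: (@leq_trans (\prod_(f <- prime_decomp e) f.1 ^ f.2)%N); last by rewrite -E.
  rewrite prime_decompE big_map/=.
  rewrite big_seq [leqRHS]big_seq; apply: leq_prod => q qe.
  rewrite -{1}(expn1 q) leq_pexp2l ?logn_gt0//.
  by move: qe; rewrite mem_primes => /andP[/prime_gt0].
have pr : perm_eq (primes (p * e)) (primes e).
  apply: uniq_perm; rewrite ?primes_uniq// => q.
  rewrite primesM ?(prime_gt0 pp)// primes_prime// mem_seq1.
  by case: eqP => // ->; rewrite mem_primes pp e0 pe.
rewrite /mobius (perm_big _ pr); case: eqP => // E.
have := prime_gt1 pp; move: rad; rewrite -E; nia.
Qed.

(** For a prime [p] dividing [n], the divisors prime to [p] cancel against their multiples by [p],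
    and the multiples of [p ^ 2] contribute nothing. *)
Lemma sum_mobius_divisors n : (0 < n)%N ->
  \sum_(1 <= d < n.+1 | (d %| n)%N) mobius d = (n == 1)%:R.
Proof.
move=> n0; case: (ltngtP n 1) => [|n1|->]; first by case: n n0.
  set p := pdiv n; have pp : prime p by apply: pdiv_prime.
  have pn : (p %| n)%N by apply: pdiv_dvd.
  have p0 := prime_gt0 pp.
  rewrite (bigID (fun d => (p %| d)%N))/= addrC.
  have -> : \sum_(1 <= d < n.+1 | (d %| n)%N && (p %| d)%N) mobius d
    = - \sum_(1 <= d < n.+1 | (d %| n)%N && ~~ (p %| d)%N) mobius d; last exact: subrr.
  under eq_bigl do rewrite andbC.
  rewrite big_mkcondr/= sum_multiples// -big_mkcond/= -sumrN.
  rewrite [RHS](big_cat_nat (n := (n %/ p).+1))//=; last by rewrite ltnS leq_div.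
  rewrite [X in _ = _ + X]big1_seq ?addr0; last first.
    move=> d; rewrite mem_index_iota => /andP[/andP[dn pd] /andP[d1 _]].
    have : (p * d %| n)%N.
      by rewrite Gauss_dvd ?pn// prime_coprime.
    by move/(dvdn_leq n0); move: d1; rewrite ltn_divLR// mulnC; lia.
  rewrite (bigID (fun d => (p %| d)%N))/= big1 ?add0r; last first.
    by move=> d /andP[_ pd]; rewrite mobius_sq.
  rewrite big_mkcond [RHS]big_mkcond; apply: eq_bigr => d _.
  case: (boolP (p %| d)%N) => pd; first by rewrite !andbF.
  rewrite !andbT mobius_primeM// Gauss_dvd ?pn// prime_coprime//.
by rewrite big_mkcond big_nat1/= mobius1.
Qed.

(** * The von Mangoldt function and Moebius inversion *)

Section von_Mangoldt.
Variable R : realType.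
Local Notation mu d := ((mobius d)%:~R : R).

(** At most one term is nonzero, since a prime power determines its base and its exponent [k >= 1].
    The form of a double sum lets the order of summation be exchanged directly. *)
Definition von_mangoldt (n : nat) : R :=
  \sum_(1 <= p < n.+1 | prime p) \sum_(1 <= k < n.+1 | n == (p ^ k)%N) ln p%:R.

Lemma ln_nat_ge0 n : 0 <= ln (n%:R : R).
Proof. by case: n => [|n]; [rewrite ln0|rewrite ln_ge0// ler1n]. Qed.

Lemma von_mangoldt_ge0 n : 0 <= von_mangoldt n.
Proof. by apply: sumr_ge0 => p _; apply: sumr_ge0 => k _; exact: ln_nat_ge0. Qed.

Lemma ln_prod (I : Type) (r : seq I) (P : pred I) (F : I -> nat) :
  (forall i, P i -> (0 < F i)%N) ->
  ln ((\prod_(i <- r | P i) F i)%N%:R : R) = \sum_(i <- r | P i) ln (F i)%:R.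
Proof.
move=> F0; elim: r => [|a r IH]; first by rewrite !big_nil ln1.
rewrite !big_cons; case: ifP => // Pa; rewrite natrM lnM ?IH// posrE ltr0n; first exact: F0.
by rewrite prodn_cond_gt0.
Qed.

Lemma ln_nat_factors n : (0 < n)%N ->
  ln (n%:R : R) = \sum_(1 <= p < n.+1 | prime p) (logn p n)%:R * ln p%:R.
Proof.
move=> n0; rewrite -{1}(partnT n0) /partn ln_prod; last first.
  move=> i _; case: i => [|i]; last by rewrite expn_gt0.
  by rewrite lognE.
rewrite big_nat_recl//= lognE/= expn0 ln1 add0r.
rewrite big_add1/= [RHS]big_mkcond/=; apply: eq_bigr => p _.
case: ifPn => pp; last by rewrite lognE (negPf pp) expn0 ln1.
by rewrite natrX lnXn ?ltr0n ?prime_gt0// mulr_natl.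
Qed.

Lemma sum_von_mangoldt n : (0 < n)%N ->
  \sum_(1 <= d < n.+1 | (d %| n)%N) von_mangoldt d = ln n%:R.
Proof.
move=> n0; rewrite ln_nat_factors//.
(* The ranges of [p] and [k] are extended from [d] to [n], which adds only zeros because [d = p ^ k]
   forces [p, k <= d]. They no longer depend on [d], so the sums can be exchanged. *)
have E d : (1 <= d < n.+1)%N -> von_mangoldt d =
    \sum_(1 <= p < n.+1 | prime p) \sum_(1 <= k < n.+1 | d == (p ^ k)%N) ln p%:R.
  move=> /andP[d1 dn]; rewrite /von_mangoldt.
  have X p : prime p -> \sum_(1 <= k < n.+1 | d == (p ^ k)%N) ln p%:R =
      \sum_(1 <= k < d.+1 | d == (p ^ k)%N) ln p%:R :> R.
    move=> pp; rewrite (big_cat_nat (n := d.+1))//= [X in _ + X]big1_seq ?addr0//.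
    move=> k; rewrite mem_index_iota => /andP[/eqP dk /andP[kd _]].
    by have := ltn_expl k (prime_gt1 pp); lia.
  rewrite [RHS](big_cat_nat (n := d.+1))//= [X in _ = _ + X]big1_seq ?addr0//.
    by apply: eq_bigr => p pp; rewrite X.
  move=> p; rewrite mem_index_iota => /andP[pp /andP[pd _]].
  rewrite big1_seq// => k; rewrite mem_index_iota => /andP[/eqP dk /andP[k1 _]].
  have : (p ^ 1 <= p ^ k)%N by rewrite leq_pexp2l// prime_gt0.
  by rewrite expn1; lia.
transitivity (\sum_(1 <= d < n.+1 | (d %| n)%N)
   \sum_(1 <= p < n.+1 | prime p) \sum_(1 <= k < n.+1 | d == (p ^ k)%N) (ln p%:R : R)).
  by rewrite big_nat_cond [RHS]big_nat_cond; apply: eq_bigr => d /andP[dn _]; rewrite E.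
rewrite exchange_big/=; apply: eq_bigr => p pp.
rewrite (exchange_big_dep_nat predT)//=.
transitivity (\sum_(1 <= k < n.+1 | (p ^ k %| n)%N) (ln p%:R : R)).
  rewrite [RHS]big_mkcond; apply: eq_bigr => k _.
  case: ifPn => pk; last first.
    by rewrite big1// => d /andP[/[swap] /eqP ->]; rewrite (negPf pk).
  rewrite (eq_bigl (xpred1 (p ^ k)%N)); last first.
    by move=> d /=; case: eqP => [->|]; rewrite ?pk ?andbF.
  by rewrite big_nat1_eq expn_gt0 prime_gt0//= ltnS dvdn_leq.
have ln_n : (logn p n < n.+1)%N.
  by rewrite ltnS; apply: ltnW; apply: ltn_logl.
rewrite (eq_bigl (fun k => k <= logn p n)%N); last by move=> k; rewrite pfactor_dvdn.
rewrite (big_cat_nat (n := (logn p n).+1))//= [X in _ + X]big1_seq ?addr0; last first.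
  by move=> k; rewrite mem_index_iota => /andP[]; lia.
rewrite big_nat_cond (eq_bigl (fun k => 1 <= k < (logn p n).+1)%N); last by move=> k; lia.
by rewrite -big_nat sumr_const_nat subn1 mulr_natl.
Qed.

(** Moebius inversion of [sum_von_mangoldt]: once the two divisor sums are exchanged, the inner sum
    of [mu] vanishes except for [e = n]. *)
Lemma sum_mobius_ln n : (0 < n)%N ->
  \sum_(1 <= d < n.+1 | (d %| n)%N) mu d * ln (n %/ d)%N%:R = von_mangoldt n.
Proof.
move=> n0.
transitivity (\sum_(1 <= d < n.+1 | (d %| n)%N)
    \sum_(1 <= e < (n %/ d).+1 | (e %| n %/ d)%N) mu d * von_mangoldt e).
  rewrite big_nat_cond [RHS]big_nat_cond; apply: eq_bigr => d /andP[/andP[d1 dn] dv].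
  by rewrite -big_distrr/= sum_von_mangoldt// divn_gt0.
rewrite sum_divisors_pairs//.
transitivity (\sum_(1 <= e < n.+1 | (e %| n)%N) (e == n)%:R * von_mangoldt e).
  rewrite big_nat_cond [RHS]big_nat_cond; apply: eq_bigr => e /andP[/andP[e1 en] ev].
  rewrite -big_distrl/= -rmorph_sum/= sum_mobius_divisors ?divn_gt0// natz -pmulrn.
  congr (_%:R * _); congr nat_of_bool.
  apply/eqP/eqP => [|->]; last by rewrite divnn n0.
  by move: ev => /divnK; lia.
rewrite big_mkcond (bigD1_seq n)/= ?iota_uniq// ?mem_index_iota ?n0 ?ltnSn// dvdnn eqxx mul1r.
by rewrite big1 ?addr0// => e /negPf ->; rewrite mul0r if_same.
Qed.

(* [F k = psi (N %/ k) - N / k + c] gives Selberg's formula, and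
   [F k = M (N %/ k)], with [M] the Mertens function, gives [mertens_fun_log]. *)
Lemma tatuzawa_iseki (N : nat) (F : nat -> R) : (0 < N)%N ->
  \sum_(1 <= d < N.+1) mu d * ln (N%:R / d%:R)
     * \sum_(1 <= m < (N %/ d).+1) F (d * m)%N
  = F 1%N * ln N%:R + \sum_(1 <= k < N.+1) von_mangoldt k * F k.
Proof.
move=> N0; under eq_bigr do rewrite big_distrr/=.
rewrite (sum_divisors_weight N (fun d k => mu d * ln (N%:R / d%:R) * F k)).
transitivity (\sum_(1 <= k < N.+1) ((k == 1)%:R * ln (N%:R) + von_mangoldt k) * F k).
  apply: eq_big_nat => k /andP[k1 kN]; rewrite -big_distrl/=; congr (_ * _).
  (* [ln (N / d) = ln (N / k) + ln (k / d)]: summed against [mu d], the first part survives only for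
     [k = 1], and the second gives [von_mangoldt k]. *)
  transitivity (\sum_(1 <= d < k.+1 | (d %| k)%N)
     (mu d * ln (N%:R / k%:R) + mu d * ln (k %/ d)%N%:R)).
    rewrite big_nat_cond [RHS]big_nat_cond.
    apply: eq_bigr => d /andP[/andP[d1 dk] dv]; rewrite -mulrDr; congr (_ * _).
    have d0 : 0 < d%:R :> R by rewrite ltr0n.
    have k0 : 0 < k%:R :> R by rewrite ltr0n.
    have N0' : 0 < N%:R :> R by rewrite ltr0n.
    have q0 : 0 < (k %/ d)%:R :> R by rewrite ltr0n divn_gt0.
    rewrite -lnM ?posrE// ?divr_gt0//; congr ln.
    have : k%:R = (k %/ d)%:R * d%:R :> R by rewrite -natrM divnK.
    move=> ->; field; by rewrite !gt_eqF.
  rewrite big_split/= sum_mobius_ln// -big_distrl/= -rmorph_sum/= sum_mobius_divisors//.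
  rewrite natz -pmulrn; congr (_ + _); case: eqP => [->|]; rewrite ?mul0r// divr1//.
under eq_bigr do rewrite mulrDl.
rewrite big_split/=; congr (_ + _).
rewrite (bigD1_seq 1)/= ?iota_uniq// ?mem_index_iota ?N0//= mul1r mulrC big1 ?addr0//.
by move=> k /negPf ->; rewrite !mul0r.
Qed.

End von_Mangoldt.

(** * Summation by parts, harmonic sums and logarithms *)

Lemma sum_hyperbola_sym (V : nmodType) (N : nat) (F : nat -> nat -> V) :
  \sum_(1 <= d < N.+1) \sum_(1 <= m < (N %/ d).+1) F d m
  = \sum_(1 <= m < N.+1) \sum_(1 <= d < (N %/ m).+1) F d m.
Proof.
have H (G : nat -> nat -> V) :
  \sum_(1 <= d < N.+1) \sum_(1 <= m < (N %/ d).+1) G d m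
  = \sum_(1 <= d < N.+1) \sum_(1 <= m < N.+1 | (d * m <= N)%N) G d m.
  apply: eq_big_nat => d /andP[d1 dn].
  rewrite [RHS](big_cat_nat (n := (N %/ d).+1))//=; last by rewrite ltnS leq_div.
  rewrite [X in _ = _ + X]big1_seq ?addr0//=; last first.
    move=> e; rewrite mem_index_iota => /andP[de /andP[e1 _]].
    by move: e1; rewrite ltn_divLR// mulnC ltnNge de.
  rewrite big_nat_cond [RHS]big_nat_cond; apply: eq_bigl => e.
  rewrite andbT; case: (boolP (1 <= e < _)%N) => //= /andP[_].
  by rewrite ltnS leq_divRL// mulnC => ->.
rewrite H [RHS](H (fun e d => F d e)) (exchange_big_dep_nat predT)//=.
by apply: eq_bigr => e _; apply: eq_bigl => d; rewrite mulnC.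
Qed.

(** The hypothesis removes the boundary term; it is met by functions of [N %/ k] that vanish at
    0. *)
Lemma sum_by_parts (V : pzRingType) (N : nat) (a B : nat -> V) :
  B N.+1 = 0 ->
  \sum_(1 <= k < N.+1) a k * B k
  = \sum_(1 <= k < N.+1) (\sum_(1 <= j < k.+1) a j) * (B k - B k.+1).
Proof.
move=> BN; suff H n : \sum_(1 <= k < n.+1) a k * B k
  = \sum_(1 <= k < n.+1) (\sum_(1 <= j < k.+1) a j) * (B k - B k.+1)
    + (\sum_(1 <= j < n.+1) a j) * B n.+1 by rewrite H BN mulr0 addr0.
elim: n => [|n IH]; first by rewrite !big_geq// mul0r addr0.
rewrite !(big_nat_recr n.+1)//= IH -!addrA; congr (_ + _).
by rewrite mulrBr subrK mulrDl.
Qed.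

Section harmonic.
Variable R : realType.
Local Notation ln n := (ln (n%:R : R)).

Definition harm (n : nat) : R := \sum_(1 <= k < n.+1) k%:R^-1.
Definition lnfact (n : nat) : R := \sum_(1 <= k < n.+1) ln k.

Lemma harmS n : harm n.+1 = harm n + n.+1%:R^-1.
Proof. by rewrite /harm big_nat_recr. Qed.

Lemma lnfactS n : lnfact n.+1 = lnfact n + ln n.+1.
Proof. by rewrite /lnfact big_nat_recr. Qed.

Lemma harm_ge0 n : 0 <= harm n.
Proof. by apply: sumr_ge0 => i _; rewrite invr_ge0. Qed.

Lemma ln_le n m : (0 < n)%N -> (n <= m)%N -> ln n <= ln m.
Proof. by move=> n0 nm; rewrite ler_ln ?posrE ?ltr0n ?ler_nat//; lia. Qed.

Lemma ln_leN n : (0 < n)%N -> ln n <= n%:R.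
Proof. by move=> n0; apply/ltW/ln_sublinear; rewrite ltr0n. Qed.

Lemma lnS_le n : (0 < n)%N -> ln n.+1 - ln n <= n%:R^-1.
Proof.
move=> n0; have n0' : 0 < n%:R :> R by rewrite ltr0n.
rewrite -ln_div ?posrE//.
have -> : n.+1%:R / n%:R = 1 + n%:R^-1 :> R by rewrite -natr1; field; rewrite gt_eqF.
by apply: le_ln1Dx; apply: (lt_trans _ (_ : 0 < _)); rewrite ?invr_gt0// ltrN10.
Qed.

Lemma lnS_ge n : (0 < n)%N -> n.+1%:R^-1 <= ln n.+1 - ln n.
Proof.
move=> n0; have n0' : 0 < n%:R :> R by rewrite ltr0n.
have n1' : 1 <= n%:R :> R by rewrite ler1n.
rewrite -[leRHS]opprK opprB -ln_div ?posrE//.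
have -> : n%:R / n.+1%:R = 1 + (- n.+1%:R^-1) :> R.
  by rewrite -natr1; field; rewrite natr1 pnatr_eq0.
rewrite lerNr; apply: le_ln1Dx.
rewrite ltrN2 invf_lt1 ?ltr0n//; rewrite -natr1; lra.
Qed.

(** [g] is Euler's constant, the supremum of the increasing sequence [harm j - ln j.+1]. The
    decreasing sequence [harm k - ln k] bounds it from above, and the two differ by at most [1 / n]
    at [n]. *)
Lemma harm_gamma : exists g : R, forall n, (0 < n)%N ->
  0 <= harm n - ln n - g <= n%:R^-1.
Proof.
have dec n : (0 < n)%N -> harm n.+1 - ln n.+1 <= harm n - ln n.
  by move=> n0; rewrite harmS; move: (lnS_ge n0); move: (n.+1%:R^-1) => v; lra.
have inc n : (0 < n)%N -> harm n - ln n.+1 <= harm n.+1 - ln n.+2.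
  by move=> n0; rewrite harmS; move: (@lnS_le n.+1 isT); move: (n.+1%:R^-1) => v; lra.
have decm n k : (0 < n)%N -> harm (n + k)%N - ln (n + k)%N <= harm n - ln n.
  move=> n0; elim: k => [|k IH]; first by rewrite addn0.
  by rewrite addnS; apply: le_trans (dec _ _) IH; lia.
have incm n k : (0 < n)%N -> harm n - ln n.+1 <= harm (n + k)%N - ln (n + k).+1.
  move=> n0; elim: k => [|k IH]; first by rewrite addn0.
  by rewrite addnS; apply: le_trans IH (inc _ _); lia.
have cmp j k : (0 < j)%N -> (0 < k)%N -> harm j - ln j.+1 <= harm k - ln k.
  move=> j0 k0; have := decm k j k0; have := incm j k j0; rewrite [(k + j)%N]addnC.
  have : ln (j + k)%N <= ln (j + k).+1 by apply: ln_le; lia.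
  lra.
pose E := [set x : R | exists2 j, (0 < j)%N & x = harm j - ln j.+1].
have E0 : E !=set0 by exists (harm 1 - ln 2); exists 1%N.
have EU : has_sup E.
  split=> //; exists (harm 1 - ln 1) => x [j j0 ->]; exact: cmp.
exists (sup E) => n n0; apply/andP; split.
  have : sup E <= harm n - ln n.
    by apply: ge_sup => // x [j j0 ->]; exact: cmp.
  lra.
have : harm n - ln n.+1 <= sup E by apply: ub_le_sup; [exact: EU.2|exists n].
by have := lnS_le n0; lra.
Qed.

Lemma harm_le n : (0 < n)%N -> harm n <= 1 + ln n.
Proof.
elim: n => // -[|n] IH _; first by rewrite /harm big_nat1 ln1 invr1 addr0.
rewrite harmS; move: (IH isT) (@lnS_ge n.+1 isT); move: (n.+2%:R^-1) => v; lra.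
Qed.

Lemma harm_ge n : ln n.+1 <= harm n.
Proof.
elim: n => [|n IH]; first by rewrite /harm big_geq// ln1.
rewrite harmS; move: IH (@lnS_le n.+1 isT); move: (n.+1%:R^-1) => v; lra.
Qed.

(** Sum [harm k = ln k + g + error] over [k <= n]: the left side adds up to [(n + 1) * harm n - n],
    whence [c = 1 + g], and the errors, each in [[0, 1 / k]], to something between 0 and
    [harm n]. *)
Lemma lnfact_harm : exists c : R, forall n,
  0 <= lnfact n - n%:R * harm n + c * n%:R <= harm n.
Proof.
have [g Hg] := harm_gamma; exists (1 + g) => n.
have E : \sum_(1 <= k < n.+1) harm k = (n%:R + 1) * harm n - n%:R.
  elim: n => [|n IH]; first by rewrite big_geq// /harm big_geq// mulr0 subr0.
  rewrite big_nat_recr//= IH harmS -!natr1; field.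
  by rewrite natr1 pnatr_eq0.
have : 0 <= \sum_(1 <= k < n.+1) harm k - lnfact n - g * n%:R <= harm n.
  elim: n {E} => [|n IH].
    by rewrite /lnfact /harm !big_geq// mulr0 !subr0 !lexx.
  rewrite big_nat_recr//= lnfactS.
  move: (Hg n.+1 isT) IH (harmS n); move: (n.+1%:R^-1) => v.
  move: (\sum_(_ <= _ < _) _) => S; rewrite -natr1; lra.
rewrite E; lra.
Qed.

Lemma lnfact_le n : lnfact n <= n%:R * ln n.
Proof.
have -> : n%:R * ln n = \sum_(1 <= k < n.+1) ln n.
  by rewrite sumr_const_nat subn1/= mulr_natl.
by apply: ler_sum_nat => k /andP[k1 kn]; apply: ln_le.
Qed.

Lemma lnfact_ge n : n%:R * ln n - n%:R <= lnfact n.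
Proof.
elim: n => [|n IH]; first by rewrite mul0r subr0 /lnfact big_geq.
rewrite lnfactS; case: n IH => [|n] IH; first by rewrite ln1 /lnfact big_geq//; lra.
have := @lnS_le n.+1 isT; set a := ln n.+2; set b := ln n.+1 => ab.
have n0 : 0 < n.+1%:R :> R by [].
have : n.+1%:R * (a - b) <= 1.
  by have := ler_wpM2l (ltW n0) ab; rewrite mulfV ?gt_eqF.
move: IH; rewrite -/b -(natr1 n.+1); set m := n.+1%:R; nra.
Qed.

Lemma ln_sqrt (y : R) : 0 < y -> exp.ln y = 2 * exp.ln (Num.sqrt y).
Proof.
move=> y0; rewrite -{1}(sqr_sqrtr (ltW y0)) lnXn ?sqrtr_gt0//.
by rewrite mulr2n; ring.
Qed.

(** With [t] the fourth root of [y] and [l = ln t <= t], the left side is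
    [4 l + 16 l ^ 2 <= 20 t ^ 2]. The square root is convenient because, by [sum_invsqrt], its sum
    over [y = N / d] is of order [N]. *)
Lemma ln_sq_le_sqrt (y : R) : 1 <= y -> exp.ln y * (1 + exp.ln y) <= 20 * Num.sqrt y.
Proof.
move=> y1; have y0 : 0 < y by lra.
set s := Num.sqrt y; set t := Num.sqrt s.
have s1 : 1 <= s by rewrite -(sqrtr1 R) ler_wsqrtr.
have s0 : 0 < s by lra.
have t1 : 1 <= t by rewrite -(sqrtr1 R) ler_wsqrtr.
have t0 : 0 < t by lra.
have tE : s = t ^+ 2 by rewrite sqr_sqrtr// ltW.
have E : exp.ln y = 4 * exp.ln t by rewrite ln_sqrt// -/s (ln_sqrt s0) -/t; ring.
have lt : exp.ln t <= t by apply/ltW/ln_sublinear.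
have l0 : 0 <= exp.ln t by apply: ln_ge0.
rewrite E tE; move: lt l0 t1; set l := exp.ln t; nra.
Qed.

Lemma sum_invsqrt (N : nat) :
  \sum_(1 <= d < N.+1) Num.sqrt (N%:R / d%:R) <= 2 * N%:R :> R.
Proof.
have H n : \sum_(1 <= d < n.+1) Num.sqrt (d%:R^-1) <= 2 * Num.sqrt n%:R :> R.
  elim: n => [|n IH]; first by rewrite big_geq// sqrtr0 mulr0.
  rewrite big_nat_recr//= ; apply: (le_trans (lerD IH (lexx _))).
  rewrite sqrtrV//; set a := Num.sqrt n%:R; set b := Num.sqrt n.+1%:R.
  have b0 : 0 < b by rewrite sqrtr_gt0.
  have a0 : 0 <= a by rewrite sqrtr_ge0.
  have E : b ^+ 2 = a ^+ 2 + 1 by rewrite !sqr_sqrtr// natr1.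
  rewrite -(ler_pM2l b0) mulrDr divff ?gt_eqF//; nra.
case: N => [|N]; first by rewrite big_geq// mulr0.
under eq_bigr do rewrite sqrtrM//.
rewrite -big_distrr/=; apply: (le_trans (ler_wpM2l (sqrtr_ge0 _) (H _))).
by rewrite mulrCA -expr2 sqr_sqrtr.
Qed.

Lemma sum_invsq (N : nat) : \sum_(1 <= d < N.+1) (d%:R ^- 2) <= 2 :> R.
Proof.
suff H : \sum_(1 <= d < N.+2) (d%:R ^- 2) <= 2 - N.+1%:R^-1 :> R.
  rewrite big_nat_recr//= in H; apply: (le_trans _ (le_trans H _)).
    by rewrite lerDl invr_ge0 exprn_ge0.
  by rewrite gerBl invr_ge0.
elim: N => [|N IH]; first by rewrite big_nat1 expr1n invr1; lra.
rewrite big_nat_recr//=; apply: (le_trans (lerD IH (lexx _))).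
rewrite -(natr1 N.+1); set m := N.+1%:R; have m0 : 0 < m :> R by [].
rewrite -subr_ge0.
have -> : 2 - (m + 1)^-1 - (2 - m^-1 + (m + 1) ^- 2) = (m * (m + 1) ^+ 2)^-1.
  by field; rewrite !gt_eqF//; lra.
by rewrite invr_ge0 mulr_ge0 ?sqr_ge0 ?ltW.
Qed.

End harmonic.

(** * Chebyshev's bound, Mertens' theorem and Selberg's formula *)

Section selberg.
Variable R : realType.
Local Notation ln n := (exp.ln (n%:R : R)).
Local Notation mu d := ((mobius d)%:~R : R).
Local Notation vM := (@von_mangoldt R).
Local Notation harm := (@harm R).
Local Notation lnfact := (@lnfact R).

Definition chebyshev_psi (N : nat) : R := \sum_(1 <= k < N.+1) vM k.
Local Notation psi := chebyshev_psi.

Lemma psi_ge0 N : 0 <= psi N.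
Proof. by apply: sumr_ge0 => k _; exact: von_mangoldt_ge0. Qed.

Lemma sum_vM_div N : \sum_(1 <= k < N.+1) vM k * (N %/ k)%:R = lnfact N.
Proof.
transitivity (\sum_(1 <= k < N.+1) \sum_(1 <= m < (N %/ k).+1) vM k).
  by apply: eq_bigr => k _; rewrite sumr_const_nat subn1/= mulr_natr.
rewrite -(sum_divisors N (fun k _ => vM k)); apply: eq_big_nat => k /andP[k0 _].
by rewrite sum_von_mangoldt.
Qed.

Lemma sum_psi_div N : \sum_(1 <= k < N.+1) psi (N %/ k) = lnfact N.
Proof.
rewrite -sum_vM_div /psi (sum_hyperbola_sym N (fun _ m => vM m)).
by apply: eq_bigr => k _; rewrite sumr_const_nat subn1/= mulr_natr.
Qed.

(** Chebyshev's argument: by [sum_vM_div], the right side weights [vM k] by the parity of [N %/ k],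
    which is never negative and equals 1 for [N %/ 2 < k <= N]. *)
Lemma psi_half N : psi N - psi (N %/ 2) <= lnfact N - 2 * lnfact (N %/ 2).
Proof.
rewrite -!sum_vM_div.
have nm : ((N %/ 2) <= N)%N by rewrite leq_div.
have E : \sum_(1 <= k < (N %/ 2).+1) vM k * (N %/ 2 %/ k)%:R
  = \sum_(1 <= k < N.+1) vM k * (N %/ 2 %/ k)%:R.
  rewrite [RHS](big_cat_nat (n := (N %/ 2).+1))//=.
  rewrite [X in _ = _ + X]big1_seq ?addr0// => k; rewrite mem_index_iota => /andP[_ /andP[kN _]].
  by rewrite divn_small ?mulr0.
rewrite E big_distrr -sumrB/=.
rewrite /psi [X in X - _](big_cat_nat (n := (N %/ 2).+1))//= addrAC subrr add0r.
rewrite [leRHS](big_cat_nat (n := (N %/ 2).+1))//=.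
have H k : vM k * (N %/ k)%:R - 2 * (vM k * (N %/ 2 %/ k)%:R) = vM k * (odd (N %/ k))%:R.
  rewrite -divnMA mulnC divnMA {1}(divn_eq (N %/ k) 2) modn2 natrD natrM.
  ring.
rewrite -[leLHS]add0r; apply: lerD.
  by apply: sumr_ge0 => k _; rewrite H mulr_ge0 ?von_mangoldt_ge0.
apply: ler_sum_nat => k /andP[k1 kN]; rewrite H.
suff -> : (N %/ k = 1)%N by rewrite mulr1.
have k0 : (0 < k)%N by lia.
have : (0 < N %/ k)%N by rewrite divn_gt0.
have : (N %/ k < 2)%N by rewrite ltn_divLR//; lia.
lia.
Qed.

(** Strong induction by halving: with [m = N %/ 2], [psi_half] and the bounds on [lnfact] make
    [psi N - psi m] linear in [N], because the main terms [N * ln N] and [2 * m * ln m] cancel. *)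
Lemma psi_le N : psi N <= 8 * N%:R.
Proof.
elim/ltn_ind: N => N IH.
case: (ltnP N 2) => N2.
  case: N N2 {IH} => [|[|]]// _; first by rewrite /psi big_geq ?mulr0.
  rewrite /psi big_nat1 /von_mangoldt big_nat_cond big1 ?mulr_ge0//.
  by move=> [|[|i]]// /andP[].
have m1 : (1 <= N %/ 2)%N by rewrite divn_gt0.
have mN' : (N %/ 2 < N)%N by lia.
have := IH _ mN'; have := psi_half N.
have := lnfact_le R N; have := lnfact_ge R (N %/ 2)%N.
set m := (N %/ 2)%N in m1 *.
have Nm : N%:R <= 2 * m%:R + 1 :> R.
  by rewrite -natrM natr1 ler_nat; rewrite /m; lia.
have mN : 2 * m%:R <= N%:R :> R.
  by rewrite -natrM ler_nat; rewrite /m; lia.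
have l1 : ln N <= ln m + 2.
  have : ln N <= exp.ln (3 * m%:R).
    rewrite ler_ln ?posrE; [|by rewrite ltr0n; lia|by rewrite mulr_gt0// ltr0n].
    have : 1 <= m%:R :> R by rewrite ler1n.
    lra.
  rewrite lnM ?posrE ?ltr0n//.
  have : exp.ln (1 + 2) <= 2 :> R by apply: le_ln1Dx; lra.
  have -> : 1 + 2 = 3 :> R by lra.
  lra.
have l2 : ln m <= m%:R by exact: ln_leN.
have l3 : 0 <= ln m by exact: ln_nat_ge0.
have m1' : 1 <= m%:R :> R by rewrite ler1n.
move: Nm mN l1 l2 l3 m1'; move: (ln N) (ln m) (N%:R) (m%:R : R) => a b x y.
nra.
Qed.

(** Removing the integer part in [sum_vM_div] costs at most [vM k] for each [k], so [N] times the
    sum differs from [lnfact N] by at most [psi N <= 8 * N]. *)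
Lemma mertens N : (0 < N)%N ->
  -1 <= \sum_(1 <= k < N.+1) vM k / k%:R - ln N <= 8.
Proof.
move=> N0; have N0' : 0 < N%:R :> R by rewrite ltr0n.
set S := \sum_(_ <= _ < _) _.
have lo : lnfact N <= N%:R * S.
  rewrite -sum_vM_div /S big_distrr/=; apply: ler_sum_nat => k /andP[k1 _].
  rewrite mulrCA ler_wpM2l ?von_mangoldt_ge0// ler_pdivlMr ?ltr0n//.
  by rewrite -natrM ler_nat leq_trunc_div.
have hi : N%:R * S <= lnfact N + psi N.
  rewrite -sum_vM_div /S big_distrr/= /psi -big_split/=.
  apply: ler_sum_nat => k /andP[k1 _].
  rewrite mulrCA -{3}[vM k]mulr1 -mulrDr ler_wpM2l ?von_mangoldt_ge0//.
  rewrite ler_pdivrMr ?ltr0n// natr1 -natrM ler_nat ltnW// ltn_ceil//.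
have := lnfact_le R N; have := lnfact_ge R N; have := psi_le N.
move=> p1 p2 p3; rewrite -(ler_pM2l N0') -[X in _ && X](ler_pM2l N0') !mulrBr; lra.
Qed.

Lemma quot_bounds N d : (0 < d)%N ->
  (N %/ d)%:R <= N%:R / d%:R :> R /\ N%:R / d%:R <= (N %/ d)%:R + 1 :> R.
Proof.
move=> d0; split; first by rewrite ler_pdivlMr ?ltr0n// -natrM ler_nat leq_trunc_div.
by rewrite ler_pdivrMr ?ltr0n// natr1 -natrM ler_nat ltnW// ltn_ceil.
Qed.

Lemma ln_quot_ge N d : (0 < d)%N -> (d <= N)%N -> ln (N %/ d)%N <= exp.ln (N%:R / d%:R).
Proof.
move=> d0 dN; have q0 : (0 < N %/ d)%N by rewrite divn_gt0.
rewrite ler_ln ?posrE ?divr_gt0 ?ltr0n//; last lia.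
by have [] := quot_bounds N d0.
Qed.

(** The constant [c] of [lnfact_harm] makes the inner sums of [tatuzawa_iseki] as small as [harm n]
    with [n = N %/ d]. Weighted by [ln (N / d)] they are at most [20 * sqrt (N / d)], of total order
    [N]. Mertens' theorem and Chebyshev's bound evaluate the terms that [- N / k + c] adds on the
    other side. *)
Lemma selberg : exists2 C : R, 0 <= C & forall N, (0 < N)%N ->
  `|psi N * ln N + \sum_(1 <= k < N.+1) vM k * psi (N %/ k) - 2 * (N%:R * ln N)|
  <= C * N%:R.
Proof.
have [c Hc] := lnfact_harm R.
exists (49 + 9 * `|c|) => [|N N0]; first by rewrite addr_ge0// mulr_ge0.
have N0' : 0 < N%:R :> R by rewrite ltr0n.
have := tatuzawa_iseki (fun k => psi (N %/ k) - N%:R / k%:R + c) N0.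
set LHS := \sum_(1 <= d < _) _ => TI.
have bL : `|LHS| <= 40 * N%:R.
  apply: (le_trans (ler_norm_sum _ _ _)).
  have -> : 40 * N%:R = 20 * (2 * N%:R) :> R by ring.
  apply: (le_trans _ (ler_wpM2l _ (sum_invsqrt R N))) => //.
  rewrite big_distrr/=; apply: ler_sum_nat => d /andP[d1 dN].
  have y1 : 1 <= N%:R / d%:R :> R by rewrite ler_pdivlMr ?ltr0n// mul1r ler_nat.
  apply: (le_trans _ (ln_sq_le_sqrt y1)).
  have l0 : 0 <= exp.ln (N%:R / d%:R) :> R by apply: ln_ge0.
  rewrite normrM normrM [X in _ * X * _]ger0_norm//.
  set n := (N %/ d)%N; have n0 : (0 < n)%N by rewrite divn_gt0.
  rewrite [X in _ * `|X|](_ : _ = lnfact n - N%:R / d%:R * harm n + c * n%:R); last first.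
    rewrite /= big_split sumrB /= sumr_const_nat subn1/= mulr_natr; congr (_ - _ + _).
      by rewrite -sum_psi_div; apply: eq_bigr => m _; rewrite divnMA.
    by rewrite /harm big_distrr/=; apply: eq_bigr => m _; rewrite natrM invfM mulrA.
  (* With [n] in place of [N / d] the value lies in [[0, harm n]] by [lnfact_harm]; the replacement
     subtracts between 0 and [harm n], so the absolute value keeps the bound [harm n]. *)
  have hn : `|lnfact n - N%:R / d%:R * harm n + c * n%:R| <= harm n.
    have := Hc n; have [q1 q2] := quot_bounds N d1; have := harm_ge0 R n.
    rewrite -/n in q1 q2; rewrite ler_norml; nra.
  have h1 : harm n <= 1 + exp.ln (N%:R / d%:R).
    by apply: (le_trans (harm_le R n0)); rewrite lerD2l; exact: ln_quot_ge.
  have m1 : `|mu d| <= 1 by rewrite -intr_norm (ler_int _ _ 1) mobius_abs.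
  apply: ler_pM => //; first by rewrite mulr_ge0.
    by rewrite -[leRHS]mul1r ler_wpM2r.
  exact: le_trans hn h1.
have E : psi N * ln N + \sum_(1 <= k < N.+1) vM k * psi (N %/ k) - 2 * (N%:R * ln N)
  = LHS + N%:R * (\sum_(1 <= k < N.+1) vM k / k%:R - ln N) - c * ln N - c * psi N.
  rewrite TI divn1 divr1.
  have -> : \sum_(1 <= k < N.+1) vM k * (psi (N %/ k) - N%:R / k%:R + c)
    = \sum_(1 <= k < N.+1) vM k * psi (N %/ k)
      - N%:R * (\sum_(1 <= k < N.+1) vM k / k%:R) + c * psi N.
    rewrite /psi !big_distrr/= -sumrB -big_split/=; apply: eq_bigr => k _; ring.
  ring.
rewrite E.
have M := mertens N0; have P := psi_le N; have P0 := psi_ge0 N.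
have l0 : 0 <= ln N by exact: ln_nat_ge0.
have lN : ln N <= N%:R by exact: ln_leN.
set S := \sum_(_ <= _ < _) _ - _ in M *.
have S8 : `|N%:R * S| <= 8 * N%:R.
  rewrite normrM (ger0_norm (ltW N0')) mulrC ler_pM2r//.
  by rewrite ler_norml; lra.
have c1 : `|c * ln N| <= `|c| * N%:R by rewrite normrM (ger0_norm l0) ler_wpM2l.
have c2 : `|c * psi N| <= `|c| * (8 * N%:R) by rewrite normrM (ger0_norm P0) ler_wpM2l.
move: bL S8 c1 c2; rewrite !ler_norml.
move: LHS {TI E} (N%:R * S) (c * ln N) (c * psi N) => a1 a2 a3 a4.
lra.
Qed.

End selberg.

(** * A recursive inequality for the Mertens function *)

Section mertens_function.
Variable R : realType.
Local Notation ln n := (exp.ln (n%:R : R)).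
Local Notation mu d := ((mobius d)%:~R : R).
Local Notation vM := (@von_mangoldt R).
Local Notation harm := (@harm R).
Local Notation lnfact := (@lnfact R).
Local Notation psi := (@chebyshev_psi R).

Definition mertens_fun (N : nat) : R := \sum_(1 <= k < N.+1) mu k.
Local Notation M := mertens_fun.

Lemma mu_le1 d : `|mu d| <= 1.
Proof. by rewrite -intr_norm (ler_int _ _ 1) mobius_abs. Qed.

Lemma mertens_fun_lip n m : (n <= m)%N -> `|M m - M n| <= (m - n)%:R.
Proof.
move=> nm; rewrite /M (big_cat_nat (n := n.+1))//= addrAC subrr add0r.
apply: (le_trans (ler_norm_sum _ _ _)); rewrite -[(m - n)%N]subSS.
rewrite -[leRHS]mulr1 mulr_natl -sumr_const_nat.
by apply: ler_sum => k _; exact: mu_le1.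
Qed.

Lemma mertens_fun0 : M 0 = 0.
Proof. by rewrite /M big_geq. Qed.

Lemma mertens_fun_le n : `|M n| <= n%:R.
Proof. by have := mertens_fun_lip (leq0n n); rewrite mertens_fun0 subr0 subn0. Qed.

Lemma sum_mertens_div N : (0 < N)%N -> \sum_(1 <= k < N.+1) M (N %/ k) = 1.
Proof.
move=> N0; rewrite /M (sum_hyperbola_sym N (fun _ m => mu m)).
rewrite -(sum_divisors N (fun m _ => mu m)).
transitivity (\sum_(1 <= k < N.+1) ((k == 1)%:R : R)).
  by apply: eq_big_nat => k /andP[k0 _]; rewrite -rmorph_sum/= sum_mobius_divisors// natz -pmulrn.
by rewrite big_ltn// big_nat_cond big1 ?addr0// => -[|[|k]].
Qed.

(** The inner sums of [tatuzawa_iseki] all equal 1 by [sum_mertens_div], so its left side is at most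
    the sum of [ln (N / d)], that is [N * ln N - lnfact N <= N]. *)
Lemma mertens_fun_log N : (0 < N)%N ->
  `|M N * ln N + \sum_(1 <= k < N.+1) vM k * M (N %/ k)| <= N%:R.
Proof.
move=> N0; have := tatuzawa_iseki (fun k => M (N %/ k)) N0; rewrite divn1 => <-.
have N0' : 0 < N%:R :> R by rewrite ltr0n.
apply: (le_trans (ler_norm_sum _ _ _)).
apply: (@le_trans _ _ (N%:R * ln N - lnfact N)); last first.
  by have := lnfact_ge R N; lra.
have -> : N%:R * ln N = \sum_(1 <= k < N.+1) ln N.
  by rewrite sumr_const_nat subn1/= mulr_natl.
rewrite /lnfact -sumrB; apply: ler_sum_nat => d /andP[d1 dN].
have d0 : 0 < d%:R :> R by rewrite ltr0n.
have -> : \sum_(1 <= m < (N %/ d).+1) M (N %/ (d * m)) = 1.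
  rewrite -[RHS](@sum_mertens_div (N %/ d)) ?divn_gt0//.
  by apply: eq_bigr => m _; rewrite divnMA.
rewrite mulr1 normrM -ln_div ?posrE// [X in _ * X]ger0_norm; last first.
  by apply: ln_ge0; rewrite ler_pdivlMr// mul1r ler_nat.
rewrite -[leRHS]mul1r ler_wpM2r ?mu_le1//.
by apply: ln_ge0; rewrite ler_pdivlMr// mul1r ler_nat.
Qed.

(** The von Mangoldt function of order two in Selberg's work; on average it behaves like
    [2 * ln k]. *)
Definition selberg_weight (k : nat) : R :=
  vM k * ln k + \sum_(1 <= d < k.+1 | (d %| k)%N) vM d * vM (k %/ d).
Local Notation W := selberg_weight.

(** [ln N - ln k] is at most [harm (N %/ k)]; summing over [k] before [m] leaves [psi (N %/ m) / m],
    at most [8 * N / m ^ 2], and [sum_invsq] gives [16 * N]. *)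
Lemma sum_vM_ln N : (0 < N)%N ->
  psi N * ln N - 16 * N%:R <= \sum_(1 <= k < N.+1) vM k * ln k <= psi N * ln N.
Proof.
move=> N0; apply/andP; split; last first.
  rewrite /chebyshev_psi big_distrl/=; apply: ler_sum_nat => k /andP[k1 kN].
  by rewrite ler_wpM2l ?von_mangoldt_ge0// ln_le.
have H : \sum_(1 <= k < N.+1) vM k * harm (N %/ k) <= 16 * N%:R.
  under eq_bigr do rewrite /harm big_distrr/=.
  rewrite (sum_hyperbola_sym N (fun k m => vM k * m%:R^-1)).
  have -> : 16 * N%:R = 8 * N%:R * 2 :> R by ring.
  apply: (le_trans _ (ler_wpM2l _ (sum_invsq R N))); last by rewrite mulr_ge0.
  rewrite big_distrr/=; apply: ler_sum_nat => m /andP[m1 _].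
  rewrite -big_distrl/=; apply: (le_trans (ler_wpM2r _ (psi_le R _))).
    by rewrite invr_ge0.
  have [q _] := quot_bounds R N m1.
  have -> : 8 * N%:R * m%:R ^- 2 = 8 * (N%:R / m%:R) / m%:R :> R.
    by rewrite expr2 invfM; ring.
  by rewrite ler_wpM2r ?invr_ge0// ler_wpM2l.
suff : psi N * ln N - \sum_(1 <= k < N.+1) vM k * ln k
    <= \sum_(1 <= k < N.+1) vM k * harm (N %/ k) by lra.
rewrite /chebyshev_psi big_distrl -sumrB/=; apply: ler_sum_nat => k /andP[k1 kN].
rewrite -mulrBr ler_wpM2l ?von_mangoldt_ge0//.
apply: (le_trans _ (harm_ge R _)).
have k0 : 0 < k%:R :> R by rewrite ltr0n.
rewrite -ln_div ?posrE ?ltr0n// ler_ln ?posrE ?divr_gt0 ?ltr0n//.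
by rewrite -natr1; have [_] := quot_bounds R N k1.
Qed.

Lemma sum_selberg_weight : exists2 C : R, 0 <= C & forall N,
  `|\sum_(1 <= k < N.+1) (W k - 2 * ln k)| <= C * N%:R.
Proof.
have [C C0 HC] := selberg R; exists (C + 18) => [|N]; first by lra.
case: (posnP N) => [->|N0]; first by rewrite big_geq// normr0 mulr0.
have E : \sum_(1 <= k < N.+1) W k
  = \sum_(1 <= k < N.+1) vM k * ln k + \sum_(1 <= k < N.+1) vM k * psi (N %/ k).
  rewrite big_split/= (sum_divisors N (fun d e => vM d * vM e)); congr (_ + _).
  by apply: eq_bigr => d _; rewrite big_distrr.
rewrite sumrB E -big_distrr/= -/(lnfact N).
have := HC N N0; have := sum_vM_ln N0; have := lnfact_le R N; have := lnfact_ge R N.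
rewrite !ler_norml.
move: (psi N * ln N) (\sum_(1 <= k < N.+1) vM k * ln k) => a b.
move: (\sum_(1 <= k < N.+1) vM k * psi (N %/ k)) (N%:R * ln N) => c d.
have : 0 <= N%:R :> R by [].
move: (N%:R) (lnfact N) => n l; lra.
Qed.

(** [mertens_fun_log] is used twice, at [N] and at every [N %/ k]. What remains is [S3 - S2], where
    the coefficient of [M (N %/ k)] is the difference of the two nonnegative parts of [W k], hence
    at most [W k] in absolute value. *)
Lemma mertens_fun_selberg N : (0 < N)%N ->
  `|M N| * ln N ^+ 2 <= \sum_(1 <= k < N.+1) W k * `|M (N %/ k)|
    + (3 * (N%:R * ln N) + 16 * N%:R).
Proof.
move=> N0; have N0' : 0 < N%:R :> R by rewrite ltr0n.
have l0 : 0 <= ln N by exact: ln_nat_ge0.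
pose S1 := \sum_(1 <= k < N.+1) vM k * M (N %/ k).
pose S2 := \sum_(1 <= k < N.+1) vM k * ln k * M (N %/ k).
pose S3 := \sum_(1 <= k < N.+1) \sum_(1 <= m < (N %/ k).+1) vM k * vM m * M (N %/ (k * m)).
have b1 : `|M N * ln N + S1| <= N%:R by exact: mertens_fun_log.
have b2 : `|S1 * ln N - S2 + S3| <= 2 * N%:R * (ln N + 8).
  have -> : S1 * ln N - S2 + S3 = \sum_(1 <= k < N.+1) vM k *
    (M (N %/ k) * (ln N - ln k) + \sum_(1 <= m < (N %/ k).+1) vM m * M (N %/ (k * m))).
    rewrite /S1 big_distrl -sumrB -big_split/=; apply: eq_bigr => k _.
    rewrite mulrDr [in RHS]big_distrr/=; congr (_ + _); first by ring.
    by apply: eq_bigr => m _; rewrite mulrA.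
  apply: (le_trans (ler_norm_sum _ _ _)).
  apply: (@le_trans _ _ (\sum_(1 <= k < N.+1) 2 * N%:R * (vM k / k%:R))); last first.
    rewrite -big_distrr/= ler_wpM2l ?mulr_ge0//.
    have := mertens R N0; move: (\sum_(_ <= _ < _) _) => S; lra.
  apply: ler_sum_nat => k /andP[k1 kN].
  have k0 : 0 < k%:R :> R by rewrite ltr0n.
  rewrite normrM (ger0_norm (von_mangoldt_ge0 R k)).
  have -> : 2 * N%:R * (vM k / k%:R) = vM k * (2 * (N%:R / k%:R)) by ring.
  rewrite ler_wpM2l ?von_mangoldt_ge0//.
  set n := (N %/ k)%N; have n0 : (0 < n)%N by rewrite divn_gt0.
  have n0' : 1 <= n%:R :> R by rewrite ler1n.
  have [q1 q2] := quot_bounds R N k1; rewrite -/n in q1 q2.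
  have := mertens_fun_log n0.
  under eq_bigr do rewrite /n -divnMA.
  set T := \sum_(_ <= _ < _) _ => b.
  have [lo hi] : ln n <= ln N - ln k /\ ln N - ln k <= ln n + n%:R^-1.
    rewrite -ln_div ?posrE//; split; first exact: ln_quot_ge.
    have : exp.ln (N%:R / k%:R) <= ln n.+1 :> R.
      by rewrite ler_ln ?posrE ?divr_gt0// -natr1.
    by have := lnS_le R n0; move: (_^-1) => v; lra.
  have d : `|M n * (ln N - ln k - ln n)| <= 1.
    rewrite normrM; apply: (@le_trans _ _ (n%:R * n%:R^-1)); last by rewrite divff// gt_eqF; lra.
    apply: ler_pM => //; first exact: mertens_fun_le.
    by rewrite ger0_norm; lra.
  have -> : M n * (ln N - ln k) + T = (M n * ln n + T) + M n * (ln N - ln k - ln n) by ring.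
  apply: (le_trans (ler_normD _ _)); lra.
have -> : `|M N| * ln N ^+ 2 = `|M N * ln N ^+ 2| by rewrite normrM (ger0_norm (sqr_ge0 _)).
have -> : M N * ln N ^+ 2 = (M N * ln N + S1) * ln N - (S1 * ln N - S2 + S3) + (S3 - S2) by ring.
have b3 : `|S3 - S2| <= \sum_(1 <= k < N.+1) W k * `|M (N %/ k)|.
  have -> : S3 = \sum_(1 <= k < N.+1) (\sum_(1 <= d < k.+1 | (d %| k)%N)
      vM d * vM (k %/ d)) * M (N %/ k).
    transitivity (\sum_(1 <= d < N.+1) \sum_(1 <= m < (N %/ d).+1)
        vM d * vM ((d * m) %/ d) * M (N %/ (d * m))).
      apply: eq_big_nat => d /andP[d1 _]; apply: eq_bigr => m _; by rewrite mulKn.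
    rewrite (sum_divisors_weight N (fun d k => vM d * vM (k %/ d) * M (N %/ k))).
    by apply: eq_bigr => k _; rewrite big_distrl.
  rewrite -sumrB; apply: (le_trans (ler_norm_sum _ _ _)).
  apply: ler_sum => k _; rewrite -mulrBl normrM ler_wpM2r//.
  have a0 : 0 <= vM k * ln k by rewrite mulr_ge0 ?von_mangoldt_ge0 ?ln_nat_ge0.
  have c0 : 0 <= \sum_(1 <= d < k.+1 | (d %| k)%N) vM d * vM (k %/ d).
    by apply: sumr_ge0 => d _; rewrite mulr_ge0 ?von_mangoldt_ge0.
  rewrite /W; move: a0 c0; move: (vM k * ln k) (\sum_(_ <= _ < _ | _) _) => u v.
  by rewrite ler_norml; lra.
have b4 : `|(M N * ln N + S1) * ln N| <= N%:R * ln N.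
  by rewrite normrM (ger0_norm l0) ler_wpM2r.
apply: (le_trans (ler_normD _ _)); rewrite addrC; apply: lerD => //.
apply: (le_trans (ler_normB _ _)); move: b2 b4; lra.
Qed.

(** Summation by parts replaces [W k] by its mean [2 * ln k]: the partial sums of the difference are
    at most [C * k], and [|M (N %/ k)|] changes no more than [N %/ k] does. Undoing the summation by
    parts then leaves [C] times the sum of [N %/ k]. *)
Lemma mertens_fun_recurrence : exists2 C : R, 0 <= C & forall N, (0 < N)%N ->
  `|M N| * ln N ^+ 2 <= 2 * \sum_(1 <= k < N.+1) ln k * `|M (N %/ k)|
    + C * N%:R * (1 + ln N).
Proof.
have [C C0 HC] := sum_selberg_weight; exists (C + 16) => [|N N0]; first by lra.
have N0' : 0 < N%:R :> R by rewrite ltr0n.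
have l0 : 0 <= ln N by exact: ln_nat_ge0.
apply: (le_trans (mertens_fun_selberg N0)).
have D k : (N %/ k.+1 <= N %/ k)%N -> `| `|M (N %/ k)| - `|M (N %/ k.+1)| | <= (N %/ k)%:R - (N %/ k.+1)%:R.
  move=> h; apply: (le_trans (ler_dist_dist _ _)); rewrite -natrB//.
  exact: mertens_fun_lip.
have P : \sum_(1 <= k < N.+1) (W k - 2 * ln k) * `|M (N %/ k)| <= C * (N%:R * (1 + ln N)).
  rewrite (@sum_by_parts _ N (fun k => W k - 2 * ln k) (fun k => `|M (N %/ k)|)); last by rewrite divn_small// mertens_fun0 normr0.
  apply: (@le_trans _ _ (C * \sum_(1 <= k < N.+1) (N %/ k)%:R)); last first.
    rewrite ler_wpM2l//; apply: (@le_trans _ _ (N%:R * harm N)); last first.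
      by rewrite ler_wpM2l// harm_le.
    rewrite /harm big_distrr/=; apply: ler_sum_nat => k /andP[k1 _].
    by have [] := quot_bounds R N k1.
  have -> : \sum_(1 <= k < N.+1) (N %/ k)%:R
    = \sum_(1 <= k < N.+1) (\sum_(1 <= j < k.+1) 1) * ((N %/ k)%:R - (N %/ k.+1)%:R) :> R.
    rewrite -(@sum_by_parts _ N (fun=> 1) (fun k => (N %/ k)%:R)); last by rewrite divn_small.
    by apply: eq_bigr => k _; rewrite mul1r.
  rewrite big_distrr/=; apply: ler_sum_nat => k /andP[k1 _].
  apply: (le_trans (ler_norm _)); rewrite normrM mulrA.
  have h : (N %/ k.+1 <= N %/ k)%N by apply: leq_div2l.
  apply: ler_pM => //; last exact: D.
  by rewrite sumr_const_nat subn1; exact: HC.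
have E : \sum_(1 <= k < N.+1) W k * `|M (N %/ k)| = 2 * (\sum_(1 <= k < N.+1) ln k * `|M (N %/ k)|)
   + \sum_(1 <= k < N.+1) (W k - 2 * ln k) * `|M (N %/ k)|.
  rewrite big_distrr -big_split/=; apply: eq_bigr => k _; ring.
rewrite E -addrA lerD2l; move: P; move: (\sum_(_ <= _ < _) _) => S P.
have : 0 <= N%:R * ln N by rewrite mulr_ge0// ltW.
nra.
Qed.

End mertens_function.

(** * Mean value of the Moebius function *)

Section mertens_dips.
Variable R : realType.
Local Notation ln n := (exp.ln (n%:R : R)).
Local Notation mu d := ((mobius d)%:~R : R).
Local Notation M := (mertens_fun R).

Lemma ln_nat_unbounded (K : R) : exists n0, forall n, (n0 <= n)%N -> K <= ln n.
Proof.
exists (Num.bound (expR K)) => n hn.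
have h : expR K <= n%:R.
  apply: (@le_trans _ _ (Num.bound (expR K))%:R); last by rewrite ler_nat.
  by apply/ltW/archi_boundP/expR_ge0.
rewrite -(expRK K) ler_ln ?posrE ?expR_gt0//.
by apply: lt_le_trans h; rewrite expR_gt0.
Qed.

(** [E] is [sum_mobius_divisors] summed up to [N]; replacing each [N %/ k] by [N / k] costs at most
    1, hence [N] in all. *)
Lemma sum_mobius_div_le N : (0 < N)%N -> `|\sum_(1 <= k < N.+1) mu k / k%:R| <= 2.
Proof.
move=> N0; have N0' : 0 < N%:R :> R by rewrite ltr0n.
have E : \sum_(1 <= k < N.+1) mu k * (N %/ k)%:R = 1.
  transitivity (\sum_(1 <= k < N.+1) ((k == 1)%:R : R)).
    transitivity (\sum_(1 <= k < N.+1) \sum_(1 <= m < (N %/ k).+1) mu k).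
      by apply: eq_bigr => k _; rewrite sumr_const_nat subn1/= mulr_natr.
    rewrite -(sum_divisors N (fun k _ => mu k)); apply: eq_big_nat => k /andP[k0 _].
    by rewrite -rmorph_sum/= sum_mobius_divisors// natz -pmulrn.
  by rewrite big_ltn// big_nat_cond big1 ?addr0// => -[|[|k]].
have D : `|N%:R * \sum_(1 <= k < N.+1) mu k / k%:R - 1| <= N%:R.
  rewrite -[X in _ - X]E big_distrr -sumrB/=; apply: (le_trans (ler_norm_sum _ _ _)).
  rewrite [leRHS](_ : _ = \sum_(1 <= k < N.+1) 1); last by rewrite sumr_const_nat subn1.
  apply: ler_sum_nat => k /andP[k1 _].
  have -> : N%:R * (mu k / k%:R) - mu k * (N %/ k)%:R = mu k * (N%:R / k%:R - (N %/ k)%:R) by ring.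
  have [q1 q2] := quot_bounds R N k1.
  rewrite normrM -[leRHS]mulr1; apply: ler_pM => //; first exact: mu_le1.
  by rewrite ger0_norm; lra.
rewrite -(ler_pM2l N0') -[N%:R in leLHS](ger0_norm (ltW N0')) -normrM.
have n1 : 1 <= N%:R :> R by rewrite ler1n.
move: D; move: (_ * \sum_(_ <= _ < _) _) => S; rewrite !ler_norml; lra.
Qed.

Lemma sum_mertens_fun_le N : `|\sum_(1 <= k < N.+1) M k / (k%:R * k.+1%:R)| <= 3.
Proof.
case: N => [|N]; first by rewrite big_geq// normr0.
have -> : \sum_(1 <= k < N.+2) M k / (k%:R * k.+1%:R)
   = \sum_(1 <= k < N.+2) mu k / k%:R - M N.+1 / N.+2%:R.
  elim: N => [|N IH]; first by rewrite !big_nat1 /mertens_fun big_nat1 mobius1; field.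
  rewrite big_nat_recr//= IH [in RHS]big_nat_recr//=.
  have -> : M N.+2 = M N.+1 + mu N.+2 by rewrite /mertens_fun [LHS]big_nat_recr.
  rewrite -(natr1 N.+2); move: (\sum_(_ <= _ < _) _) => S.
  have n2 : N.+2%:R != 0 :> R by rewrite pnatr_eq0.
  have n3 : N.+2%:R + 1 != 0 :> R by rewrite natr1 pnatr_eq0.
  by move: (N.+2%:R) n2 n3 => v n2 n3; field; rewrite n2 n3.
apply: (le_trans (ler_normB _ _)).
have := @sum_mobius_div_le N.+1 isT.
suff : `|M N.+1 / N.+2%:R| <= 1 by lra.
rewrite normrM normfV [X in _ / X]ger0_norm// ler_pdivrMr// mul1r.
by apply: (le_trans (mertens_fun_le _ _)); rewrite ler_nat.
Qed.

(* The sums of [M k / (k * (k + 1))] are bounded, so on every long multiplicative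
   interval [M] changes sign or is small somewhere; and [M] is 1-Lipschitz. *)
Lemma mertens_fun_dip (b : R) : 0 < b -> b <= 1 ->
  exists E n2, [/\ (2 <= E)%N, (0 < n2)%N & forall n, (n2 <= n)%N -> exists2 y, (n <= y)%N &
    2 * y%:R < E%:R * n%:R :> R /\
    forall k, (y <= k)%N -> k%:R <= (1 + b / 8) * y%:R -> `|M k| <= 5 * b / 8 * k%:R].
Proof.
move=> b0 b1.
(* If [s * M k > b / 2 * k] held on all of [[n, K * n)] for a sign [s], the sum of
   [M k / (k * (k + 1))] there would exceed [b / 2 * (12 / b + 1) > 6] in absolute value, against
   the bound [3 + 3] from two partial sums. The factor 2 absorbs the passage from [n] to [n + 1] in
   the logarithms. *)
pose K := Num.bound (2 * expR (12 / b + 1)).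
have KE : 2 * expR (12 / b + 1) < K%:R by apply: archi_boundP; rewrite mulr_ge0// expR_ge0.
have K2 : (2 < K)%N.
  rewrite -(ltr_nat R); apply: le_lt_trans KE.
  rewrite ler_peMr// -expR0 ler_expR addr_ge0// divr_ge0// ltW//.
(* The second witness ensures [b * n > 2]: a step of [M], at most 1, cannot jump from above
   [b / 2 * k] to below its negative. *)
exists (2 * K)%N, (Num.bound (2 / b)).+1; split => //; first by lia.
move=> n nn2; have n0 : (0 < n)%N by lia.
have n0' : 0 < n%:R :> R by rewrite ltr0n.
have bn : 2 < b * n%:R.
  rewrite -ltr_pdivrMl// mulrC; apply: (lt_le_trans (archi_boundP _)).
    by rewrite divr_ge0// ltW.
  by rewrite ler_nat ltnW.
have [[y /andP[ny yK] My]|H] := pselect (exists2 y, (n <= y < K * n)%N & `|M y| <= b / 2 * y%:R).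
  exists y => //; split.
    rewrite -!natrM ltr_nat. lia.
  (* From at most [b / 2 * y] at [y], [|M|] grows by at most [b / 8 * y] up to [k]; this is the
     [5 * b / 8]. *)
  move=> k yk hk; have y0 : 0 < y%:R :> R by rewrite ltr0n; lia.
  have := ler_normD (M k - M y) (M y); rewrite subrK => h; apply: (le_trans h).
  have := mertens_fun_lip R yk; rewrite natrB// => h2.
  have yk' : y%:R <= k%:R :> R by rewrite ler_nat.
  nra.
exfalso.
have H' k : (n <= k < K * n)%N -> b / 2 * k%:R < `|M k|.
  by move=> hk; rewrite ltNge; apply/negP => h; apply: H; exists k.
have sgn : (forall k, (n <= k < K * n)%N -> b / 2 * k%:R < M k) \/
           (forall k, (n <= k < K * n)%N -> b / 2 * k%:R < - M k).
  have nK : (n <= n < K * n)%N by rewrite leqnn -[X in (X < _)%N]mul1n ltn_pmul2r//; lia.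
  have step (s : R) : `|s| = 1 -> b / 2 * n%:R < s * M n ->
      forall k, (n <= k < K * n)%N -> b / 2 * k%:R < s * M k.
    move=> s1 sn k /andP[nk]; rewrite -(subnKC nk); elim: (k - n)%N => [|j IH] hj.
      by rewrite addn0.
    rewrite addnS in hj *.
    have hj' : (n + j < K * n)%N by lia.
    have := IH hj'; set m := (n + j)%N => hm.
    have mm : (n <= m.+1 < K * n)%N by rewrite /m; lia.
    have := H' _ mm; have := mertens_fun_lip R (leqnSn m); rewrite subSnn.
    have -> : `|M m.+1 - M m| = `|s * M m.+1 - s * M m| by rewrite -mulrBr normrM s1 mul1r.
    have -> : `|M m.+1| = `|s * M m.+1| by rewrite normrM s1 mul1r.
    have bm : b * n%:R <= b * m%:R by rewrite ler_wpM2l ?ler_nat ?ltW// /m; lia.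
    move: (s * M m.+1) (s * M m) hm bm => u v hm bm.
    rewrite ler_norml -natr1 => /andP[h1 h2].
    by case: (ger0P u) => hu; lra.
  have := H' _ nK; case: (ger0P (M n)) => hM h; [left|right] => k hk.
    by rewrite -[M k]mul1r; apply: step => //; rewrite ?normr1 ?mul1r.
  by rewrite -mulN1r; apply: step => //; rewrite ?normrN1 ?mulN1r.
pose S := \sum_(n <= k < K * n) M k / (k%:R * k.+1%:R).
have Sb : `|S| <= 6.
  have := sum_mertens_fun_le n.-1; have := sum_mertens_fun_le (K * n).-1.
  have -> : ((K * n).-1.+1 = K * n)%N by rewrite prednK// muln_gt0; lia.
  rewrite prednK// (big_cat_nat (n := n))//=; last by rewrite leq_pmull//; lia.
  rewrite -/S; move: (\sum_(_ <= _ < _) _) => T; rewrite !ler_norml; lra.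
have lnsum : b / 2 * (ln (K * n)%N.+1 - ln n.+1) <= b / 2 * \sum_(n <= k < K * n) k.+1%:R^-1.
  rewrite ler_wpM2l//; first by rewrite divr_ge0// ltW.
  have nK : (n <= K * n)%N by rewrite leq_pmull//; lia.
  rewrite -(subnKC nK); elim: (K * n - n)%N => [|j IH].
    by rewrite addn0 big_geq// subrr.
  rewrite addnS big_nat_recr ?leq_addr//=.
  have := @lnS_le R (n + j).+1 isT; move: IH.
  by move: (_^-1) => v; lra.
have big : 6 < b / 2 * (ln (K * n)%N.+1 - ln n.+1).
  have l : 12 / b + 1 <= ln (K * n)%N.+1 - ln n.+1.
    rewrite -ln_div ?posrE// -[leLHS]expRK ler_ln ?posrE ?expR_gt0 ?divr_gt0//.
    rewrite ler_pdivlMr//.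
    apply: (@le_trans _ _ (K%:R / 2 * n.+1%:R)).
      by rewrite ler_pM2r// ler_pdivlMr// mulrC ltW.
    have n1 : 1 <= n%:R :> R by rewrite ler1n.
    have K0 : 0 <= K%:R :> R by [].
    by rewrite -(natr1 n) -(natr1 (K * n)) natrM; nra.
  have : b / 2 * (12 / b + 1) = 6 + b / 2 by field; rewrite gt_eqF.
  have : b / 2 * (12 / b + 1) <= b / 2 * (ln (K * n)%N.+1 - ln n.+1).
    by rewrite ler_wpM2l// divr_ge0// ltW.
  lra.
have key (s : R) : (forall k, (n <= k < K * n)%N -> b / 2 * k%:R < s * M k) -> 6 < s * S.
  move=> hs; apply: (lt_le_trans big); apply: (le_trans lnsum).
  rewrite /S !big_distrr/=; apply: ler_sum_nat => k hk.
  have k0 : 0 < k%:R :> R by rewrite ltr0n; lia.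
  have k1 : 0 < k.+1%:R :> R by rewrite ltr0n.
  rewrite invfM !mulrA ler_pM2r ?invr_gt0//.
  by rewrite ler_pdivlMr//; apply/ltW/hs.
move: Sb; rewrite ler_norml => /andP[Sb1 Sb2].
case: sgn => hs.
  have := key 1; rewrite mul1r => h.
  have /h : forall k, (n <= k < K * n)%N -> b / 2 * k%:R < 1 * M k by move=> k /hs; rewrite mul1r.
  lra.
have := key (-1); rewrite mulN1r => h.
have /h : forall k, (n <= k < K * n)%N -> b / 2 * k%:R < -1 * M k by move=> k /hs; rewrite mulN1r.
lra.
Qed.

End mertens_dips.

Section prime_number_theorem.
Variable R : realType.
Local Notation ln n := (exp.ln (n%:R : R)).
Local Notation M := (mertens_fun R).

Lemma sum_ln_div N : \sum_(1 <= k < N.+1) ln k / k%:R <= ln N ^+ 2 / 2 + 1.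
Proof.
case: N => [|N]; first by rewrite big_geq// ln0// expr0n/= mul0r add0r.
have -> : \sum_(1 <= k < N.+2) ln k / k%:R = \sum_(1 <= k < N.+1) ln k.+1 / k.+1%:R.
  by rewrite big_ltn// ln1 mul0r add0r big_add1.
have H : \sum_(1 <= k < N.+1) ln k.+1 / k.+1%:R
    <= \sum_(1 <= k < N.+1) (2^-1 * (ln k.+1 ^+ 2 - ln k ^+ 2) + 2^-1 * k%:R ^- 2).
  apply: ler_sum_nat => k /andP[k1 _].
  have := lnS_ge R k1; have := lnS_le R k1; have := ln_nat_ge0 R k.+1; have := ln_nat_ge0 R k.
  have k0 : 0 < k%:R :> R by rewrite ltr0n.
  have : 0 <= k%:R^-1 :> R by rewrite invr_ge0.
  have : 0 <= k.+1%:R^-1 :> R by rewrite invr_ge0.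
  rewrite -exprVn; move: (k%:R^-1) (k.+1%:R^-1) (ln k) (ln k.+1) => u v a b.
  move=> v0 u0 a0 b0 h1 h2.
  have h3 : b * v <= b * (b - a) by rewrite ler_wpM2l.
  have h4 : (b - a) ^+ 2 <= u ^+ 2.
    have ab : 0 <= b - a by lra.
    by rewrite ler_sqr ?nnegrE//; lra.
  rewrite !expr2 in h4 *; lra.
apply: (le_trans H); rewrite big_split/= -!big_distrr/=.
have -> : \sum_(1 <= k < N.+1) (ln k.+1 ^+ 2 - ln k ^+ 2) = ln N.+1 ^+ 2.
  elim: N {H} => [|N IH]; first by rewrite big_geq// ln1 expr0n.
  by rewrite big_nat_recr//= IH addrC subrK.
by have := sum_invsq R N; lra.
Qed.

(** The quotients [N %/ k] are sorted into windows [[E ^ i, E ^ i.+1)], each with a dip [[y, y1]].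
    The [k] whose quotient lies in the dip contribute at least [N * b / 18] to the sum of [N %/ k],
    and [ln k >= ln N / 2] as long as the windows stay below the square root of [N]. About
    [ln N / (2 * e)] windows with [e = ln E] do so. *)
Lemma dip_weight (b : R) : 0 < b -> b <= 1 -> exists2 z : R, 0 < z & exists N1, forall N, (N1 <= N)%N ->
  z * (N%:R * ln N ^+ 2) <= \sum_(1 <= k < N.+1)
     ln k * (N %/ k)%:R * (`|M (N %/ k)| <= 5 * b / 8 * (N %/ k)%:R)%R%:R.
Proof.
move=> b0 b1; have [E [n2 [E2 n20 D]]] := mertens_fun_dip b0 b1.
pose g N k := ln k * (N %/ k)%:R * (`|M (N %/ k)| <= 5 * b / 8 * (N %/ k)%:R)%R%:R.
have g0 N k : 0 <= g N k by rewrite /g !mulr_ge0 ?ln_nat_ge0.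
pose W N i := \sum_(1 <= k < N.+1) ((E ^ i <= N %/ k < E ^ i.+1)%N)%:R * g N k.
have E1 : (1 < E)%N by lia.
have disj N I : \sum_(0 <= i < I) W N i <= \sum_(1 <= k < N.+1) g N k.
  rewrite /W exchange_big/=; apply: ler_sum => k _; rewrite -big_distrl/=.
  rewrite -[leRHS]mul1r ler_wpM2r//; set q := (N %/ k)%N.
  have -> : \sum_(0 <= i < I) ((E ^ i <= q < E ^ i.+1)%N)%:R
     = ((q < E ^ I)%N)%:R - ((q < E ^ 0)%N)%:R :> R.
    elim: I => [|I IH]; first by rewrite big_geq// subrr.
    rewrite big_nat_recr//= IH addrAC; congr (_ - _).
    have : (E ^ I <= E ^ I.+1)%N by rewrite leq_exp2l.
    by case: (ltnP q (E ^ I)); case: (ltnP q (E ^ I.+1)) => //= *; rewrite ?addr0 ?add0r//; lia.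
  by case: (q < _)%N; case: (q < _)%N; rewrite /= ?subr0 ?sub0r ?subrr//; lra.
have win i I N : (n2 <= E ^ i)%N -> (i < I)%N -> (E ^ (2 * I) <= N)%N -> 18 / b <= (E ^ I)%:R ->
   N%:R * ln N * (b / 36) <= W N i.
  move=> n2i iI EN bE; have [y niy [yE dip]] := D _ n2i.
  have y0 : (0 < y)%N by apply: leq_trans niy; rewrite expn_gt0; lia.
  have y0' : 1 <= y%:R :> R by rewrite ler1n.
  pose y1 := (y + Num.truncn (b / 8 * y%:R))%N.
  have by0 : 0 <= b / 8 * y%:R by rewrite mulr_ge0// divr_ge0// ltW.
  have [t1 t2] : (Num.truncn (b / 8 * y%:R))%:R <= b / 8 * y%:R /\
       b / 8 * y%:R < (Num.truncn (b / 8 * y%:R)).+1%:R.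
    by have /andP[] := truncn_itv by0.
  have y1E : (y1.+1 <= E ^ i.+1)%N.
    rewrite expnS -(ltr_nat R) natrM /y1 natrD; apply: le_lt_trans yE; nra.
  have y1I : (y1.+1 <= E ^ I)%N by apply: (leq_trans y1E); rewrite leq_exp2l.
  have sqN : (y1.+1 * E ^ I <= N)%N.
    apply: leq_trans EN; rewrite mul2n -addnn expnD leq_mul2r; by rewrite y1I orbT.
  have N0 : (0 < N)%N by apply: leq_trans EN; rewrite expn_gt0; lia.
  have N0' : 0 < N%:R :> R by rewrite ltr0n.
  have lN : 0 <= ln N by exact: ln_nat_ge0.
  rewrite /W; set A := (N %/ y1.+1)%N; set B := (N %/ y)%N.
  have AB : (A <= B)%N by apply: leq_div2l => //; rewrite ltnW// ltnS leq_addr.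
  have BN : (B <= N)%N by exact: leq_div.
  rewrite (big_cat_nat (n := A.+1))//= ?ltnS ?(leq_trans AB)//.
  rewrite [X in _ + X](big_cat_nat (n := B.+1))//= ?ltnS//.
  rewrite -[leLHS]add0r; apply: lerD; first by apply: sumr_ge0 => k _; rewrite mulr_ge0.
  rewrite -[leLHS]addr0; apply: lerD; last by apply: sumr_ge0 => k _; rewrite mulr_ge0.
  apply: (@le_trans _ _ (\sum_(A.+1 <= k < B.+1) (ln N / 2 * y%:R))); last first.
    apply: ler_sum_nat => k /andP[Ak kB].
    have k0 : (0 < k)%N by exact: leq_ltn_trans (leq0n A) Ak.
    have k0' : 0 < k%:R :> R by rewrite ltr0n.
    have qy : (y <= N %/ k)%N by rewrite leq_divRL// mulnC -leq_divRL.
    have qy1 : (N %/ k < y1.+1)%N by rewrite ltn_divLR// mulnC -ltn_divLR.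
    have qE : (E ^ i <= N %/ k < E ^ i.+1)%N by rewrite (leq_trans niy qy) (leq_trans qy1 y1E).
    have dp : `|M (N %/ k)| <= 5 * b / 8 * (N %/ k)%:R.
      apply: dip => //; apply: (@le_trans _ _ y1%:R); first by rewrite ler_nat.
      by rewrite /y1 natrD; lra.
    rewrite qE mul1r /g dp mulr1; apply: ler_pM => //; first by rewrite divr_ge0.
      have kN : (N <= k * k)%N.
        have h1 : (N < k * y1.+1)%N by rewrite -ltn_divLR.
        have h2 : (y1.+1 * y1.+1 <= N)%N by apply: leq_trans sqN; rewrite leq_mul2l y1I.
        have h3 : (y1.+1 < k)%N by rewrite -(ltn_pmul2r (m := y1.+1))// (leq_ltn_trans h2 h1).
        by apply: ltnW; apply: (leq_trans h1); rewrite leq_mul2l ltnW ?orbT.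
      have : ln N <= ln (k * k)%N by apply: ln_le.
      by rewrite natrM lnM ?posrE//; lra.
    by rewrite ler_nat.
  rewrite sumr_const_nat subSS -[_ *+ (B - A)]mulr_natr natrB//.
  have [_ qB] := quot_bounds R N y0.
  have [qA _] := quot_bounds R N (ltn0Sn y1).
  rewrite -/A -/B in qA qB.
  have qA' : N%:R / y1.+1%:R <= N%:R / ((1 + b / 8) * y%:R).
    rewrite ler_pM2l// lef_pV2 ?posrE ?ltr0n//; last by rewrite mulr_gt0//; lra.
    by rewrite -(natr1 y1) /y1 natrD; move: t2; rewrite -(natr1 (Num.truncn _)); lra.
  (* About [N / y - N / (y1 + 1)] values of [k] are counted. As [1 / (1 + b / 8) <= 1 - b / 9], this
     gives [N * b / 9] after multiplication by [y], half of which pays for rounding: [h4], where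
     [18 / b <= E ^ I] enters. *)
  have cnt : N%:R * (b / 18) <= y%:R * (B%:R - A%:R).
    have h1 : N%:R <= (B%:R + 1) * y%:R :> R by rewrite -ler_pdivrMr//; lra.
    have h2 : y%:R * A%:R <= N%:R / (1 + b / 8).
      apply: (@le_trans _ _ (y%:R * (N%:R / ((1 + b / 8) * y%:R)))).
        by rewrite ler_pM2l ?(le_trans qA qA')//; lra.
      rewrite le_eqVlt; apply/orP; left; apply/eqP; field.
      by rewrite !gt_eqF//; lra.
    have h3 : N%:R / (1 + b / 8) <= N%:R * (1 - b / 9).
      rewrite ler_pM2l// -[leLHS]mul1r ler_pdivrMr; last lra.
      nra.
    have h4 : y%:R <= N%:R * (b / 18).
      have h5 : y%:R * (E ^ I)%:R <= N%:R :> R.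
        by rewrite -natrM ler_nat; apply: leq_trans sqN; rewrite leq_mul2r ltnW ?orbT// ltnS leq_addr.
      have h6 : 18 <= (E ^ I)%:R * b by rewrite -ler_pdivrMr.
      have : y%:R * 18 <= y%:R * ((E ^ I)%:R * b) by rewrite ler_pM2l//; lra.
      have : y%:R * (E ^ I)%:R * b <= N%:R * b by rewrite ler_wpM2r// ltW.
      lra.
    lra.
  have -> : N%:R * ln N * (b / 36) = ln N / 2 * (N%:R * (b / 18)) by field.
  by rewrite -[leRHS]mulrA; apply: ler_wpM2l; rewrite ?divr_ge0.
pose e := ln E; have e0 : 0 < e by apply: ln_gt0; rewrite ltr1n.
have Eunb (m : nat) : (m <= E ^ m)%N by apply/ltnW/ltn_expl.
pose i0 := n2; pose I0 := (i0 + (Num.bound (18 / b)))%N.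
(* A window yields [b / 36], and at least [ln N / (4 * e)] windows are used: half of the available
   number is given up for [i0] and for rounding. *)
exists (b / (36 * 4 * e)); first by rewrite divr_gt0// !mulr_gt0.
have [N1 HN1] := ln_nat_unbounded (4 * e * (i0%:R + 2)).
exists (maxn N1 (E ^ (2 * I0.+1))) => N; rewrite geq_max => /andP[NN1 NN2].
have N0 : (0 < N)%N by apply: leq_trans NN2; rewrite expn_gt0; lia.
have N0' : 0 < N%:R :> R by rewrite ltr0n.
have L := HN1 _ NN1.
pose I := (trunc_log E N %/ 2)%N.
have EI : (E ^ (2 * I) <= N)%N.
  apply: leq_trans (trunc_logP E1 N0); rewrite leq_exp2l//.
  by rewrite mulnC leq_trunc_div.
have NE : (N < E ^ (2 * I.+1))%N.
  apply: leq_trans (trunc_log_ltn N E1) _; rewrite leq_exp2l//.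
  by rewrite mulnC -ltn_divLR.
have lnNE : ln N <= (2 * I%:R + 2) * e.
  have : ln N <= ln (E ^ (2 * I.+1))%N by rewrite ln_le// ltnW.
  rewrite natrX lnXn ?ltr0n; last by lia.
  by rewrite -[e *+ _]mulr_natl natrM -(natr1 I) mulrDr mulr1.
have I0I : (I0 <= I)%N.
  have : (E ^ (2 * I0.+1) < E ^ (2 * I.+1))%N by apply: leq_ltn_trans NE.
  by rewrite ltn_exp2l//; lia.
apply: (le_trans _ (disj N I)).
have i0I : (i0 <= I)%N by rewrite (leq_trans _ I0I)// leq_addr.
rewrite (big_cat_nat (n := i0))//= -[leLHS]add0r; apply: lerD.
  by apply: sumr_ge0 => i _; apply: sumr_ge0 => k _; rewrite mulr_ge0.
apply: (@le_trans _ _ (\sum_(i0 <= i < I) (N%:R * ln N * (b / 36)))); last first.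
  apply: ler_sum_nat => i /andP[ii iI]; apply: (win i I) => //.
    by apply: leq_trans (Eunb i).
  apply: (@le_trans _ _ (Num.bound (18 / b))%:R).
    by apply/ltW/archi_boundP; rewrite divr_ge0// ltW.
  rewrite ler_nat; apply: leq_trans (Eunb I); apply: leq_trans I0I; exact: leq_addl.
rewrite sumr_const_nat -[_ *+ (I - i0)]mulr_natr natrB//.
have lN : 0 <= ln N by exact: ln_nat_ge0.
have -> : b / (36 * 4 * e) * (N%:R * ln N ^+ 2) = N%:R * ln N * (b / 36) * (ln N / (4 * e)).
  by field; rewrite gt_eqF.
rewrite ler_wpM2l//; first by rewrite !mulr_ge0// ?ltW// divr_gt0.
rewrite ler_pdivrMr ?mulr_gt0//; nra.
Qed.

(** The weights [ln k * (N / k)] add up to about [N * ln N ^ 2 / 2], so the recurrence with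
    [|M q| <= a * q] merely returns [a]. At the dips [|M q|] is smaller by at least [3 / 8 * b * q],
    and they carry a positive share of the weight. [d] is half of the saving; the other half absorbs
    the lower-order terms. *)
Lemma mertens_fun_improve (b : R) : 0 < b -> b <= 1 -> exists2 d : R, 0 < d &
  forall a, b <= a ->
   (exists n0, forall n, (n0 <= n)%N -> `|M n| <= a * n%:R) ->
   (exists n0, forall n, (n0 <= n)%N -> `|M n| <= (a - d) * n%:R).
Proof.
move=> b0 b1; have [z z0 [N1 HZ]] := dip_weight b0 b1.
have [C C0 HC] := mertens_fun_recurrence R.
exists (3 / 8 * b * z); first by rewrite !mulr_gt0//; lra.
move=> a ba [n0 Hn0].
pose T := 2 * a + 2 * n0%:R + 2 * C.
have T0 : 0 <= T by rewrite /T !addr_ge0 ?mulr_ge0//; lra.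
have [N2 HN2] := ln_nat_unbounded (T / (3 / 8 * b * z)).
have [N3 HN3] := ln_nat_unbounded (1 : R).
exists (maxn N1 (maxn N2 (maxn N3 1))) => N; rewrite !geq_max => /and4P[h1 h2 h3 N0].
have N0' : 0 < N%:R :> R by rewrite ltr0n.
have L1 := HN3 _ h3; have := HN2 _ h2; rewrite ler_pdivrMr; last by rewrite !mulr_gt0//; lra.
move=> LT; have Z := HZ _ h1; have RC := HC _ N0.
have pt q : `|M q| <= a * q%:R - 3 / 8 * b * (q%:R * (`|M q| <= 5 * b / 8 * q%:R)%R%:R) + n0%:R.
  have q0 : 0 <= q%:R :> R by [].
  have n00 : 0 <= n0%:R :> R by [].
  case: (boolP (`|M q| <= 5 * b / 8 * q%:R)) => dp; rewrite /= ?mulr1 ?mulr0n ?mulr0; first by nra.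
  case: (leqP n0 q) => hq; first by have := Hn0 _ hq; lra.
  have : q%:R <= n0%:R :> R by rewrite ler_nat ltnW.
  by have := mertens_fun_le R q; nra.
have S : \sum_(1 <= k < N.+1) ln k * `|M (N %/ k)| <=
   a * (N%:R * (ln N ^+ 2 / 2 + 1)) - 3 / 8 * b * (z * (N%:R * ln N ^+ 2)) + n0%:R * (N%:R * ln N).
  apply: (@le_trans _ _ (\sum_(1 <= k < N.+1)
    (a * (N%:R * (ln k / k%:R)) - 3 / 8 * b * (ln k * (N %/ k)%:R * (`|M (N %/ k)| <= 5 * b / 8 * (N %/ k)%:R)%R%:R)
     + n0%:R * ln k))).
    apply: ler_sum_nat => k /andP[k1 kN].
    have l0 := ln_nat_ge0 R k.
    apply: (le_trans (ler_wpM2l l0 (pt _))); rewrite mulrDr mulrBr.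
    have [q1 _] := quot_bounds R N k1.
    rewrite [ln k * n0%:R]mulrC lerD2r; apply: lerB; last by rewrite le_eqVlt; apply/orP; left; apply/eqP; ring.
    have -> : a * (N%:R * (ln k / k%:R)) = a * ln k * (N%:R / k%:R) by ring.
    rewrite mulrA [ln k * a]mulrC ler_wpM2l// mulr_ge0//; lra.
  rewrite big_split/= sumrB -!big_distrr/=; apply: lerD; last first.
    by rewrite ler_wpM2l//; exact: lnfact_le.
  apply: lerB.
    rewrite ler_wpM2l ?ler_wpM2l ?sum_ln_div//; lra.
  by rewrite ler_wpM2l//; lra.
have L2 : 0 < ln N ^+ 2 by rewrite exprn_gt0//; lra.
rewrite -(ler_pM2r L2); apply: (le_trans RC).
apply: (le_trans (lerD (ler_wpM2l _ S) (lexx _))) => //.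
have key : 2 * a + 2 * n0%:R * ln N + C * (1 + ln N) <= 3 / 8 * b * z * ln N ^+ 2.
  apply: (@le_trans _ _ (T * ln N)).
    have : 0 <= n0%:R :> R by [].
    by rewrite /T; nra.
  by rewrite expr2 mulrA mulrC [leRHS]mulrC ler_wpM2l// ?(mulrC (ln N)); lra.
have := ler_wpM2l (ltW N0') key.
move: (ln N) (N%:R) (n0%:R) => l n m; nra.
Qed.

(** The gain [d] is the same for all [a >= b], so if the infimum [b] of the admissible constants
    were positive, a constant within [d] of it would improve to one below it. The [max] with 0 keeps
    the improved constant in [Q]. *)
Theorem mertens_fun_small (eps : R) : 0 < eps ->
  exists n0, forall n, (n0 <= n)%N -> `|M n| <= eps * n%:R.
Proof.
move=> eps0.
pose Q := [set a : R | 0 <= a /\ exists n0, forall n, (n0 <= n)%N -> `|M n| <= a * n%:R].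
have Q1 : Q 1 by split => //; exists 0%N => n _; rewrite mul1r mertens_fun_le.
have hi : has_inf Q by split; [exists 1|exists 0 => x []].
set b := inf Q.
have b0 : 0 <= b by apply: lb_le_inf; [exists 1|move=> x []].
have b1 : b <= 1 by apply: ge_inf => //; exact: hi.2.
have up a : Q a -> forall c, a <= c -> Q c.
  move=> [a0 [n0 H]] c ac; split; first lra.
  exists n0 => n /H; move=> h; apply: (le_trans h); by rewrite ler_wpM2r.
have [bz|bz] := eqVneq b 0.
  have [a Qa ae] := inf_adherent eps0 hi.
  by have [_] := up _ Qa eps (ltac:(rewrite -/b bz in ae; lra)).
have bp : 0 < b by rewrite lt_def bz.
have [d d0 H] := mertens_fun_improve bp b1.
have [a Qa ae] := inf_adherent d0 hi; rewrite -/b in ae.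
have ba : b <= a by apply: ge_inf => //; exact: hi.2.
have [m0 Hm] := H a ba Qa.2.
exfalso; have : b <= Num.max (a - d) 0.
  apply: ge_inf; first exact: hi.2.
  split; first by rewrite le_max lexx orbT.
  exists m0 => n /Hm h; apply: (le_trans h); rewrite ler_wpM2r//.
  by rewrite le_max lexx.
rewrite le_max => /orP[]; lra.
Qed.

End prime_number_theorem.

(** * Complex modulus and exponential *)

Section modulus.
Variable R : realType.
Implicit Types (z w : R[i]) (x : R).
Local Open Scope complex_scope.

(** The norm of [R[i]] takes its values in [R[i]]; a real-valued modulus keeps all estimates among
    real numbers. *)
Definition cabs z : R := Num.sqrt (Re z ^+ 2 + Im z ^+ 2).

Lemma cabsE z : `|z| = (cabs z)%:C.
Proof. by rewrite normc_def. Qed.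

Lemma cabs_ge0 z : 0 <= cabs z.
Proof. exact: sqrtr_ge0. Qed.

Lemma cabsM z w : cabs (z * w) = cabs z * cabs w.
Proof. by apply: (@complexI R); rewrite rmorphM/= -!cabsE normrM. Qed.

Lemma cabsD z w : cabs (z + w) <= cabs z + cabs w.
Proof. by rewrite -lecR rmorphD/= -!cabsE ler_normD. Qed.

Lemma cabsN z : cabs (- z) = cabs z.
Proof. by apply: (@complexI R); rewrite -!cabsE normrN. Qed.

Lemma cabsB z w : cabs (z - w) <= cabs z + cabs w.
Proof. by rewrite -(cabsN w) cabsD. Qed.

Lemma cabsC z w : cabs (z - w) = cabs (w - z).
Proof. by rewrite -cabsN opprB. Qed.

Lemma cabs0 : cabs 0 = 0.
Proof. by apply: (@complexI R); rewrite -cabsE normr0. Qed.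

Lemma cabs1 : cabs 1 = 1.
Proof. by apply: (@complexI R); rewrite -cabsE normr1. Qed.

Lemma cabs_real x : cabs x%:C = `|x|.
Proof. by rewrite /cabs /= expr0n addr0 sqrtr_sqr. Qed.

Lemma cabs_nat n : cabs n%:R = n%:R.
Proof. by apply: (@complexI R); rewrite -cabsE normr_nat rmorph_nat. Qed.

Lemma cabsV z : cabs z^-1 = (cabs z)^-1.
Proof. by apply: (@complexI R); rewrite fmorphV/= -!cabsE normfV. Qed.

Lemma cabs_int (m : int) : cabs m%:~R = `|m%:~R|.
Proof. by rewrite -cabs_real rmorph_int. Qed.

Lemma cabs_conj z : cabs (conjc z) = cabs z.
Proof. by case: z => a b; rewrite /cabs /= sqrrN. Qed.

Lemma cabs_sqr z : (cabs z ^+ 2)%:C = z * conjc z.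
Proof. by rewrite -sqr_normc cabsE rmorphXn. Qed.

Lemma cabs_sum (I : Type) (r : seq I) (P : pred I) (F : I -> R[i]) :
  cabs (\sum_(i <- r | P i) F i) <= \sum_(i <- r | P i) cabs (F i).
Proof.
elim/big_ind2: _ => [|z1 x1 z2 x2 h1 h2|//]; first by rewrite cabs0.
exact: le_trans (cabsD _ _) (lerD h1 h2).
Qed.

Lemma Re_le_cabs z : `|Re z| <= cabs z.
Proof. by have := normc_ge_Re z; rewrite cabsE lecR. Qed.

Lemma Im_le_cabs z : `|Im z| <= cabs z.
Proof.
case: z => a b; rewrite -(sqrtr_sqr b) /cabs /= ler_wsqrtr//.
by rewrite lerDr sqr_ge0.
Qed.

Lemma cabs_le_ReIm z : cabs z <= `|Re z| + `|Im z|.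
Proof.
rewrite [in cabs z](complexE z) (le_trans (cabsD _ _))// cabsM !cabs_real.
have -> : cabs 'i = 1 by rewrite /cabs /= expr0n add0r expr1n sqrtr1.
by rewrite mul1r.
Qed.

Lemma cabs_eq0 z : cabs z = 0 -> z = 0.
Proof.
by move=> z0; apply/eqP; rewrite -normr_eq0 cabsE z0.
Qed.

Lemma cabs_dist_dist z w : `|cabs z - cabs w| <= cabs (z - w).
Proof.
have := cabsD (z - w) w; have := cabsD (w - z) z; rewrite !subrK (cabsC w).
by rewrite ler_norml; lra.
Qed.

End modulus.

Section expi.
Variable R : realType.
Implicit Types (s t x : R).
Local Open Scope complex_scope.

Lemma sin_le x : `|sin x| <= `|x|.
Proof.
wlog x0 : x / 0 <= x.
  move=> H; have [/H//|x0] := lerP 0 x.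
  by rewrite -normrN -sinN -[leRHS]normrN H// oppr_ge0 ltW.
have sin_derive y : y \in `]0, x[ -> is_derive y 1 (@sin R) (cos y).
  by move=> _; exact: is_derive_sin.
have sin_cont : {within `[0, x], continuous (@sin R)}.
  by apply: continuous_subspaceT; exact: continuous_sin.
have [c _] := MVT_segment x0 sin_derive sin_cont.
by rewrite sin0 !subr0 => ->; rewrite normrM ler_piMl// cos_max.
Qed.

Lemma cos_half x : 1 - cos x = 2 * sin (x / 2) ^+ 2.
Proof.
have -> : cos x = cos ((x / 2) *+ 2) by rewrite -mulr_natr divfK.
by rewrite cos_mulr2n sin2cos2 mulr2n; ring.
Qed.

Lemma cos_quadratic x : 1 - cos x <= x ^+ 2 / 2.
Proof.
rewrite cos_half; have := sin_le (x / 2).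
rewrite -ler_sqr ?nnegrE// !real_normK ?num_real//.
by rewrite expr_div_n; lra.
Qed.

Lemma sin_quadratic x : `|x - sin x| <= x ^+ 2.
Proof.
wlog x0 : x / 0 <= x.
  move=> H; have [/H//|x0] := lerP 0 x.
  have nx : 0 <= - x by rewrite oppr_ge0 ltW.
  by have := H _ nx; rewrite sinN opprK sqrrN [- x + _]addrC distrC.
have sin_derive y : y \in `]0, x[ -> is_derive y 1 (@sin R) (cos y).
  by move=> _; exact: is_derive_sin.
have sin_cont : {within `[0, x], continuous (@sin R)}.
  by apply: continuous_subspaceT; exact: continuous_sin.
have [c /andP[c0 cx]] := MVT_segment x0 sin_derive sin_cont.
rewrite !bnd_simp in c0 cx.
rewrite sin0 !subr0 => ->; have -> : x - cos c * x = (1 - cos c) * x by ring.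
have c1 : 1 - cos c <= c.
  rewrite cos_half; have := sin_le (c / 2); have := sin_max (c / 2).
  rewrite [`|c / 2|]ger0_norm ?divr_ge0// -real_normK ?num_real//.
  have := normr_ge0 (sin (c / 2)); move: (`|_|) => y; nra.
have c2 := cos_le1 c.
by rewrite ger0_norm ?mulr_ge0//; nra.
Qed.

Definition expi t : R[i] := cos (2 * pi * t) +i* sin (2 * pi * t).

Lemma expiD s t : expi (s + t) = expi s * expi t.
Proof. by apply/eqP; rewrite /expi mulrDr cosD sinD eq_complex /= [sin _ * cos _ + _]addrC !eqxx. Qed.

Lemma expi0 : expi 0 = 1.
Proof. by rewrite /expi mulr0 cos0 sin0. Qed.

Lemma expiNr t : expi (- t) = conjc (expi t).
Proof. by rewrite /expi mulrN cosN sinN. Qed.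

Lemma cabs_expi t : cabs (expi t) = 1.
Proof. by rewrite /cabs /= cos2Dsin2 sqrtr1. Qed.

Lemma expi1 : expi 1 = 1.
Proof. by rewrite /expi mulr1 mulr_natl cos2pi sin2pi. Qed.

Lemma expi_natM n t : expi (n%:R * t) = expi t ^+ n.
Proof.
elim: n => [|n IH]; first by rewrite mul0r expi0.
by rewrite -natr1 mulrDl mul1r expiD IH exprSr.
Qed.

Lemma expi_nat n : expi n%:R = 1.
Proof. by rewrite -[n%:R]mulr1 expi_natM expi1 expr1n. Qed.

Lemma expi_int (k : int) : expi k%:~R = 1.
Proof.
case: (intP k) => [|n|n]; first by rewrite expi0.
  by rewrite -pmulrn expi_nat.
by rewrite mulrNz -pmulrn expiNr expi_nat conjc1.
Qed.

Lemma expiDint t (k : int) : expi (t + k%:~R) = expi t.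
Proof. by rewrite expiD expi_int mulr1. Qed.

Lemma expi_eqmod s t (k : int) : s - t = k%:~R -> expi s = expi t.
Proof. by move=> h; rewrite -(expiDint t k) -h addrC subrK. Qed.

(** Twice the square of [2 * pi]: for [x = 2 * pi * t], the deviations [1 - cos x] and [x - sin x]
    are each at most [x ^ 2] in absolute value. *)
Definition expi_const : R := 8 * pi ^+ 2.

Lemma expi_const_ge1 : 1 <= expi_const.
Proof. by have := pi_ge2 R; rewrite /expi_const; nra. Qed.

Lemma expi_taylor t : cabs (expi t - 1 - (2 * pi * t)%:C * 'i) <= expi_const * t ^+ 2.
Proof.
apply: (le_trans (cabs_le_ReIm _)); rewrite /expi /=.
rewrite !(mulr0, mul0r, mulr1, sub0r, subr0, addr0, add0r, oppr0).
set x := 2 * pi * t; have := cos_quadratic x; have := sin_quadratic x; have := cos_le1 x.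
have -> : expi_const * t ^+ 2 = 2 * x ^+ 2 by rewrite /x /expi_const; ring.
rewrite (distrC (sin x)) (distrC (cos x)) => h1 h2 h3.
rewrite [`|1 - _|]ger0_norm; last lra.
have := sqr_ge0 x; lra.
Qed.

Lemma expi_taylor_at s t :
  cabs (expi (s + t) - expi s - (2 * pi * t)%:C * 'i * expi s) <= expi_const * t ^+ 2.
Proof.
have -> : expi (s + t) - expi s - (2 * pi * t)%:C * 'i * expi s
  = expi s * (expi t - 1 - (2 * pi * t)%:C * 'i) by rewrite expiD; ring.
by rewrite cabsM cabs_expi mul1r expi_taylor.
Qed.

Lemma expi_lip0 t : cabs (expi t - 1) <= 4 * pi * `|t|.
Proof.
apply: (le_trans (cabs_le_ReIm _)); rewrite /expi /= subr0.
set x := 2 * pi * t; have -> : 4 * pi * `|t| = 2 * `|x|.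
  by rewrite /x !normrM ger0_norm// [`|pi|]ger0_norm ?pi_ge0//; ring.
have -> : `|cos x - 1| = 1 - cos x by rewrite distrC ger0_norm// subr_ge0 cos_le1.
have := sin_le x; have := cos_quadratic x; have := cos_half x; have := sin_le (x / 2); have := sin_max (x / 2).
rewrite [`|x / 2|]normrM [`|2^-1|]ger0_norm ?invr_ge0// => a b c _ d.
suff : 2 * sin (x / 2) ^+ 2 <= `|x| by lra.
rewrite -real_normK ?num_real//; have := normr_ge0 (sin (x / 2)).
move: a b; move: (`|sin (x / 2)|) (`|x|) => u v; nra.
Qed.

Lemma expi_lip s t (k : int) : cabs (expi s - expi t) <= 4 * pi * `|s - t - k%:~R|.
Proof.
have -> : expi s - expi t = expi t * (expi (s - t - k%:~R) - 1).
  rewrite mulrBr -expiD mulr1; congr (_ - _).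
  have -> : t + (s - t - k%:~R) = s + (- k)%:~R by rewrite mulrNz; ring.
  by rewrite expiDint.
by rewrite cabsM cabs_expi mul1r expi_lip0.
Qed.

Lemma cabs_expiB1_sqr t : cabs (expi t - 1) ^+ 2 = 2 - 2 * cos (2 * pi * t).
Proof.
rewrite /cabs sqr_sqrtr ?addr_ge0 ?sqr_ge0//= subr0.
by have := cos2Dsin2 (2 * pi * t); set c := cos _; set d := sin _ => h; lra.
Qed.

(** The squared chord [2 - 2 * cos (2 * pi * u)] increases for [u] in [[0, 1 / 2]]; [k] is its value
    at [d], cut off at [1 / 2] to stay on this branch. *)
Lemma expi_near_int (d : R) : 0 < d -> exists2 k : R, 0 < k &
  forall t, cabs (expi t - 1) ^+ 2 < k -> exists m : int, `|t - m%:~R| < d.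
Proof.
move=> d0; pose d' := Num.min d (1 / 2).
have d'0 : 0 < d' by rewrite lt_min d0; lra.
have d'2 : d' <= 1 / 2 by rewrite ge_min lexx orbT.
have d'd : d' <= d by rewrite ge_min lexx.
have p0 := pi_gt0 R.
exists (2 - 2 * cos (2 * pi * d')).
  suff : cos (2 * pi * d') < cos 0 by rewrite cos0; lra.
  rewrite ltr_cos ?mulr_gt0//; rewrite in_itv/= ?lexx ?pi_ge0//.
  by apply/andP; split; nra.
move=> t; rewrite cabs_expiB1_sqr => h.
pose m := Num.floor (t + 1 / 2); exists m.
have /andP[m1 m2] : m%:~R <= t + 1 / 2 < (m + 1)%:~R by exact: floor_itv.
rewrite intrD in m2.
pose u := t - m%:~R; rewrite -/u.
have E : cos (2 * pi * t) = cos (2 * pi * `|u|).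
  have -> : cos (2 * pi * `|u|) = cos (2 * pi * u).
    by rewrite -[RHS]cos_norm !normrM [`|2|]ger0_norm// [`|pi|]ger0_norm ?pi_ge0.
  have := expiDint t (- m); rewrite mulrNz -/u => /(congr1 (@complex.Re R)) /= <- //.
rewrite E in h; apply: lt_le_trans d'd.
have u2 : `|u| <= 1 / 2 by rewrite ler_norml /u; lra.
have : cos (2 * pi * d') < cos (2 * pi * `|u|) by lra.
have u0 := normr_ge0 u.
rewrite ltr_cos; last 2 first.
- by rewrite in_itv/=; apply/andP; split; nra.
- by rewrite in_itv/=; apply/andP; split; nra.
by rewrite ltr_pM2l// mulr_gt0.
Qed.

End expi.

Arguments expi : simpl never.

Arguments conjc : simpl never.

(** * Sums over primes and the Turan-Kubilius inequality *)

Section primes.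
Variable R : realType.
Local Notation ln n := (exp.ln (n%:R : R)).
Local Notation vM := (@von_mangoldt R).

Definition prime_recip (W : nat) : R := \sum_(1 <= p < W.+1 | prime p) p%:R^-1.

Lemma geometric_le (x : R) N : 0 <= x -> x <= 1 / 2 ->
  \sum_(1 <= k < N.+1) x ^+ k <= 2 * x.
Proof.
move=> x0 x1; suff H n : \sum_(1 <= k < n.+1) x ^+ k <= 2 * x - 2 * x ^+ n.+1.
  by apply: (le_trans (H N)); rewrite gerBl mulr_ge0// exprn_ge0.
elim: n => [|n IH]; first by rewrite big_geq// expr1; lra.
rewrite big_nat_recr//=; apply: (le_trans (lerD IH (lexx _))).
by rewrite (exprS x n.+1); have := exprn_ge0 n.+1 x0; move: (x ^+ n.+1) => y; nra.
Qed.

(** In Mertens' sum all powers of one prime contribute at most [2 * ln p / p], a geometric series of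
    ratio at most [1 / 2]. *)
Lemma sum_ln_prime_ge N : (0 < N)%N ->
  (ln N - 1) / 2 <= \sum_(1 <= p < N.+1 | prime p) ln p / p%:R.
Proof.
move=> N0; have /andP[m1 _] := mertens R N0.
suff : \sum_(1 <= k < N.+1) vM k / k%:R <= 2 * \sum_(1 <= p < N.+1 | prime p) ln p / p%:R by lra.
apply: (@le_trans _ _ (\sum_(1 <= n < N.+1) \sum_(1 <= p < N.+1 | prime p)
   \sum_(1 <= k < N.+1 | n == (p ^ k)%N) ln p / n%:R)).
  apply: ler_sum_nat => n /andP[n1 nN]; rewrite /von_mangoldt big_distrl/=.
  have nonneg p : 0 <= ln p / n%:R by rewrite divr_ge0 ?ln_nat_ge0.
  rewrite [leRHS](big_cat_nat (n := n.+1))//= -[leLHS]addr0; apply: lerD; last first.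
    by apply: sumr_ge0 => p _; apply: sumr_ge0.
  apply: ler_sum => p _; rewrite big_distrl/=.
  rewrite [leRHS](big_cat_nat (n := n.+1))//= -[leLHS]addr0; apply: lerD => //.
  by apply: sumr_ge0.
rewrite exchange_big/= big_distrr/=; apply: ler_sum => p pp.
have p0 : 0 < p%:R :> R by rewrite ltr0n prime_gt0.
rewrite (exchange_big_dep_nat predT)//=.
apply: (@le_trans _ _ (\sum_(1 <= k < N.+1) ln p * p%:R^-1 ^+ k)); last first.
  rewrite -big_distrr/= mulrCA; apply: ler_wpM2l; first exact: ln_nat_ge0.
  apply: geometric_le; first by rewrite invr_ge0 ltW.
  by rewrite div1r lef_pV2 ?posrE// ler_nat prime_gt1.
apply: ler_sum => k _; rewrite big_nat1_eq.
case: ifP => _; last by rewrite mulr_ge0 ?ln_nat_ge0// exprn_ge0// invr_ge0 ltW.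
by rewrite natrX exprVn.
Qed.

(** For [N] large in terms of [W], the primes in [(W, N]] have [ln p / p] adding up to at least
    [ln N / 4], hence [1 / p] to at least [1 / 4]; this is iterated. *)
Lemma prime_recip_unbounded (K : R) : exists W, K <= prime_recip W.
Proof.
have step W : exists W', prime_recip W + 1 / 4 <= prime_recip W'.
  pose A := \sum_(1 <= p < W.+1 | prime p) ln p / p%:R.
  have [n0 H] := ln_nat_unbounded (4 * (A + 1)).
  pose N := maxn n0 W.+1; exists N; have l := H N (leq_maxl _ _).
  have A0 : 0 <= A by apply: sumr_ge0 => p _; rewrite divr_ge0 ?ln_nat_ge0.
  have WN : (W < N)%N by rewrite leq_max leqnn orbT.
  have N0 : (0 < N)%N by apply: leq_trans WN.
  have := sum_ln_prime_ge N0.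
  rewrite /prime_recip [in leRHS](big_cat_nat (n := W.+1))//= -/A; last by apply: leq_trans WN _.
  move=> h; rewrite [leRHS](big_cat_nat (n := W.+1))//=; last by apply: leq_trans WN _.
  rewrite lerD2l; have l1 : 0 < ln N by lra.
  rewrite -(ler_pM2l l1); apply: (@le_trans _ _ (\sum_(W.+1 <= p < N.+1 | prime p) ln p / p%:R)).
    by move: h; move: (\sum_(_ <= _ < _ | _) _) => S; lra.
  rewrite big_distrr/= big_nat_cond [leRHS]big_nat_cond.
  apply: ler_sum => p /andP[/andP[p1 p2] pp].
  by rewrite ler_wpM2r ?invr_ge0// ln_le// prime_gt0.
have iter j : exists W, prime_recip 0 + j%:R / 4 <= prime_recip W.
  elim: j => [|i [V HV]]; first by exists 0%N; lra.
  by have [V' HV'] := step V; exists V'; rewrite -(natr1 i); lra.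
have [W HW] := iter (Num.bound (4 * `|K|)); exists W; apply: le_trans HW.
have : 4 * `|K| < (Num.bound (4 * `|K|))%:R by apply: archi_boundP; rewrite mulr_ge0.
have -> : prime_recip 0 = 0 by rewrite /prime_recip big_geq.
by have := ler_norm K; lra.
Qed.

Definition prime_count (W n : nat) : R := \sum_(1 <= p < W.+1 | prime p) (p %| n)%:R.

Lemma sum_dvd N p : (0 < p)%N -> \sum_(1 <= n < N.+1) ((p %| n)%:R : R) = (N %/ p)%:R.
Proof.
move=> p0; transitivity (\sum_(1 <= n < N.+1 | (p %| n)%N) (1 : R)).
  by rewrite [RHS]big_mkcond; apply: eq_bigr => n _; case: (_ %| _)%N.
by rewrite sum_multiples// sumr_const_nat subn1.
Qed.

Lemma turan_kubilius W N :
  \sum_(1 <= n < N.+1) (prime_count W n - prime_recip W) ^+ 2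
  <= N%:R * prime_recip W + 2 * W%:R ^+ 2.
Proof.
pose a p n : R := (p %| n)%:R - p%:R^-1.
have N0 : 0 <= N%:R :> R by [].
have pair p q : prime p -> prime q -> \sum_(1 <= n < N.+1) a p n * a q n
    <= (p == q)%:R * (N%:R / p%:R) + 2.
  move=> pp pq; have p0 := prime_gt0 pp; have q0 := prime_gt0 pq.
  have p0' : 0 < p%:R :> R by rewrite ltr0n.
  have q0' : 0 < q%:R :> R by rewrite ltr0n.
  have p1 : p%:R^-1 <= 1 :> R by rewrite invf_le1// ler1n.
  have q1 : q%:R^-1 <= 1 :> R by rewrite invf_le1// ler1n.
  have pi0 : 0 <= p%:R^-1 :> R by rewrite invr_ge0 ltW.
  have qi0 : 0 <= q%:R^-1 :> R by rewrite invr_ge0 ltW.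
  have -> : \sum_(1 <= n < N.+1) a p n * a q n
    = \sum_(1 <= n < N.+1) ((p %| n) && (q %| n))%N%:R - q%:R^-1 * (N %/ p)%:R
      - p%:R^-1 * (N %/ q)%:R + N%:R * (p%:R^-1 * q%:R^-1).
    rewrite -!sum_dvd// !big_distrr/= -!sumrB.
    have -> : N%:R * (p%:R^-1 * q%:R^-1) = \sum_(1 <= n < N.+1) (p%:R^-1 * q%:R^-1) :> R.
      by rewrite sumr_const_nat subn1/= mulr_natl.
    rewrite -big_split/=; apply: eq_bigr => n _; rewrite /a.
    by case: (p %| n)%N; case: (q %| n)%N; rewrite /=; ring.
  have [u1 u2] := quot_bounds R N p0; have [v1 v2] := quot_bounds R N q0.
  have pu : q%:R^-1 * (N%:R / p%:R - 1) <= q%:R^-1 * (N %/ p)%:R :> R by rewrite ler_wpM2l//; lra.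
  have pv : p%:R^-1 * (N%:R / q%:R - 1) <= p%:R^-1 * (N %/ q)%:R :> R by rewrite ler_wpM2l//; lra.
  case: (eqVneq p q) => [pqE|pqN].
    rewrite -pqE in pu pv *; under eq_bigr do rewrite andbb.
    rewrite sum_dvd//=.
    have : 0 <= N%:R * (p%:R^-1 * p%:R^-1) :> R by rewrite !mulr_ge0.
    by move: pu u1; move: (p%:R^-1) pi0 p1 => x x0 x1; nra.
  have -> : \sum_(1 <= n < N.+1) ((p %| n) && (q %| n))%N%:R = (N %/ (p * q))%:R :> R.
    rewrite -sum_dvd ?muln_gt0 ?p0//; apply: eq_bigr => n _; rewrite Gauss_dvd//.
    by rewrite prime_coprime// dvdn_prime2// (negPf pqN).
  have pq0 : (0 < p * q)%N by rewrite muln_gt0 p0.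
  have [w1 _] := quot_bounds R N pq0.
  rewrite natrM invfM in w1.
  by rewrite mul0r add0r; lra.
have -> : \sum_(1 <= n < N.+1) (prime_count W n - prime_recip W) ^+ 2
  = \sum_(1 <= p < W.+1 | prime p) \sum_(1 <= q < W.+1 | prime q) \sum_(1 <= n < N.+1) a p n * a q n.
  transitivity (\sum_(1 <= n < N.+1) \sum_(1 <= p < W.+1 | prime p) \sum_(1 <= q < W.+1 | prime q) a p n * a q n).
    apply: eq_bigr => n _; rewrite /prime_count /prime_recip -sumrB expr2 big_distrlr/=.
    by [].
  rewrite exchange_big/=; apply: eq_bigr => p _; by rewrite exchange_big.
apply: (@le_trans _ _ (\sum_(1 <= p < W.+1 | prime p) (N%:R / p%:R + 2 * W%:R))).
  apply: ler_sum => p pp.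
  apply: (@le_trans _ _ (\sum_(1 <= q < W.+1 | prime q) ((p == q)%:R * (N%:R / p%:R) + 2))).
    by apply: ler_sum => q pq; apply: pair.
  rewrite big_split/=; apply: lerD.
    rewrite -big_distrl/= -[leRHS]mul1r ler_wpM2r// ?divr_ge0//.
    have -> : \sum_(1 <= q < W.+1 | prime q) (p == q)%:R = \sum_(1 <= q < W.+1 | q == p) (prime q)%:R :> R.
      rewrite big_mkcond [RHS]big_mkcond; apply: eq_bigr => q _; rewrite eq_sym.
      by case: (prime q); case: eqP.
    by rewrite big_nat1_eq; case: ifP => _; rewrite ?pp.
  apply: (@le_trans _ _ (\sum_(1 <= q < W.+1) (2 : R))).
    by rewrite big_mkcond; apply: ler_sum => q _; case: ifP.
  by rewrite sumr_const_nat subn1 mulr_natr.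
rewrite big_split/=; apply: lerD; first by rewrite /prime_recip big_distrr.
apply: (@le_trans _ _ (\sum_(1 <= q < W.+1) (2 * W%:R : R))).
  by rewrite big_mkcond; apply: ler_sum => q _; case: ifP => // _; rewrite mulr_ge0.
by rewrite sumr_const_nat subn1/= -[_ *+ W]mulr_natr expr2 mulrA.
Qed.

End primes.

(** * The Katai criterion *)

Section katai.
Variable R : realType.
Local Notation mu n := ((mobius n)%:~R : R[i]).
Implicit Types F G : nat -> R[i].

Definition mobius_null F := forall e : R, 0 < e -> exists N0, forall N, (N0 <= N)%N ->
  cabs (\sum_(1 <= n < N.+1) F n * mu n) <= e * N%:R.

Definition mean_null F := forall e : R, 0 < e -> exists N0, forall N, (N0 <= N)%N ->
  cabs (\sum_(1 <= n < N.+1) F n) <= e * N%:R.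

Lemma cabs_mu n : cabs (mu n) <= 1.
Proof. by rewrite cabs_int -intr_norm (ler_int R _ 1) mobius_abs. Qed.

(** Summed with [t] near the root mean square of the terms, this does the work of the Cauchy-Schwarz
    inequality. *)
Lemma norm_le_sq (x t : R) : 0 < t -> x <= x ^+ 2 / (2 * t) + t / 2.
Proof.
move=> t0; rewrite -subr_ge0.
have -> : x ^+ 2 / (2 * t) + t / 2 - x = (x - t) ^+ 2 / (2 * t) by field; rewrite gt_eqF.
by rewrite divr_ge0 ?sqr_ge0// mulr_ge0// ltW.
Qed.

Lemma mean_null_le F (e : R) : mean_null F -> 0 < e ->
  exists2 K : R, 0 <= K & forall N, cabs (\sum_(1 <= n < N.+1) F n) <= e * N%:R + K.
Proof.
move=> H e0; have [N0 HN] := H e e0.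
exists (\sum_(0 <= N < N0) cabs (\sum_(1 <= n < N.+1) F n)).
  by apply: sumr_ge0 => i _; exact: cabs_ge0.
have P : 0 <= \sum_(0 <= N < N0) cabs (\sum_(1 <= n < N.+1) F n).
  by apply: sumr_ge0 => i _; exact: cabs_ge0.
move=> N; case: (leqP N0 N) => hN; first by have := HN _ hN; lra.
have -> : \sum_(0 <= N < N0) cabs (\sum_(1 <= n < N.+1) F n)
  = cabs (\sum_(1 <= n < N.+1) F n) + \sum_(0 <= i < N0 | i != N) cabs (\sum_(1 <= n < i.+1) F n).
  by rewrite (bigD1_seq N) ?iota_uniq// mem_index_iota.
rewrite addrA [_ + cabs _]addrC -addrA lerDl addr_ge0//; first by rewrite mulr_ge0// ltW.
by apply: sumr_ge0 => i _; exact: cabs_ge0.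
Qed.

(** Count each [n] once for every prime divisor up to [W]: by Turan-Kubilius this multiplies the sum
    by [L] up to an error ([b1]). For [n = p * m], [mu (p * m) = - mu m] unless [p] divides [m],
    which is rare ([b2]). What remains is a sum of [mu m * G m], bounded by the squares of [G m]
    ([b3]): their diagonal part is at most [N * L], and the rest are the correlations. *)
Lemma katai_sum F (W : nat) (e : R) :
  (forall n, cabs (F n) <= 1) -> 0 < e -> 1 <= prime_recip R W ->
  (forall p q, prime p -> prime q -> p != q -> mean_null (fun n => F (p * n)%N * conjc (F (q * n)%N))) ->
  exists K : R, forall N,
   prime_recip R W * cabs (\sum_(1 <= n < N.+1) F n * mu n)
   <= (2 * Num.sqrt (prime_recip R W) + 2 + W%:R ^+ 2 * e) * N%:R + K.
Proof.
move=> F1 e0 L1 corr; set L := prime_recip R W; set t := Num.sqrt L.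
have L0 : 0 < L by rewrite /L; lra.
have t1 : 1 <= t by rewrite -(sqrtr1 R) ler_wsqrtr.
have t0 : 0 < t by lra.
have tE : t ^+ 2 = L by rewrite sqr_sqrtr// ltW.
have [K K0 HK] : exists2 K : R, 0 <= K & forall p q, prime p -> prime q -> p != q ->
    (p <= W)%N -> (q <= W)%N -> forall N,
    cabs (\sum_(1 <= n < N.+1) F (p * n)%N * conjc (F (q * n)%N)) <= e * N%:R + K.
  have H1 p q : exists K : R, 0 <= K /\ (prime p -> prime q -> p != q -> forall N,
    cabs (\sum_(1 <= n < N.+1) F (p * n)%N * conjc (F (q * n)%N)) <= e * N%:R + K).
    case: (boolP [&& prime p, prime q & p != q]) => [/and3P[pp pq pqN]|h].
      by have [K K0 HK] := mean_null_le (corr p q pp pq pqN) e0; exists K.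
    by exists 0; split=> // pp pq pqN; move: h; rewrite pp pq pqN.
  pose k p q := projT1 (cid (H1 p q)).
  have k0 p q : 0 <= k p q by rewrite /k; case: cid => ? [].
  have kP p q : prime p -> prime q -> p != q -> forall N,
    cabs (\sum_(1 <= n < N.+1) F (p * n)%N * conjc (F (q * n)%N)) <= e * N%:R + k p q.
    by rewrite /k; case: cid => ? [].
  exists (\sum_(0 <= p < W.+1) \sum_(0 <= q < W.+1) k p q).
    by apply: sumr_ge0 => p _; apply: sumr_ge0.
  move=> p q pp pq pqN pW qW N; apply: (le_trans (kP _ _ pp pq pqN N)); rewrite lerD2l.
  rewrite (bigD1_seq p) ?iota_uniq ?mem_index_iota ?ltnS//=.
  rewrite (bigD1_seq q) ?iota_uniq ?mem_index_iota ?ltnS//=.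
  rewrite -addrA lerDl addr_ge0//; first by apply: sumr_ge0.
  by apply: sumr_ge0 => i _; apply: sumr_ge0.
exists (W%:R ^+ 2 * (K + 1)) => N.
have N0 : 0 <= N%:R :> R by [].
pose S := \sum_(1 <= n < N.+1) F n * mu n; rewrite -/S.
pose G m := \sum_(1 <= p < W.+1 | prime p && (p * m <= N)%N) F (p * m)%N.
have main : (L%:C)%C * S = \sum_(1 <= n < N.+1) F n * mu n * ((L - prime_count R W n)%:C)%C
   + (\sum_(1 <= p < W.+1 | prime p) \sum_(1 <= m < (N %/ p).+1) F (p * m)%N * (mu (p * m) + mu m))
   - \sum_(1 <= m < N.+1) mu m * G m.
  have E1 : \sum_(1 <= n < N.+1) F n * mu n * ((prime_count R W n)%:C)%C
     = \sum_(1 <= p < W.+1 | prime p) \sum_(1 <= m < (N %/ p).+1) F (p * m)%N * mu (p * m).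
    transitivity (\sum_(1 <= n < N.+1) \sum_(1 <= p < W.+1 | prime p) (if (p %| n)%N then F n * mu n else 0)).
      apply: eq_bigr => n _; rewrite /prime_count rmorph_sum big_distrr/=.
      by apply: eq_bigr => p _; case: (p %| n)%N; rewrite /= ?mulr1n ?mulr0n ?rmorph1 ?rmorph0 ?mulr1 ?mulr0.
    rewrite exchange_big/=; apply: eq_bigr => p pp.
    by rewrite -big_mkcond/= (sum_multiples N (fun n => F n * mu n)) ?prime_gt0.
  have E2 : \sum_(1 <= m < N.+1) mu m * G m
     = \sum_(1 <= p < W.+1 | prime p) \sum_(1 <= m < (N %/ p).+1) F (p * m)%N * mu m.
    transitivity (\sum_(1 <= m < N.+1) \sum_(1 <= p < W.+1 | prime p)
        (if (p * m <= N)%N then F (p * m)%N * mu m else 0)).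
      apply: eq_bigr => m _; rewrite /G big_mkcondr big_distrr/=.
      by apply: eq_bigr => p _; case: ifP => _; rewrite ?mulr0// mulrC.
    rewrite exchange_big/=; apply: eq_bigr => p pp; have p0 := prime_gt0 pp.
    rewrite [LHS](big_cat_nat (n := (N %/ p).+1))//=; last by rewrite ltnS leq_div.
    rewrite [X in _ + X]big1_seq ?addr0; last first.
      move=> m; rewrite mem_index_iota => /andP[_ /andP[h _]]; case: ifP => // h'.
      by move: h; rewrite ltn_divLR// mulnC ltnNge h'.
    apply: eq_big_nat => m /andP[_]; rewrite ltnS leq_divRL// mulnC => ->//.
  under [X in _ + X - _]eq_bigr do (under eq_bigr do rewrite mulrDr; rewrite big_split/=).
  rewrite big_split/= -E1 -E2 addrA addrK -big_split/= /S big_distrr/=.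
  by apply: eq_bigr => n _; rewrite rmorphB/=; ring.
have b1 : cabs (\sum_(1 <= n < N.+1) F n * mu n * ((L - prime_count R W n)%:C)%C)
   <= N%:R * t + W%:R ^+ 2.
  apply: (le_trans (cabs_sum _ _ _)).
  apply: (@le_trans _ _ (\sum_(1 <= n < N.+1) ((prime_count R W n - L) ^+ 2 / (2 * t) + t / 2))).
    apply: ler_sum => n _; rewrite !cabsM cabs_real distrC.
    apply: (@le_trans _ _ (1 * 1 * `|prime_count R W n - L|)).
      apply: ler_pM => //; first by rewrite mulr_ge0 ?cabs_ge0.
      by apply: ler_pM; rewrite ?cabs_ge0 ?F1 ?cabs_mu.
    rewrite !mul1r; apply: (le_trans (norm_le_sq _ t0)).
    by rewrite real_normK// num_real.
  rewrite big_split/= -big_distrl/= sumr_const_nat subn1/= -[_ *+ N]mulr_natl.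
  apply: (@le_trans _ _ ((N%:R * L + 2 * W%:R ^+ 2) / (2 * t) + N%:R * (t / 2))).
    rewrite lerD2r ler_pM2r ?turan_kubilius// invr_gt0 mulr_gt0//.
  rewrite -tE.
  have -> : (N%:R * t ^+ 2 + 2 * W%:R ^+ 2) / (2 * t) + N%:R * (t / 2) = N%:R * t + W%:R ^+ 2 / t.
    by field; rewrite gt_eqF.
  rewrite lerD2l ler_pdivrMr// ler_peMr// sqr_ge0//.
have b2 : cabs (\sum_(1 <= p < W.+1 | prime p) \sum_(1 <= m < (N %/ p).+1) F (p * m)%N * (mu (p * m) + mu m))
   <= 2 * N%:R.
  apply: (@le_trans _ _ (\sum_(1 <= p < W.+1) N%:R * (p%:R ^- 2))); last first.
    by rewrite -big_distrr/= mulrC ler_wpM2r// sum_invsq.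
  apply: (le_trans (cabs_sum _ _ _)); rewrite big_mkcond/=; apply: ler_sum_nat => p /andP[p1 _].
  case: ifP => pp; last by rewrite mulr_ge0// invr_ge0 exprn_ge0.
  apply: (le_trans (cabs_sum _ _ _)).
  apply: (@le_trans _ _ (\sum_(1 <= m < (N %/ p).+1) (p %| m)%:R)).
    apply: ler_sum => m _; rewrite cabsM -[leRHS]mul1r; apply: ler_pM; rewrite ?cabs_ge0//.
    case: (boolP (p %| m)%N) => pm.
      by rewrite mobius_sq// add0r cabs_mu.
    by rewrite mobius_primeM// rmorphN/= addNr cabs0.
  rewrite sum_dvd//.
  have [q1 _] := quot_bounds R (N %/ p) p1; have [q2 _] := quot_bounds R N p1.
  apply: (le_trans q1).
  have -> : N%:R * p%:R ^- 2 = N%:R / p%:R / p%:R :> R by rewrite expr2 invfM mulrA.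
  by rewrite ler_wpM2r// invr_ge0.
have b3 : cabs (\sum_(1 <= m < N.+1) mu m * G m) <= N%:R * t + W%:R ^+ 2 * (e * N%:R + K).
  apply: (le_trans (cabs_sum _ _ _)).
  apply: (@le_trans _ _ (\sum_(1 <= m < N.+1) (cabs (G m) ^+ 2 / (2 * t) + t / 2))).
    apply: ler_sum => m _; rewrite cabsM.
    apply: (@le_trans _ _ (1 * cabs (G m))); first by rewrite ler_wpM2r ?cabs_ge0 ?cabs_mu.
    by rewrite mul1r; exact: norm_le_sq.
  rewrite big_split/= -big_distrl/= sumr_const_nat subn1/= -[_ *+ N]mulr_natl.
  have sq : \sum_(1 <= m < N.+1) cabs (G m) ^+ 2 <= N%:R * L + W%:R ^+ 2 * (e * N%:R + K).
    have pairb p q : prime p -> prime q -> (p <= W)%N -> (q <= W)%N ->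
      cabs (\sum_(1 <= m < N.+1 | (p * m <= N)%N && (q * m <= N)%N) F (p * m)%N * conjc (F (q * m)%N))
       <= (p == q)%:R * (N%:R / p%:R) + (e * N%:R + K).
      move=> pp pq pW qW; have p0 := prime_gt0 pp; have q0 := prime_gt0 pq.
      have eK : 0 <= e * N%:R + K by rewrite addr_ge0// mulr_ge0// ltW.
      pose N' := minn (N %/ p) (N %/ q).
      have -> : \sum_(1 <= m < N.+1 | (p * m <= N)%N && (q * m <= N)%N) F (p * m)%N * conjc (F (q * m)%N)
         = \sum_(1 <= m < N'.+1) F (p * m)%N * conjc (F (q * m)%N).
        have N'N : (N' <= N)%N by rewrite geq_min leq_div.
        rewrite [LHS](big_cat_nat (n := N'.+1))//= [X in _ + X]big1_seq ?addr0; last first.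
          move=> m; rewrite mem_index_iota => /andP[/andP[h1 h2] /andP[]].
          by rewrite /N' gtn_min -![(_ * m)%N]mulnC -!leq_divRL// in h1 h2 *; rewrite !ltnNge h1 h2.
        rewrite big_nat_cond [RHS]big_nat_cond; apply: eq_bigl => m; rewrite andbT.
        case: (boolP (1 <= m < _)%N) => //= /andP[_]; rewrite ltnS /N' leq_min !leq_divRL//.
        by rewrite mulnC [(m * q)%N]mulnC => ->.
      case: (eqVneq p q) => [E|pqN].
        rewrite -E mul1r -[leLHS]addr0; apply: lerD => //.
        apply: (le_trans (cabs_sum _ _ _)).
        have [q1 _] := quot_bounds R N p0; apply: le_trans q1.
        apply: (@le_trans _ _ (\sum_(1 <= m < N'.+1) 1)).
          by apply: ler_sum => m _; rewrite cabsM cabs_conj; have := F1 (p * m)%N; have := cabs_ge0 (F (p * m)%N); nra.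
        by rewrite sumr_const_nat subn1/= ler_nat /N' geq_minl.
      rewrite mul0r add0r; apply: (le_trans (HK p q pp pq pqN pW qW N')).
      by rewrite lerD2r ler_pM2l// ler_nat /N' geq_min leq_div.
    have -> : \sum_(1 <= m < N.+1) cabs (G m) ^+ 2 = Re (\sum_(1 <= p < W.+1 | prime p) \sum_(1 <= q < W.+1 | prime q)
       \sum_(1 <= m < N.+1 | (p * m <= N)%N && (q * m <= N)%N) F (p * m)%N * conjc (F (q * m)%N)).
      rewrite -[LHS]/(Re ((_)%:C)%C); congr Re; rewrite rmorph_sum/=.
      transitivity (\sum_(1 <= m < N.+1) \sum_(1 <= p < W.+1 | prime p) \sum_(1 <= q < W.+1 | prime q)
         (if (p * m <= N)%N && (q * m <= N)%N then F (p * m)%N * conjc (F (q * m)%N) else 0)).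
        apply: eq_bigr => m _; rewrite cabs_sqr /G rmorph_sum big_distrlr/=.
        rewrite big_mkcondr/=; apply: eq_bigr => p _; case: ifP => h1; last by rewrite big1// => q _; rewrite h1.
        by rewrite big_mkcondr/=; apply: eq_bigr => q _; rewrite /=.
      rewrite exchange_big/=; apply: eq_bigr => p _; rewrite exchange_big/=; apply: eq_bigr => q _.
      by rewrite -big_mkcond.
    apply: (le_trans (ler_norm _)); apply: (le_trans (Re_le_cabs _)); apply: (le_trans (cabs_sum _ _ _)).
    apply: (@le_trans _ _ (\sum_(1 <= p < W.+1 | prime p) (N%:R / p%:R + W%:R * (e * N%:R + K)))).
      rewrite big_nat_cond [leRHS]big_nat_cond; apply: ler_sum => p /andP[/andP[p1 pW] pp].
      apply: (le_trans (cabs_sum _ _ _)).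
      apply: (@le_trans _ _ (\sum_(1 <= q < W.+1 | prime q) ((p == q)%:R * (N%:R / p%:R) + (e * N%:R + K)))).
        rewrite big_nat_cond [leRHS]big_nat_cond; apply: ler_sum => q /andP[/andP[q1 qW] pq].
        exact: pairb.
      rewrite big_split/=; apply: lerD.
        rewrite -big_distrl/= -[leRHS]mul1r ler_wpM2r// ?divr_ge0//.
        have -> : \sum_(1 <= q < W.+1 | prime q) (p == q)%:R = \sum_(1 <= q < W.+1 | q == p) (prime q)%:R :> R.
          rewrite big_mkcond [RHS]big_mkcond; apply: eq_bigr => q _; rewrite eq_sym.
          by case: (prime q); case: eqP.
        by rewrite big_nat1_eq; case: ifP => _; rewrite ?pp.
      apply: (@le_trans _ _ (\sum_(1 <= q < W.+1) (e * N%:R + K))).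
        by rewrite big_mkcond; apply: ler_sum => q _; case: ifP => // _; rewrite addr_ge0// mulr_ge0// ltW.
      by rewrite sumr_const_nat subn1 mulr_natl.
    rewrite big_split/=; apply: lerD; first by rewrite /L /prime_recip big_distrr.
    apply: (@le_trans _ _ (\sum_(1 <= q < W.+1) (W%:R * (e * N%:R + K)))).
      by rewrite big_mkcond; apply: ler_sum => q _; case: ifP => // _; rewrite mulr_ge0// addr_ge0// mulr_ge0// ltW.
    by rewrite sumr_const_nat subn1/= -[_ *+ W]mulr_natl expr2 mulrA.
  have X0 : 0 <= W%:R ^+ 2 * (e * N%:R + K) by rewrite mulr_ge0 ?sqr_ge0// addr_ge0// mulr_ge0// ltW.
  apply: (@le_trans _ _ ((N%:R * L + W%:R ^+ 2 * (e * N%:R + K)) / (2 * t) + N%:R * (t / 2))).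
    by rewrite lerD2r ler_pM2r// invr_gt0 mulr_gt0.
  move: X0; move: (W%:R ^+ 2 * (e * N%:R + K)) => X X0; rewrite -tE.
  have -> : (N%:R * t ^+ 2 + X) / (2 * t) + N%:R * (t / 2) = N%:R * t + X / (2 * t).
    by field; rewrite gt_eqF.
  by rewrite lerD2l ler_pdivrMr ?mulr_gt0// ler_peMr//; lra.
have -> : L * cabs S = cabs ((L%:C)%C * S) by rewrite cabsM cabs_real ger0_norm// ltW.
rewrite main; apply: (le_trans (cabsB _ _)); apply: (le_trans (lerD (cabsD _ _) (lexx _))).
move: b1 b2 b3; rewrite !mulrDr; lra.
Qed.

Theorem katai F : (forall n, cabs (F n) <= 1) ->
  (forall p q, prime p -> prime q -> p != q -> mean_null (fun n => F (p * n)%N * conjc (F (q * n)%N))) ->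
  mobius_null F.
Proof.
move=> F1 corr e e0.
(* With [t] the square root of [L] and tolerance [1 / W ^ 2] for the correlations, [katai_sum] gives
   [t ^ 2 * S <= (2 * t + 3) * N + K <= 8 * t * N]; so [t >= 8 / e] suffices. *)
have [W HW] := prime_recip_unbounded (1 + (8 / e) ^+ 2).
set L := prime_recip R W in HW *; have sq0 := sqr_ge0 (8 / e).
have L1 : 1 <= L by lra.
pose t := Num.sqrt L.
have t1 : 1 <= t by rewrite -(sqrtr1 R) ler_wsqrtr.
have tE : t ^+ 2 = L by rewrite sqr_sqrtr//; lra.
have te : 8 <= t * e.
  rewrite -ler_pdivrMr// -ler_sqr ?nnegrE ?divr_ge0//; [|exact: ltW|lra].
  by rewrite tE; lra.
have W0 : 0 < W%:R :> R.
  rewrite ltr0n lt0n; apply/eqP => W0.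
  by move: L1; rewrite /L /prime_recip W0 big_geq//; lra.
have e1 : 0 < W%:R ^- 2 :> R by rewrite invr_gt0 exprn_gt0.
have [K HK] := katai_sum F1 e1 L1 corr.
exists (Num.bound `|K|) => N hN; have := HK N; rewrite -/L -/t.
have KN : K <= N%:R.
  apply: (le_trans (ler_norm _)); apply/ltW/(lt_le_trans (archi_boundP (normr_ge0 _))).
  by rewrite ler_nat.
rewrite mulfV ?gt_eqF ?exprn_gt0//; move: (cabs _) => S h.
have N0 : 0 <= N%:R :> R by [].
have h2 : t ^+ 2 * S <= t * 8 * N%:R.
  by rewrite tE; apply: (le_trans h); nra.
have h3 : t * S <= 8 * N%:R.
  by rewrite -(ler_pM2l (_ : 0 < t)); [rewrite mulrA -expr2 mulrA|lra].
have t0 : 0 < t by lra.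
rewrite -(ler_pM2l t0); apply: (le_trans h3); rewrite mulrA ler_wpM2r//.
Qed.

End katai.

(** * Fejer kernels and equidistribution *)

Section fejer.
Variable R : realType.
Implicit Types (s t v x y : R) (Q P : nat).
Local Notation "x %:C" := (real_complex _ x) (format "x %:C") : ring_scope.

Lemma expi_eq1 t : expi t = 1 -> exists m : int, t = m%:~R.
Proof.
move=> h; pose m := Num.floor (t + 1 / 2); exists m.
have /andP[m1 m2] : m%:~R <= t + 1 / 2 < (m + 1)%:~R by exact: floor_itv.
rewrite intrD in m2.
pose u := t - m%:~R.
have hu : expi u = 1 by rewrite /u -mulrNz expiDint.
have cu : cos (2 * pi * `|u|) = 1.
  have -> : cos (2 * pi * `|u|) = cos (2 * pi * u).
    by rewrite -[RHS]cos_norm !normrM [`|2|]ger0_norm// [`|pi|]ger0_norm ?pi_ge0.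
  by have := congr1 (@complex.Re R) hu.
have u2 : `|u| <= 1 / 2 by rewrite ler_norml /u; lra.
have u0 := normr_ge0 u; have p0 := pi_gt0 R.
have : 2 * pi * `|u| = 0.
  apply: (@cos_inj R); rewrite ?in_itv/= ?lexx ?pi_ge0 ?cos0//.
  by apply/andP; split; nra.
move/eqP; rewrite !mulf_eq0 normr_eq0 (gt_eqF p0) pnatr_eq0 /= => /eqP; rewrite /u; lra.
Qed.

Lemma geometric_expi t N :
  (\sum_(0 <= i < N) expi (i%:R * t)) * (expi t - 1) = expi (N%:R * t) - 1.
Proof.
elim: N => [|N IH]; first by rewrite big_geq// mul0r mul0r expi0 subrr.
by rewrite big_nat_recr//= mulrDl IH -(natr1 N) mulrDl mul1r expiD; ring.
Qed.

Lemma sum_roots_unity (P : nat) (m : int) : (0 < P)%N -> (`|m| < P)%N -> m != 0 ->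
  \sum_(0 <= i < P) expi (i%:R * (m%:~R / P%:R : R)) = 0.
Proof.
move=> P0 mP m0; have P0' : P%:R != 0 :> R by rewrite pnatr_eq0 -lt0n.
have := geometric_expi (m%:~R / P%:R) P.
rewrite mulrC [_ * (_ / _)]mulrC divfK// expi_int subrr => /eqP.
rewrite mulf_eq0 => /orP[|/eqP //]; rewrite subr_eq0 => /eqP /expi_eq1[k hk].
exfalso; have : m = k * P%:Z.
  apply/eqP; rewrite -(eqr_int R) intrM -[P%:~R]/(P%:R) -hk divfK//.
by move=> mE; move: mP m0; rewrite mE abszM /= ; case: (k =P 0) => [->|]; rewrite ?mul0r ?eqxx//; nia.
Qed.

Definition dirichlet_kernel Q t : R[i] := \sum_(0 <= j < Q) expi (j%:R * t).
Definition fejer_kernel Q t : R := cabs (dirichlet_kernel Q t) ^+ 2 / Q%:R.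

Lemma fejer_kernel_ge0 Q t : 0 <= fejer_kernel Q t.
Proof. by rewrite divr_ge0// sqr_ge0. Qed.

Lemma fejer_kernelE Q t : (fejer_kernel Q t)%:C
  = Q%:R^-1 * \sum_(0 <= j < Q) \sum_(0 <= k < Q) expi ((j%:Z - k%:Z)%:~R * t).
Proof.
rewrite /fejer_kernel rmorphM fmorphV rmorph_nat /= cabs_sqr /dirichlet_kernel mulrC; congr (_ * _).
rewrite rmorph_sum big_distrlr/=; apply: eq_bigr => j _; apply: eq_bigr => k _.
by rewrite /= -expiNr -expiD intrD mulrNz mulrDl mulNr.
Qed.

(** By the geometric sum, the left side is [|expi (Q t) - 1| ^ 2 / Q]. The squared chord is
    therefore the natural measure of distance on the circle here, and the moduli of continuity below
    are expressed through it. *)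
Lemma fejer_kernel_tail Q t : (0 < Q)%N -> fejer_kernel Q t * cabs (expi t - 1) ^+ 2 <= 4 / Q%:R.
Proof.
move=> Q0; rewrite /fejer_kernel mulrAC -exprMn -cabsM geometric_expi.
rewrite ler_wpM2r ?invr_ge0//.
have : cabs (expi (Q%:R * t) - 1) <= 2.
  by apply: (le_trans (cabsB _ _)); rewrite cabs_expi cabs1; lra.
by have := cabs_ge0 (expi (Q%:R * t) - 1); nra.
Qed.

(** The frequencies [j - k] are smaller than [P] in absolute value, so averaging over [P] equally
    spaced points is exact: only the [Q] terms with [j = k] survive. *)
Lemma sum_fejer_kernel Q P v : (0 < Q)%N -> (Q <= P)%N ->
  \sum_(0 <= i < P) fejer_kernel Q (v - i%:R / P%:R) = P%:R.
Proof.
move=> Q0 QP; have P0 : (0 < P)%N by apply: leq_trans QP.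
have Q0' : Q%:R != 0 :> R[i] by rewrite pnatr_eq0 -lt0n.
apply: (@complexI R); rewrite rmorph_sum rmorph_nat /=.
transitivity (Q%:R^-1 * \sum_(0 <= j < Q) \sum_(0 <= k < Q) \sum_(0 <= i < P)
    expi ((j%:Z - k%:Z)%:~R * (v - i%:R / P%:R))).
  under eq_bigr do rewrite fejer_kernelE.
  rewrite -big_distrr/= exchange_big/=; congr (_ * _); apply: eq_bigr => j _.
  by rewrite exchange_big.
transitivity (Q%:R^-1 * \sum_(0 <= j < Q) (P%:R : R[i])); last first.
  by rewrite sumr_const_nat subn0 -[P%:R *+ Q]mulr_natl mulKf.
congr (_ * _); apply: eq_big_nat => j /andP[_ jQ].
rewrite (bigD1_seq j) ?iota_uniq ?mem_index_iota//=.
rewrite [X in _ + X]big1_seq ?addr0.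
  under eq_bigr do rewrite subrr mul0r expi0.
  by rewrite sumr_const_nat subn0.
move=> k; rewrite mem_index_iota => /andP[kj /andP[_ kQ]].
transitivity (expi ((j%:Z - k%:Z)%:~R * v) * \sum_(0 <= i < P) expi (i%:R * ((k%:Z - j%:Z)%:~R / P%:R))).
  rewrite big_distrr/=; apply: eq_bigr => i _; rewrite -expiD; congr expi.
  by rewrite !intrD !mulrNz; ring.
rewrite sum_roots_unity ?mulr0//; first by lia.
by rewrite subr_eq0; apply: contra kj; rewrite eqz_nat.
Qed.

(** The approximate identity in discrete form: a deviation may be [e] nearby and a multiple of the
    squared chord far away, and by [fejer_kernel_tail] the latter costs only [4 * B / Q] on
    average. *)
Lemma fejer_average Q P v (phi : nat -> R[i]) (l : R[i]) (e B : R) :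
  (0 < Q)%N -> (Q <= P)%N -> 0 <= B ->
  (forall i, (i < P)%N -> cabs (phi i - l) <= e + B * cabs (expi (v - i%:R / P%:R) - 1) ^+ 2) ->
  cabs (P%:R^-1 * \sum_(0 <= i < P) phi i * (fejer_kernel Q (v - i%:R / P%:R))%:C - l)
  <= e + 4 * B / Q%:R.
Proof.
move=> Q0 QP B0 H; have P0 : (0 < P)%N by apply: leq_trans QP.
have P0' : 0 < P%:R :> R by rewrite ltr0n.
have PC0 : P%:R != 0 :> R[i] by rewrite pnatr_eq0 -lt0n.
have E : l = P%:R^-1 * \sum_(0 <= i < P) l * (fejer_kernel Q (v - i%:R / P%:R))%:C.
  by rewrite -big_distrr/= -rmorph_sum sum_fejer_kernel// rmorph_nat mulrCA mulVf ?mulr1.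
rewrite {1}E -mulrBr -sumrB cabsM cabsV cabs_nat.
rewrite mulrC ler_pdivrMr//; apply: (le_trans (cabs_sum _ _ _)).
apply: (@le_trans _ _ (\sum_(0 <= i < P) (e * fejer_kernel Q (v - i%:R / P%:R) + B * (4 / Q%:R)))).
  apply: ler_sum_nat => i /andP[_ iP]; rewrite -mulrBl cabsM cabs_real ger0_norm ?fejer_kernel_ge0//.
  apply: (le_trans (ler_wpM2r (fejer_kernel_ge0 _ _) (H i iP))).
  rewrite mulrDl lerD2l -mulrA ler_wpM2l// mulrC; exact: fejer_kernel_tail.
rewrite big_split/= -big_distrr/= sum_fejer_kernel// sumr_const_nat subn0 -[_ *+ P]mulr_natr.
by rewrite mulrDl; lra.
Qed.

End fejer.

Section trigonometric.
Variable R : realType.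
Implicit Types (phi f g : R -> R -> R[i]).
Local Notation "x %:C" := (real_complex _ x) (format "x %:C") : ring_scope.

(* Also encodes periodicity, since [expi] only sees its argument modulo 1. *)
Definition torus_continuous phi := forall e : R, 0 < e -> exists2 k : R, 0 < k &
  forall x y x' y', cabs (expi (x - x') - 1) ^+ 2 < k -> cabs (expi (y - y') - 1) ^+ 2 < k ->
  cabs (phi x y - phi x' y') <= e.

Inductive trig_poly : (R -> R -> R[i]) -> Prop :=
| trig_poly_mono c (m l : int) : trig_poly (fun x y => c * expi (m%:~R * x + l%:~R * y))
| trig_poly_add f g : trig_poly f -> trig_poly g -> trig_poly (fun x y => f x y + g x y).

Lemma trig_poly_scale c f : trig_poly f -> trig_poly (fun x y => c * f x y).
Proof.
elim=> [d m l|{}f g _ hf _ hg].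
  have -> : (fun x y => c * (d * expi (m%:~R * x + l%:~R * y)))
    = (fun x y => (c * d) * expi (m%:~R * x + l%:~R * y)).
    by apply/funext => x; apply/funext => y; rewrite mulrA.
  exact: trig_poly_mono.
have -> : (fun x y => c * (f x y + g x y)) = (fun x y => c * f x y + c * g x y).
  by apply/funext => x; apply/funext => y; rewrite mulrDr.
exact: trig_poly_add.
Qed.

Lemma trig_poly0 : trig_poly (fun _ _ => 0).
Proof.
have -> : (fun _ _ : R => 0) = (fun x y : R => 0 * expi (0%:~R * x + 0%:~R * y)).
  by apply/funext => x; apply/funext => y; rewrite mul0r.
exact: trig_poly_mono.
Qed.

Lemma trig_poly_sum (I : Type) (r : seq I) (F : I -> R -> R -> R[i]) :
  (forall i, trig_poly (F i)) -> trig_poly (fun x y => \sum_(i <- r) F i x y).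
Proof.
move=> H; elim: r => [|a r IH].
  have -> : (fun x y => \sum_(i <- [::]) F i x y) = (fun _ _ => 0).
    by apply/funext => x; apply/funext => y; rewrite big_nil.
  exact: trig_poly0.
have -> : (fun x y => \sum_(i <- a :: r) F i x y) = (fun x y => F a x y + \sum_(i <- r) F i x y).
  by apply/funext => x; apply/funext => y; rewrite big_cons.
exact: trig_poly_add.
Qed.

Lemma trig_poly_mul f g : trig_poly f -> trig_poly g -> trig_poly (fun x y => f x y * g x y).
Proof.
elim=> [c m l|f1 f2 _ h1 _ h2] hg.
  elim: hg => [d m' l'|g1 g2 _ h1 _ h2].
    have -> : (fun x y => c * expi (m%:~R * x + l%:~R * y) * (d * expi (m'%:~R * x + l'%:~R * y)))
      = (fun x y => (c * d) * expi ((m + m')%:~R * x + (l + l')%:~R * y)).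
      apply/funext => x; apply/funext => y; rewrite mulrACA -expiD; congr (_ * expi _).
      by rewrite !intrD; ring.
    exact: trig_poly_mono.
  have -> : (fun x y => c * expi (m%:~R * x + l%:~R * y) * (g1 x y + g2 x y))
    = (fun x y => c * expi (m%:~R * x + l%:~R * y) * g1 x y + c * expi (m%:~R * x + l%:~R * y) * g2 x y).
    by apply/funext => x; apply/funext => y; rewrite mulrDr.
  exact: trig_poly_add.
have -> : (fun x y => (f1 x y + f2 x y) * g x y) = (fun x y => f1 x y * g x y + f2 x y * g x y).
  by apply/funext => x; apply/funext => y; rewrite mulrDl.
by apply: trig_poly_add; [exact: h1|exact: h2].
Qed.

Lemma trig_poly_approx phi (B : R) : torus_continuous phi ->
  (forall x y, cabs (phi x y) <= B) -> forall e : R, 0 < e ->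
  exists2 s, trig_poly s & forall x y, cabs (phi x y - s x y) <= e.
Proof.
move=> cphi phiB e e0.
have B0 : 0 <= B by apply: le_trans (phiB 0 0); exact: cabs_ge0.
have e2 : 0 < e / 2 by lra.
have [k k0 Hk] := cphi _ e2.
(* Where continuity says nothing, one of the two squared chords is at least [k], and [B'] times it
   exceeds the trivial bound [2 * B]. *)
pose B' := 2 * B / k; have B'0 : 0 <= B' by rewrite divr_ge0 ?mulr_ge0// ltW.
have near x y x' y' : cabs (phi x' y' - phi x y) <=
   (e / 2 + B' * cabs (expi (x - x') - 1) ^+ 2) + B' * cabs (expi (y - y') - 1) ^+ 2.
  have sx : 0 <= B' * cabs (expi (x - x') - 1) ^+ 2 by rewrite mulr_ge0// sqr_ge0.
  have sy : 0 <= B' * cabs (expi (y - y') - 1) ^+ 2 by rewrite mulr_ge0// sqr_ge0.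
  have far (z : R) : k <= z -> 2 * B <= B' * z.
    by move=> kz; rewrite /B' mulrAC ler_pdivlMr// ler_wpM2l// mulr_ge0.
  have tr : cabs (phi x' y' - phi x y) <= 2 * B.
    by apply: (le_trans (cabsB _ _)); have := phiB x y; have := phiB x' y'; lra.
  case: (ltP (cabs (expi (x - x') - 1) ^+ 2) k) => hx; last by have := far _ hx; lra.
  case: (ltP (cabs (expi (y - y') - 1) ^+ 2) k) => hy; last by have := far _ hy; lra.
  by rewrite cabsC; have := Hk x y x' y' hx hy; lra.
pose Q := (Num.bound (16 * B' / e)).+1.
have Q0 : (0 < Q)%N by [].
have Q0' : 0 < Q%:R :> R by rewrite ltr0n.
have QE : 4 * B' / Q%:R <= e / 4.
  rewrite ler_pdivrMr// mulrC.
  have h : 16 * B' / e < Q%:R.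
    apply: (lt_le_trans (archi_boundP _)); last by rewrite ler_nat /Q.
    by apply: divr_ge0; [apply: mulr_ge0|exact: ltW].
  by move: h; rewrite ltr_pdivrMr//; lra.
pose psi a y := Q%:R^-1 * \sum_(0 <= b < Q) phi (a%:R / Q%:R) (b%:R / Q%:R)
    * (fejer_kernel Q (y - b%:R / Q%:R))%:C.
pose s x y := Q%:R^-1 * \sum_(0 <= a < Q) psi a y * (fejer_kernel Q (x - a%:R / Q%:R))%:C.
exists s => [|x y]; last first.
  rewrite cabsC; apply: (@le_trans _ _ ((e / 2 + 4 * B' / Q%:R) + 4 * B' / Q%:R)); last lra.
  apply: fejer_average => // a aQ.
  rewrite -addrA [4 * B' / Q%:R + _]addrC addrA; by apply: fejer_average.
have Kx a : trig_poly (fun x _ => (fejer_kernel Q (x - a))%:C).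
  have -> : (fun x _ : R => (fejer_kernel Q (x - a))%:C)
    = (fun x y => Q%:R^-1 * \sum_(0 <= j < Q) \sum_(0 <= k < Q)
        expi ((j%:Z - k%:Z)%:~R * (- a)) * expi ((j%:Z - k%:Z)%:~R * x + 0%:~R * y)).
    apply/funext => x; apply/funext => y; rewrite fejer_kernelE; congr (_ * _).
    apply: eq_bigr => j _; apply: eq_bigr => i _; rewrite -expiD; congr expi; ring.
  by apply: trig_poly_scale; do 2 apply: trig_poly_sum => ?; exact: trig_poly_mono.
have Ky a : trig_poly (fun _ y => (fejer_kernel Q (y - a))%:C).
  have -> : (fun _ y : R => (fejer_kernel Q (y - a))%:C)
    = (fun x y => Q%:R^-1 * \sum_(0 <= j < Q) \sum_(0 <= k < Q)
        expi ((j%:Z - k%:Z)%:~R * (- a)) * expi (0%:~R * x + (j%:Z - k%:Z)%:~R * y)).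
    apply/funext => x; apply/funext => y; rewrite fejer_kernelE; congr (_ * _).
    apply: eq_bigr => j _; apply: eq_bigr => i _; rewrite -expiD; congr expi; ring.
  by apply: trig_poly_scale; do 2 apply: trig_poly_sum => ?; exact: trig_poly_mono.
apply: trig_poly_scale; apply: trig_poly_sum => a; apply: trig_poly_mul => //.
by apply: trig_poly_scale; apply: trig_poly_sum => b; apply: trig_poly_scale.
Qed.

(** Uniform in the starting point [n0]: the contraction argument works with windows placed anywhere
    and needs the equidistribution of the rotation in this form. *)
Definition uniform_null (F : nat -> R[i]) := forall e : R, 0 < e ->
  exists N0, forall N, (N0 <= N)%N -> forall n0,
  cabs (\sum_(0 <= i < N) F (n0 + i)%N) <= e * N%:R.

Lemma uniform_null_mean F : uniform_null F -> mean_null F.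
Proof.
move=> H e e0; have [N0 HN] := H e e0; exists N0 => N hN.
rewrite big_add1/=; apply: le_trans (HN N hN 1%N).
by under eq_bigr do rewrite -add1n.
Qed.

Lemma uniform_nullD F G : uniform_null F -> uniform_null G -> uniform_null (fun n => F n + G n).
Proof.
move=> hF hG e e0; have e2 : 0 < e / 2 by lra.
have [N1 H1] := hF _ e2; have [N2 H2] := hG _ e2.
exists (maxn N1 N2) => N; rewrite geq_max => /andP[h1 h2] n0.
rewrite big_split/=; apply: (le_trans (cabsD _ _)).
by have := H1 _ h1 n0; have := H2 _ h2 n0; lra.
Qed.

Lemma uniform_null_approx F : (forall e : R, 0 < e -> exists2 G, uniform_null G &
   forall n, cabs (F n - G n) <= e) -> uniform_null F.
Proof.
move=> H e e0; have e2 : 0 < e / 2 by lra.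
have [G hG FG] := H _ e2; have [N0 HN] := hG _ e2.
exists N0 => N hN n0.
have -> : \sum_(0 <= i < N) F (n0 + i)%N = \sum_(0 <= i < N) (F (n0 + i)%N - G (n0 + i)%N)
   + \sum_(0 <= i < N) G (n0 + i)%N by rewrite sumrB subrK.
apply: (le_trans (cabsD _ _)); have := HN _ hN n0.
suff : cabs (\sum_(0 <= i < N) (F (n0 + i)%N - G (n0 + i)%N)) <= e / 2 * N%:R by lra.
apply: (le_trans (cabs_sum _ _ _)).
apply: (@le_trans _ _ (\sum_(0 <= i < N) e / 2)); first by apply: ler_sum.
by rewrite sumr_const_nat subn0 mulr_natr.
Qed.

Lemma uniform_null_expi (c : R[i]) (t : R) : expi t != 1 ->
  uniform_null (fun n => c * expi (n%:R * t)).
Proof.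
move=> t1 e e0.
have d0 : 0 < cabs (expi t - 1).
  rewrite lt_def cabs_ge0 andbT; apply: contra t1 => /eqP /cabs_eq0 /eqP.
  by rewrite subr_eq0.
set d := cabs _ in d0.
pose K := 2 * cabs c / (d * e).
have K0 : 0 <= K by rewrite divr_ge0 ?mulr_ge0 ?cabs_ge0 ?ltW.
exists (Num.bound K) => N hN n0.
have -> : \sum_(0 <= i < N) c * expi ((n0 + i)%:R * t)
  = c * expi (n0%:R * t) * \sum_(0 <= i < N) expi (i%:R * t).
  by rewrite big_distrr/=; apply: eq_bigr => i _; rewrite natrD mulrDl expiD mulrA.
rewrite !cabsM cabs_expi mulr1.
have g := congr1 (@cabs R) (geometric_expi t N); rewrite cabsM -/d in g.
have g2 : cabs (\sum_(0 <= i < N) expi (i%:R * t)) * d <= 2.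
  by rewrite g; apply: (le_trans (cabsB _ _)); rewrite cabs_expi cabs1; lra.
have KN : K <= N%:R.
  by apply/ltW/(lt_le_trans (archi_boundP K0)); rewrite ler_nat.
have : 2 * cabs c <= N%:R * (d * e) by rewrite -ler_pdivrMr// mulr_gt0.
have := cabs_ge0 c; move: (cabs (\sum_(_ <= _ < _) _)) g2 => S g2 c0 h.
rewrite -(ler_pM2r d0); apply: le_trans (_ : 2 * cabs c <= _); last lra.
by rewrite -mulrA mulrC ler_wpM2r.
Qed.

Section weyl.
Variables (alpha beta : R).
Hypothesis indep : forall m l : int, (m != 0) || (l != 0) ->
  expi (m%:~R * alpha + l%:~R * beta) != 1.

(** Equidistribution without naming the limit: a translation does not change the averages of [phi].
    For a nontrivial character both averages vanish, and for a constant the difference is 0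
    identically. *)
Lemma weyl_shift phi (B : R) (w1 w2 : R) : torus_continuous phi ->
  (forall x y, cabs (phi x y) <= B) ->
  uniform_null (fun n => phi (n%:R * alpha + w1) (n%:R * beta + w2) - phi (n%:R * alpha) (n%:R * beta)).
Proof.
move=> cphi phiB; apply: uniform_null_approx => e e0.
have e2 : 0 < e / 2 by lra.
have [s ts hs] := trig_poly_approx cphi phiB e2.
exists (fun n => s (n%:R * alpha + w1) (n%:R * beta + w2) - s (n%:R * alpha) (n%:R * beta)); last first.
  move=> n; set a := phi _ _; set b := phi _ _; set c := s _ _; set d := s _ _.
  have -> : a - b - (c - d) = (a - c) - (b - d) by ring.
  apply: (le_trans (cabsB _ _)); have := hs (n%:R * alpha + w1) (n%:R * beta + w2).
  by have := hs (n%:R * alpha) (n%:R * beta); rewrite -/a -/b -/c -/d; lra.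
elim: ts => [c m l|f g _ hf _ hg].
  have E n : c * expi (m%:~R * (n%:R * alpha + w1) + l%:~R * (n%:R * beta + w2))
     - c * expi (m%:~R * (n%:R * alpha) + l%:~R * (n%:R * beta))
     = (c * (expi (m%:~R * w1 + l%:~R * w2) - 1)) * expi (n%:R * (m%:~R * alpha + l%:~R * beta)).
    have -> : m%:~R * (n%:R * alpha + w1) + l%:~R * (n%:R * beta + w2)
      = (m%:~R * w1 + l%:~R * w2) + n%:R * (m%:~R * alpha + l%:~R * beta) by ring.
    have -> : m%:~R * (n%:R * alpha) + l%:~R * (n%:R * beta) = n%:R * (m%:~R * alpha + l%:~R * beta) by ring.
    by rewrite expiD; ring.
  under eq_fun do rewrite E.
  case: (boolP ((m != 0) || (l != 0))) => [h|]; first exact: uniform_null_expi (indep h).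
  rewrite negb_or !negbK => /andP[/eqP -> /eqP ->].
  rewrite !mul0r addr0 expi0 subrr mulr0.
  move=> e' e'0; exists 0%N => N _ n0; rewrite big1 ?cabs0 ?mulr_ge0 ?(ltW e'0)// => i _.
  by rewrite mul0r.
have := uniform_nullD hf hg; congr uniform_null; apply/funext => n; ring.
Qed.

End weyl.

End trigonometric.

(** * Sequences orthogonal to the Moebius function *)

Section mobius_null_closure.
Variable R : realType.
Implicit Types F G : nat -> R[i].
Local Notation mu n := ((mobius n)%:~R : R[i]).

Lemma mobius_nullD F G : mobius_null F -> mobius_null G -> mobius_null (fun n => F n + G n).
Proof.
move=> hF hG e e0; have e2 : 0 < e / 2 by lra.
have [N1 H1] := hF _ e2; have [N2 H2] := hG _ e2.
exists (maxn N1 N2) => N; rewrite geq_max => /andP[h1 h2].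
under eq_bigr do rewrite mulrDl.
rewrite big_split/=; apply: (le_trans (cabsD _ _)).
by have := H1 _ h1; have := H2 _ h2; lra.
Qed.

Lemma mobius_null0 : mobius_null (fun=> 0 : R[i]).
Proof.
move=> e e0; exists 0%N => N _; rewrite big1 ?cabs0 ?mulr_ge0 ?(ltW e0)// => i _.
by rewrite mul0r.
Qed.

Lemma mobius_null_scale c F : mobius_null F -> mobius_null (fun n => c * F n).
Proof.
move=> hF e e0; have c1 : 0 < cabs c + 1 by have := cabs_ge0 c; lra.
have e1 : 0 < e / (cabs c + 1) by rewrite divr_gt0.
have [N0 H] := hF _ e1; exists N0 => N hN.
under eq_bigr do rewrite -mulrA.
rewrite -big_distrr/= cabsM; have := H _ hN.
have := cabs_ge0 c; have := cabs_ge0 (\sum_(1 <= n < N.+1) F n * mu n).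
move: (cabs (\sum_(_ <= _ < _) _)) (cabs c) c1 {e1 H} => S d c1 S0 d0.
rewrite mulrAC ler_pdivlMr//; nra.
Qed.

Lemma mobius_null_sum (I : Type) (r : seq I) (F : I -> nat -> R[i]) :
  (forall i, mobius_null (F i)) -> mobius_null (fun n => \sum_(i <- r) F i n).
Proof.
move=> H; elim: r => [|a r IH].
  by under eq_fun do rewrite big_nil; exact: mobius_null0.
by under eq_fun do rewrite big_cons; exact: mobius_nullD.
Qed.

Lemma mobius_null_approx F : (forall e : R, 0 < e -> exists2 G, mobius_null G &
   forall n, cabs (F n - G n) <= e) -> mobius_null F.
Proof.
move=> H e e0; have e2 : 0 < e / 2 by lra.
have [G hG FG] := H _ e2; have [N0 HN] := hG _ e2.
exists N0 => N hN.
have -> : \sum_(1 <= i < N.+1) F i * mu i = \sum_(1 <= i < N.+1) (F i - G i) * mu i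
   + \sum_(1 <= i < N.+1) G i * mu i by rewrite -big_split/=; apply: eq_bigr => i _; ring.
apply: (le_trans (cabsD _ _)); have := HN _ hN.
suff : cabs (\sum_(1 <= i < N.+1) (F i - G i) * mu i) <= e / 2 * N%:R by lra.
apply: (le_trans (cabs_sum _ _ _)).
apply: (@le_trans _ _ (\sum_(1 <= i < N.+1) e / 2)).
  apply: ler_sum => i _; rewrite cabsM -[leRHS]mulr1.
  by apply: ler_pM; rewrite ?cabs_ge0 ?FG ?cabs_mu.
by rewrite sumr_const_nat subn1 mulr_natr.
Qed.

Lemma mobius_null_cst (c : R[i]) : mobius_null (fun=> c).
Proof.
have -> : (fun=> c) = (fun n : nat => c * 1) by apply/funext => n; rewrite mulr1.
apply: mobius_null_scale => e e0; have [N0 H] := mertens_fun_small e0.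
exists N0 => N hN; under eq_bigr do rewrite mul1r.
have -> : \sum_(1 <= i < N.+1) mu i = real_complex R (mertens_fun R N).
  by rewrite /mertens_fun rmorph_sum; apply: eq_bigr => i _; rewrite /= rmorph_int.
by rewrite cabs_real; exact: H.
Qed.

Lemma katai_bounded F (B : R) : (forall n, cabs (F n) <= B) ->
  (forall p q, prime p -> prime q -> p != q -> mean_null (fun n => F (p * n)%N * conjc (F (q * n)%N))) ->
  mobius_null F.
Proof.
move=> FB corr; have B0 : 0 <= B by apply: le_trans (FB 0%N); exact: cabs_ge0.
have B1 : 0 < B + 1 by lra.
pose b := real_complex R (B + 1).
have b0 : b != 0 by apply/eqP => /complexI /eqP; rewrite gt_eqF.
have -> : F = (fun n => b * (b^-1 * F n)) by apply/funext => n; rewrite mulVKf.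
apply: mobius_null_scale; apply: katai => [n|p q pp pq pqN].
  rewrite cabsM cabsV cabs_real ger0_norm ?(ltW B1)// mulrC ler_pdivrMr// mul1r.
  by have := FB n; lra.
move=> e e0; have e1 : 0 < e * (B + 1) ^+ 2 by rewrite mulr_gt0 ?exprn_gt0.
have [N0 H] := corr p q pp pq pqN _ e1; exists N0 => N hN.
have E : conjc b^-1 = b^-1 by rewrite /b -fmorphV conjc_real.
under eq_bigr do rewrite [conjc _]rmorphM /= E mulrACA.
rewrite -big_distrr/= !cabsM cabsV cabs_real ger0_norm ?(ltW B1)//.
rewrite -invfM mulrC ler_pdivrMr ?mulr_gt0//; apply: (le_trans (H _ hN)).
by rewrite expr2 le_eqVlt; apply/orP; left; apply/eqP; ring.
Qed.

Section torus.
Variables (alpha beta : R).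
Hypothesis indep : forall m l : int, (m != 0) || (l != 0) ->
  expi (m%:~R * alpha + l%:~R * beta) != 1.

Lemma mobius_null_expi (m l : int) (c : R[i]) :
  mobius_null (fun n => c * expi (n%:R * (m%:~R * alpha + l%:~R * beta))).
Proof.
apply: mobius_null_scale.
case: (boolP ((m != 0) || (l != 0))) => [h|]; last first.
  rewrite negb_or !negbK => /andP[/eqP -> /eqP ->].
  rewrite !mul0r addr0; under eq_fun do rewrite mulr0 expi0.
  exact: mobius_null_cst.
apply: katai => [n|p q pp pq pqN]; first by rewrite cabs_expi.
apply: uniform_null_mean.
have -> : (fun n => expi ((p * n)%:R * (m%:~R * alpha + l%:~R * beta))
   * conjc (expi ((q * n)%:R * (m%:~R * alpha + l%:~R * beta))))
  = (fun n => 1 * expi (n%:R * ((m * (p%:Z - q%:Z))%:~R * alpha + (l * (p%:Z - q%:Z))%:~R * beta))).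
  apply/funext => n; rewrite mul1r -expiNr -expiD; congr expi.
  by rewrite !natrM !intrM !intrD !mulrNz; ring.
apply: uniform_null_expi; apply: indep.
have pq0 : p%:Z - q%:Z != 0 by rewrite subr_eq0; apply: contra pqN; rewrite eqz_nat.
by rewrite !mulf_eq0 (negPf pq0) !orbF.
Qed.

Lemma mobius_null_torus phi (B x0 y0 : R) : torus_continuous phi ->
  (forall x y, cabs (phi x y) <= B) ->
  mobius_null (fun n => phi (x0 + n%:R * alpha) (y0 + n%:R * beta)).
Proof.
move=> cphi phiB; apply: mobius_null_approx => e e0.
have [s ts hs] := trig_poly_approx cphi phiB e0.
exists (fun n => s (x0 + n%:R * alpha) (y0 + n%:R * beta)); last by move=> n; exact: hs.
elim: ts => [c m l|f g _ hf _ hg]; last exact: mobius_nullD.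
have -> : (fun n => c * expi (m%:~R * (x0 + n%:R * alpha) + l%:~R * (y0 + n%:R * beta)))
  = (fun n => (c * expi (m%:~R * x0 + l%:~R * y0)) * expi (n%:R * (m%:~R * alpha + l%:~R * beta))).
  apply/funext => n; rewrite -mulrA -expiD; congr (_ * expi _); ring.
exact: mobius_null_expi.
Qed.

End torus.

End mobius_null_closure.

(** * Contraction along almost periods *)

Section contraction.
Variable R : realType.
Implicit Types a F : nat -> R[i].

Lemma window_shift F (B : R) (k N n0 : nat) : (forall n, cabs (F n) <= B) ->
  cabs (\sum_(0 <= i < N) F (n0 + k + i)%N - \sum_(0 <= i < N) F (n0 + i)%N) <= 2 * B * k%:R.
Proof.
move=> FB; elim: k => [|k IH]; first by rewrite addn0 subrr cabs0 mulr0.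
have E : \sum_(0 <= i < N) F (n0 + k.+1 + i)%N - \sum_(0 <= i < N) F (n0 + k + i)%N
   = F (n0 + k + N)%N - F (n0 + k)%N.
  rewrite -sumrB; under eq_bigr do rewrite addnS addSnnS.
  by rewrite (telescope_sumr (fun i => F (n0 + k + i)%N))// addn0.
rewrite -(subrKA (\sum_(0 <= i < N) F (n0 + k + i)%N)).
apply: (le_trans (cabsD _ _)); rewrite E -(natr1 k) mulrDr mulr1.
have := cabsB (F (n0 + k + N)%N) (F (n0 + k)%N).
have := FB (n0 + k + N)%N; have := FB (n0 + k)%N; lra.
Qed.

(** From [|1 + g| ^ 2 + |1 - g| ^ 2 = 4] and [x <= 1 + x ^ 2 / 4]. *)
Lemma cabs_parallelogram (g : R[i]) : cabs g = 1 -> cabs (1 + g) <= 2 - cabs (1 - g) ^+ 2 / 4.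
Proof.
move=> g1; have E : cabs (1 + g) ^+ 2 + cabs (1 - g) ^+ 2 = 4.
  have : cabs g ^+ 2 = 1 by rewrite g1 expr1n.
  case: g {g1} => u v; rewrite /cabs !sqr_sqrtr ?addr_ge0 ?sqr_ge0//=; lra.
have x0 := cabs_ge0 (1 + g); move: E; move: (cabs (1 + g)) x0 => x x0 E.
have := sqr_ge0 (x / 2 - 1); lra.
Qed.

(** A single window length is asked for: longer windows are cut into windows of that length, with a
    negligible remainder. The infimum of such [s] thus governs all long averages. *)
Definition window_bound a (s : R) := exists2 N, (0 < N)%N &
  forall n0, cabs (\sum_(0 <= i < N) a (n0 + i)%N) <= s * N%:R.

Lemma window_bound_all a (B s e : R) : (forall n, cabs (a n) <= B) -> 0 <= s ->
  window_bound a s -> 0 < e ->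
  exists N0, forall N, (N0 <= N)%N -> forall n0,
  cabs (\sum_(0 <= i < N) a (n0 + i)%N) <= (s + e) * N%:R.
Proof.
move=> aB s0 [M M0 HM] e0; have B0 : 0 <= B by apply: le_trans (aB 0%N); exact: cabs_ge0.
have K0 : 0 <= M%:R * B / e by rewrite divr_ge0 ?mulr_ge0// ltW.
exists (Num.bound (M%:R * B / e)) => N hN n0.
have blocks k n : cabs (\sum_(0 <= i < k * M) a (n + i)%N) <= s * (k * M)%:R.
  elim: k n => [|k IH] n; first by rewrite mul0n big_geq// cabs0 mulr0.
  rewrite mulSn (big_cat_nat (n := M))//= ?leq_addr//.
  have -> : \sum_(M <= i < M + k * M) a (n + i)%N = \sum_(0 <= i < k * M) a (n + M + i)%N.
    rewrite -{1}[M]add0n big_addn addKn.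
    by apply: eq_bigr => i _; rewrite -addnA [(i + M)%N]addnC.
  apply: (le_trans (cabsD _ _)); rewrite natrD mulrDr; apply: lerD; [exact: HM|exact: IH].
have KN : M%:R * B <= e * N%:R.
  rewrite mulrC [e * _]mulrC -ler_pdivrMr// [B * _]mulrC.
  by apply/ltW/(lt_le_trans (archi_boundP K0)); rewrite ler_nat.
have dM := leq_trunc_div N M.
rewrite (big_cat_nat (n := (N %/ M * M)%N))//=.
apply: (le_trans (cabsD _ _)); rewrite mulrDl; apply: lerD.
  by apply: (le_trans (blocks _ _)); rewrite ler_wpM2l// ler_nat.
apply: le_trans KN; apply: (le_trans (cabs_sum _ _ _)).
apply: (@le_trans _ _ (\sum_(N %/ M * M <= i < N) B)); first by apply: ler_sum.
rewrite sumr_const_nat -[_ *+ _]mulr_natl ler_wpM2r// ler_nat.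
have := ltn_mod N M; rewrite M0 => h; have := divn_eq N M; lia.
Qed.

(** [a] repeats after [t] up to a slowly varying unimodular factor [g]. The constant [c] is fixed
    before [e]: even if [t] grows as [e] shrinks, [g] must stay away from 1 by the same amount on
    average. *)
Definition almost_period a (c : R) := forall e : R, 0 < e -> exists t (g : nat -> R[i]),
  [/\ forall n, cabs (a (n + t)%N - g n * a n) <= e,
      forall n, cabs (g n) = 1,
      forall n, cabs (g n.+1 - g n) <= e &
      exists N1, forall N, (N1 <= N)%N -> forall n0,
        c * N%:R <= \sum_(0 <= i < N) cabs (1 - g (n0 + i)%N) ^+ 2].

(* A window sum [F] of [a] inherits [F (n + t) ~ g n * F n], and averaging
   [F n + F (n + t)] gains the mean of [|1 + g| / 2 <= 1 - |1 - g| ^+ 2 / 8]. *)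
Lemma window_contract a (B c s : R) : (forall n, cabs (a n) <= B) -> 0 < c ->
  almost_period a c -> 0 < s -> window_bound a s -> window_bound a (s * (1 - c / 16)).
Proof.
move=> aB c0 ap s0 [M M0 HM]; have B0 : 0 <= B by apply: le_trans (aB 0%N); exact: cabs_ge0.
have M0' : 0 < M%:R :> R by rewrite ltr0n.
pose F n := \sum_(0 <= i < M) a (n + i)%N.
have FB n : cabs (F n) <= s * M%:R by exact: HM.
have d0 : 0 < M%:R * (1 + M%:R * B) by rewrite mulr_gt0// ltr_wpDr// mulr_ge0// ltW.
(* Each of the [M] terms of a window sum is off by [e], and by a drift of [g] of at most [e * M]
   times [B]; this [e] keeps the total at [s * M * c / 32]. *)
pose e := s * M%:R * c / 32 / (M%:R * (1 + M%:R * B)).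
have e0 : 0 < e by rewrite /e !divr_gt0// !mulr_gt0.
have eE : e * (M%:R * (1 + M%:R * B)) = s * M%:R * c / 32 by rewrite /e divfK// gt_eqF.
have [t [g [g1 g2 g3 [N1 g4]]]] := ap e e0.
have gk n k : cabs (g (n + k)%N - g n) <= e * k%:R.
  elim: k => [|k IH]; first by rewrite addn0 subrr cabs0 mulr0.
  rewrite addnS -(subrKA (g (n + k)%N)); apply: (le_trans (cabsD _ _)).
  by rewrite -(natr1 k); have := g3 (n + k)%N; lra.
have Fg n : cabs (F (n + t)%N - g n * F n) <= s * M%:R * c / 32.
  rewrite /F big_distrr -sumrB/=; apply: (le_trans (cabs_sum _ _ _)).
  rewrite -eE; have -> : e * (M%:R * (1 + M%:R * B)) = \sum_(0 <= i < M) (e * (1 + M%:R * B)).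
    by rewrite sumr_const_nat subn0 -[_ *+ M]mulr_natl; ring.
  apply: ler_sum_nat => i /andP[_ iM].
  have -> : a (n + t + i)%N - g n * a (n + i)%N
    = (a (n + i + t)%N - g (n + i)%N * a (n + i)%N) + (g (n + i)%N - g n) * a (n + i)%N.
    by rewrite addnAC; ring.
  apply: (le_trans (cabsD _ _)); rewrite mulrDr mulr1; apply: lerD; first exact: g1.
  rewrite cabsM mulrA; apply: ler_pM; rewrite ?cabs_ge0 ?aB//.
  by apply: (le_trans (gk _ _)); rewrite ler_wpM2l ?ler_nat ?(ltW e0)// ltnW.
have sc : 0 < s * c by rewrite mulr_gt0.
(* Relative to [s * N], the gain is [c / 8]. The inexact almost period costs [c / 64] and, for
   [N >= K], the ends of the shifted windows cost [c / 32]; more than [c / 16] is left. *)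
pose K := 32 * (t%:R * s * M%:R + 2 * M%:R ^+ 2 * B) / (s * c * M%:R).
have K0 : 0 <= K.
  by rewrite /K divr_ge0 ?mulr_ge0 ?addr_ge0 ?mulr_ge0 ?exprn_ge0 ?(ltW s0) ?(ltW c0) ?(ltW M0').
pose N := (maxn N1 (Num.bound K)).+1; exists N => // n0.
have N0' : 0 < N%:R :> R by rewrite ltr0n.
have KN : 32 * (t%:R * s * M%:R + 2 * M%:R ^+ 2 * B) <= N%:R * (s * c * M%:R).
  rewrite -ler_pdivrMr ?mulr_gt0// -/K; apply/ltW/(lt_le_trans (archi_boundP K0)).
  by rewrite ler_nat /N leqW// leq_maxr.
pose S := \sum_(0 <= n < N) a (n0 + n)%N; rewrite -/S.
pose T := \sum_(0 <= n < N) F (n0 + n)%N.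
have b1 : cabs (T - M%:R * S) <= 2 * M%:R ^+ 2 * B.
  have -> : T - M%:R * S = \sum_(0 <= i < M) (\sum_(0 <= n < N) a (n0 + i + n)%N - S).
    rewrite sumrB sumr_const_nat subn0 -[S *+ M]mulr_natl /T /F exchange_big/=; congr (_ - _).
    by apply: eq_bigr => i _; apply: eq_bigr => n _; rewrite addnAC.
  apply: (le_trans (cabs_sum _ _ _)).
  have -> : 2 * M%:R ^+ 2 * B = \sum_(0 <= i < M) (2 * B * M%:R).
    by rewrite sumr_const_nat subn0 -[_ *+ M]mulr_natl; ring.
  apply: ler_sum_nat => i /andP[_ iM]; apply: (le_trans (window_shift _ _ _ aB)).
  by rewrite ler_wpM2l ?mulr_ge0// ler_nat ltnW.
pose T' := \sum_(0 <= n < N) F (n0 + t + n)%N.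
have b2 : cabs (T' - T) <= 2 * (s * M%:R) * t%:R by exact: window_shift.
have b3 : cabs (T + T') <= s * M%:R * (2 * N%:R - c * N%:R / 4) + s * M%:R * c / 32 * N%:R.
  have -> : T + T' = \sum_(0 <= n < N) (1 + g (n0 + n)%N) * F (n0 + n)%N
     + \sum_(0 <= n < N) (F (n0 + n + t)%N - g (n0 + n)%N * F (n0 + n)%N).
    rewrite /T /T' -!big_split/=; apply: eq_bigr => n _; rewrite [(n0 + t + n)%N]addnAC; ring.
  apply: (le_trans (cabsD _ _)); apply: lerD; last first.
    apply: (le_trans (cabs_sum _ _ _)).
    apply: (@le_trans _ _ (\sum_(0 <= n < N) (s * M%:R * c / 32))); first by apply: ler_sum.
    by rewrite sumr_const_nat subn0 -[_ *+ N]mulr_natr.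
  apply: (le_trans (cabs_sum _ _ _)).
  apply: (@le_trans _ _ (\sum_(0 <= n < N) s * M%:R * (2 - cabs (1 - g (n0 + n)%N) ^+ 2 / 4))).
    apply: ler_sum => n _; rewrite cabsM mulrC; apply: ler_pM; rewrite ?cabs_ge0//.
    exact: cabs_parallelogram.
  rewrite -big_distrr/= ler_wpM2l// ?mulr_ge0// ?(ltW s0)//.
  rewrite sumrB -big_distrl/= sumr_const_nat subn0 -[_ *+ N]mulr_natr.
  have : c * N%:R <= \sum_(0 <= i < N) cabs (1 - g (n0 + i)%N) ^+ 2.
    by apply: g4; rewrite /N leqW// leq_maxl.
  by lra.
have MS : M%:R * cabs S = cabs (M%:R * S) by rewrite cabsM cabs_nat.
have b4 : 2 * (M%:R * cabs S) <= cabs (T + T') + cabs (T' - T) + 2 * cabs (T - M%:R * S).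
  have -> : 2 * (M%:R * cabs S) = cabs (2 * (M%:R * S)).
    by rewrite cabsM (cabs_nat R 2) MS.
  have -> : 2 * (M%:R * S) = (T + T') - (T' - T) - 2 * (T - M%:R * S) by ring.
  apply: (le_trans (cabsB _ _)); rewrite [cabs (2 * _)]cabsM (cabs_nat R 2).
  by rewrite lerD2r; exact: cabsB.
rewrite -(ler_pM2l M0').
have : 0 <= s * M%:R * c * N%:R by rewrite !mulr_ge0// ltW.
move: b1 b2 b3 b4 KN; move: (cabs (T + T')) (cabs (T' - T)) (cabs (T - M%:R * S)) (cabs S) => u1 u2 u3 u4.
lra.
Qed.

(** Were the infimum [b] of the window bounds positive, one within [b * c / 32] of it would contract
    below it, since the gain is at least [b * c / 16]. *)
Theorem almost_period_null a (B c : R) : (forall n, cabs (a n) <= B) -> 0 < c ->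
  almost_period a c -> uniform_null a.
Proof.
move=> aB c0 ap; have B0 : 0 <= B by apply: le_trans (aB 0%N); exact: cabs_ge0.
pose W := [set s : R | 0 <= s /\ window_bound a s].
have WB : W B.
  split=> //; exists 1%N => // n; rewrite big_nat1 mulr1; exact: aB.
have hi : has_inf W by split; [exists B|exists 0 => x []].
set b := inf W.
have b0 : 0 <= b by apply: lb_le_inf; [exists B|move=> x []].
suff bz : b = 0.
  move=> e e0; have e2 : 0 < e / 2 by lra.
  have [s [s0 ws] se] := inf_adherent e2 hi; rewrite -/b bz add0r in se.
  have [N0 HN] := window_bound_all aB s0 ws e2; exists N0 => N hN n0.
  by apply: (le_trans (HN _ hN _)); rewrite ler_wpM2r//; lra.
apply/eqP; case: (boolP (b == 0)) => // bz.
have bp : 0 < b by rewrite lt_def bz.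
have e0 : 0 < b * c / 32 by rewrite divr_gt0// mulr_gt0.
have [s [s0 ws] se] := inf_adherent e0 hi; rewrite -/b in se.
have bs : b <= s by apply: ge_inf => //; exact: hi.2.
have s1 : 0 < s by lra.
have w2 := window_contract aB c0 ap s1 ws.
exfalso; have : b <= Num.max (s * (1 - c / 16)) 0.
  apply: ge_inf; first exact: hi.2.
  split; first by rewrite le_max lexx orbT.
  case: w2 => N N0 h; exists N => // n0; apply: (le_trans (h n0)).
  by rewrite ler_wpM2r// le_max lexx.
rewrite le_max => /orP[h|]; last by lra.
have : s * c >= b * c by rewrite ler_wpM2r// ltW.
nra.
Qed.

End contraction.

(** * Maps to the circle through real representatives *)

Section near_integers.
Variable R : realType.
Implicit Types (s t d x y : R) (f g : R -> R -> R).

Definition nearZ d t := exists k : int, `|t - k%:~R| <= d.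

Lemma nearZ_int (k : int) : nearZ 0 k%:~R.
Proof. by exists k; rewrite subrr normr0. Qed.

Lemma nearZ_norm t : nearZ `|t| t.
Proof. by exists 0; rewrite subr0. Qed.

Lemma nearZW d d' t : d <= d' -> nearZ d t -> nearZ d' t.
Proof. by move=> dd [k hk]; exists k; apply: le_trans dd. Qed.

Lemma nearZD d d' s t : nearZ d s -> nearZ d' t -> nearZ (d + d') (s + t).
Proof.
move=> [k hk] [l hl]; exists (k + l).
have -> : s + t - (k + l)%:~R = (s - k%:~R) + (t - l%:~R) by rewrite intrD; ring.
by apply: (le_trans (ler_normD _ _)); apply: lerD.
Qed.

Lemma nearZN d t : nearZ d t -> nearZ d (- t).
Proof. by move=> [k hk]; exists (- k); rewrite mulrNz -opprD normrN. Qed.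

Lemma nearZB d d' s t : nearZ d s -> nearZ d' t -> nearZ (d + d') (s - t).
Proof. by move=> hs /nearZN; exact: nearZD. Qed.

Lemma nearZ_mulint d t (m : int) : nearZ d t -> nearZ (`|m%:~R| * d) (m%:~R * t).
Proof.
move=> [k hk]; exists (m * k); rewrite intrM -mulrBr normrM ler_wpM2l//.
Qed.

Lemma nearZ_sum (n : nat) (F D : nat -> R) : (forall i, nearZ (D i) (F i)) ->
  nearZ (\sum_(0 <= i < n) D i) (\sum_(0 <= i < n) F i).
Proof.
move=> H; elim: n => [|n IH]; first by rewrite !big_geq//; exact: (nearZ_int 0).
by rewrite !big_nat_recr//=; exact: nearZD.
Qed.

Lemma nearZ_expi d s t : nearZ d (s - t) -> cabs (expi s - expi t) <= 4 * pi * d.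
Proof.
move=> [k hk]; apply: (le_trans (expi_lip s t k)).
by rewrite ler_wpM2l// mulr_ge0// pi_ge0.
Qed.

Lemma nearZ0_expi s t : nearZ 0 (s - t) -> expi s = expi t.
Proof.
move=> /nearZ_expi; rewrite mulr0 => h; apply/eqP; rewrite -subr_eq0; apply/eqP.
by apply: cabs_eq0; apply/eqP; rewrite eq_le h cabs_ge0.
Qed.

(* The representative of [t] modulo 1 in [-1/2, 1/2). *)
Definition cfrac t := t - (Num.floor (t + 1 / 2))%:~R.

Lemma cfrac_int t : exists k : int, t - cfrac t = k%:~R.
Proof. by exists (Num.floor (t + 1 / 2)); rewrite /cfrac; ring. Qed.

Lemma cfracE s t : nearZ 0 (t - s) -> `|s| < 1 / 2 -> cfrac t = s.
Proof.
move=> [k]; rewrite normr_le0 subr_eq0 => /eqP tk; rewrite ltr_norml => /andP[h1 h2].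
rewrite /cfrac; have -> : Num.floor (t + 1 / 2) = k.
  by apply: floor_def; rewrite intrD; apply/andP; split; lra.
lra.
Qed.

Lemma cfrac_le d t : nearZ d t -> d < 1 / 2 -> `|cfrac t| <= d.
Proof.
move=> [k hk] d2; rewrite (@cfracE (t - k%:~R))//; last by apply: le_lt_trans d2.
have -> : t - (t - k%:~R) = k%:~R by ring.
exact: nearZ_int.
Qed.

Lemma nearZ_cfrac t : nearZ 0 (t - cfrac t).
Proof. by have [k ->] := cfrac_int t; exact: nearZ_int. Qed.

(** A Lipschitz map from the torus to the circle, given by real representatives. Both conditions
    hold only modulo 1, as [f] itself may jump by integers. *)
Definition circle_map (L : R) f :=
  (forall x y x' y', nearZ (L * (`|x - x'| + `|y - y'|)) (f x y - f x' y')) /\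
  (forall x y (a b : int), nearZ 0 (f (x + a%:~R) (y + b%:~R) - f x y)).

Lemma circle_mapD L L' f g : circle_map L f -> circle_map L' g ->
  circle_map (L + L') (fun x y => f x y + g x y).
Proof.
move=> [hf pf] [hg pg]; split=> [x y x' y'|x y a b].
  have -> : f x y + g x y - (f x' y' + g x' y') = (f x y - f x' y') + (g x y - g x' y') by ring.
  by rewrite mulrDl; exact: nearZD.
have -> : f (x + a%:~R) (y + b%:~R) + g (x + a%:~R) (y + b%:~R) - (f x y + g x y)
  = (f (x + a%:~R) (y + b%:~R) - f x y) + (g (x + a%:~R) (y + b%:~R) - g x y) by ring.
by rewrite -[0]addr0; exact: nearZD.
Qed.

Lemma circle_map_mulint L f (m : int) : circle_map L f ->
  circle_map (`|m%:~R| * L) (fun x y => m%:~R * f x y).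
Proof.
move=> [hf pf]; split=> [x y x' y'|x y a b]; rewrite -mulrBr.
  by rewrite -mulrA; exact: nearZ_mulint.
by rewrite -[0](mulr0 `|m%:~R|); exact: nearZ_mulint.
Qed.

Lemma circle_map_cst c : circle_map 0 (fun _ _ => c).
Proof.
split=> *; rewrite subrr ?mul0r; exact: (nearZ_int 0).
Qed.

Lemma circle_map_sum (n : nat) L (F : nat -> R -> R -> R) :
  (forall i, circle_map L (F i)) ->
  circle_map (n%:R * L) (fun x y => \sum_(0 <= i < n) F i x y).
Proof.
move=> H; elim: n => [|n IH].
  rewrite mul0r; have -> : (fun x y => \sum_(0 <= i < 0) F i x y) = (fun _ _ => 0).
    by apply/funext => x; apply/funext => y; rewrite big_geq.
  exact: circle_map_cst.
have -> : (fun x y => \sum_(0 <= i < n.+1) F i x y) = (fun x y => \sum_(0 <= i < n) F i x y + F n x y).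
  by apply/funext => x; apply/funext => y; rewrite big_nat_recr.
by rewrite -natr1 mulrDl mul1r; exact: circle_mapD.
Qed.

Lemma circle_map_affine L f (p : nat) (u v : R) : circle_map L f ->
  circle_map (p%:R * L) (fun x y => f (p%:R * x + u) (p%:R * y + v)).
Proof.
move=> [hf pf]; split=> [x y x' y'|x y a b].
  have := hf (p%:R * x + u) (p%:R * y + v) (p%:R * x' + u) (p%:R * y' + v).
  have E s t w : p%:R * s + w - (p%:R * t + w) = p%:R * (s - t) by ring.
  by rewrite !E !normrM [`|p%:R|]ger0_norm// -mulrDr mulrCA mulrA.
have := pf (p%:R * x + u) (p%:R * y + v) (p%:Z * a) (p%:Z * b).
rewrite !intrM -!pmulrn; congr (nearZ _ (f _ _ - _)); ring.
Qed.

Lemma circle_map_linear (a b : int) :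
  circle_map (`|a%:~R| + `|b%:~R|) (fun x y => a%:~R * x + b%:~R * y).
Proof.
split=> [x y x' y'|x y k l]; last first.
  exists (a * k + b * l); rewrite intrD !intrM.
  have -> : a%:~R * (x + k%:~R) + b%:~R * (y + l%:~R) - (a%:~R * x + b%:~R * y) - (a%:~R * k%:~R + b%:~R * l%:~R) = 0 :> R by ring.
  by rewrite normr0.
apply: nearZW (nearZ_norm _).
have -> : a%:~R * x + b%:~R * y - (a%:~R * x' + b%:~R * y') = a%:~R * (x - x') + b%:~R * (y - y') by ring.
apply: (le_trans (ler_normD _ _)); rewrite !normrM.
have := normr_ge0 (a%:~R : R); have := normr_ge0 (b%:~R : R).
have := normr_ge0 (x - x'); have := normr_ge0 (y - y').
move: `|x - x'| `|y - y'| `|a%:~R| `|b%:~R| => X Y A B Y0 X0 B0 A0.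
have := mulr_ge0 A0 Y0; have := mulr_ge0 B0 X0; lra.
Qed.

Lemma circle_map_continuous L f : 0 <= L -> circle_map L f ->
  torus_continuous (fun x y => expi (f x y)).
Proof.
move=> L0 [hf pf] e e0; have p0 := pi_gt0 R.
have c0 : 0 < 8 * pi * (L + 1) by rewrite !mulr_gt0//; lra.
have d0 : 0 < e / (8 * pi * (L + 1)) by rewrite divr_gt0.
have [k k0 Hk] := expi_near_int d0; exists k => // x y x' y' /Hk[m hm] /Hk[l hl].
have N1 := hf (x - m%:~R) (y - l%:~R) x' y'.
have N2 := pf (x - m%:~R) (y - l%:~R) m l; rewrite !subrK in N2.
have N := nearZD N2 N1; rewrite add0r in N.
have E : f x y - f (x - m%:~R) (y - l%:~R) + (f (x - m%:~R) (y - l%:~R) - f x' y')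
   = f x y - f x' y' by ring.
rewrite E in N; apply: (le_trans (nearZ_expi N)).
have -> : x - m%:~R - x' = x - x' - m%:~R by ring.
have -> : y - l%:~R - y' = y - y' - l%:~R by ring.
set d := e / _ in hm hl d0 *.
have dE : d * (8 * pi * (L + 1)) = e by rewrite divfK// gt_eqF.
apply: (@le_trans _ _ (4 * pi * (L * (d + d)))).
  by rewrite ler_wpM2l ?mulr_ge0 ?pi_ge0// ler_wpM2l// lerD// ltW.
rewrite -dE; have : 0 <= pi * d by rewrite mulr_ge0// ltW.
lra.
Qed.

End near_integers.

(** * Winding numbers *)

Section winding.
Variable R : realType.
Implicit Types (x y : R) (f : R -> R -> R).
Local Notation "x %:C" := (real_complex _ x) (format "x %:C") : ring_scope.

(** The increment over one step of length [1 / Q] in the first variable, lifted to the reals by its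
    smallest representative. The sum over a full turn is the degree of [f] on that circle once [Q]
    is large compared with the Lipschitz constant. *)
Definition wstep f (Q : nat) x y (j : nat) :=
  cfrac (f (x + j.+1%:R / Q%:R) y - f (x + j%:R / Q%:R) y).

Definition winding f (Q : nat) x y := \sum_(0 <= j < Q) wstep f Q x y j.

Lemma wstep_le L f (Q : nat) x y j : 0 <= L -> circle_map L f -> 4 * L < Q%:R ->
  `|wstep f Q x y j| <= L / Q%:R.
Proof.
move=> L0 [hf _] LQ; have Q0 : 0 < Q%:R :> R by lra.
apply: cfrac_le; last by rewrite ltr_pdivrMr//; lra.
have := hf (x + j.+1%:R / Q%:R) y (x + j%:R / Q%:R) y.
rewrite subrr normr0 addr0.
have -> : x + j.+1%:R / Q%:R - (x + j%:R / Q%:R) = Q%:R^-1.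
  by rewrite -(natr1 j); field; rewrite gt_eqF.
by rewrite ger0_norm// invr_ge0 ltW.
Qed.

Lemma winding_int L f (Q : nat) x y : circle_map L f -> (0 < Q)%N ->
  exists K : int, winding f Q x y = K%:~R.
Proof.
move=> [_ pf] Q0; have Q0' : Q%:R != 0 :> R by rewrite pnatr_eq0 -lt0n.
pose g j := f (x + j%:R / Q%:R) y.
have A : nearZ 0 (\sum_(0 <= j < Q) (g j.+1 - g j - wstep f Q x y j)).
  have := @nearZ_sum R Q (fun j => g j.+1 - g j - wstep f Q x y j) (fun=> 0) (fun j => nearZ_cfrac _).
  by rewrite big1.
rewrite sumrB telescope_sumr// in A.
have B : nearZ 0 (g Q - g 0%N).
  have := pf x y 1 0; rewrite !addr0.
  by rewrite /g divff// mul0r addr0.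
have [K hK] := nearZB B A; exists K; apply/eqP; rewrite -subr_eq0 -normr_le0.
move: hK; rewrite addr0; congr (`|_ - _| <= _).
by rewrite /winding; ring.
Qed.

(** [d j] lifts the distance between the two curves. The bounds [1 / 8] leave no room for wrapping
    around, so corresponding steps differ exactly by [d j.+1 - d j], which telescopes to 0 because
    the curves are closed. *)
Lemma winding_shift L f (Q : nat) x y x' y' : 0 <= L -> circle_map L f -> 8 * L < Q%:R ->
  8 * L * (`|x - x'| + `|y - y'|) < 1 ->
  winding f Q x y = winding f Q x' y'.
Proof.
move=> L0 cf LQ Lx; have [hf pf] := cf; have Q0 : 0 < Q%:R :> R by lra.
pose d j := cfrac (f (x + j%:R / Q%:R) y - f (x' + j%:R / Q%:R) y').
have dl j : `|d j| < 1 / 8.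
  have n8 : L * (`|x - x'| + `|y - y'|) < 1 / 8 by lra.
  apply: le_lt_trans n8; apply: cfrac_le; last by lra.
  have := hf (x + j%:R / Q%:R) y (x' + j%:R / Q%:R) y'.
  by have -> : x + j%:R / Q%:R - (x' + j%:R / Q%:R) = x - x' by ring.
have key j : wstep f Q x y j = wstep f Q x' y' j + (d j.+1 - d j).
  have w8 : `|wstep f Q x' y' j| < 1 / 8.
    have h4 : 4 * L < Q%:R by lra.
    apply: (le_lt_trans (wstep_le x' y' j L0 cf h4)).
    by rewrite ltr_pdivrMr//; lra.
  apply: cfracE; last first.
    have := dl j; have := dl j.+1; move: w8; rewrite !ltr_norml; lra.
  have A := nearZ_cfrac (f (x + j%:R / Q%:R) y - f (x' + j%:R / Q%:R) y').
  have B := nearZ_cfrac (f (x + j.+1%:R / Q%:R) y - f (x' + j.+1%:R / Q%:R) y').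
  have C := nearZ_cfrac (f (x' + j.+1%:R / Q%:R) y' - f (x' + j%:R / Q%:R) y').
  have := nearZD C (nearZB B A); rewrite !addr0; congr nearZ.
  by rewrite -/(wstep f Q x' y' j) -/(d j) -/(d j.+1); ring.
rewrite /winding (eq_bigr _ (fun j _ => key j)) big_split/= telescope_sumr//.
suff -> : d Q = d 0%N by rewrite subrr addr0.
rewrite {1}/d; apply: cfracE; last by have := dl 0%N; lra.
have P1 := pf x y 1 0; have P2 := pf x' y' 1 0.
have A := nearZ_cfrac (f (x + 0%:R / Q%:R) y - f (x' + 0%:R / Q%:R) y').
rewrite !addr0 in P1 P2.
have := nearZD (nearZB P1 P2) A; rewrite !addr0 -/(d 0%N) mul0r !addr0 divff ?gt_eqF//.
by congr nearZ; rewrite /d mul0r !addr0; ring.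
Qed.

(** The segment joining the two points is cut into moves short enough for [winding_shift]. *)
Lemma winding_const L f (Q : nat) x y x' y' : 0 <= L -> circle_map L f -> 8 * L < Q%:R ->
  winding f Q x y = winding f Q x' y'.
Proof.
move=> L0 cf LQ.
pose D := 8 * L * (`|x - x'| + `|y - y'|).
have D0 : 0 <= D by rewrite !mulr_ge0// addr_ge0.
pose n := (Num.bound D).+1; have n0 : 0 < n%:R :> R by rewrite ltr0n.
have Dn : D < n%:R by apply: (lt_le_trans (archi_boundP D0)); rewrite ler_nat.
pose X i := x + i%:R / n%:R * (x' - x); pose Y i := y + i%:R / n%:R * (y' - y).
have step i : winding f Q (X i) (Y i) = winding f Q (X i.+1) (Y i.+1).
  apply: (winding_shift L0 cf LQ).
  have -> : X i - X i.+1 = (x - x') / n%:R by rewrite /X -(natr1 i); field; rewrite gt_eqF.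
  have -> : Y i - Y i.+1 = (y - y') / n%:R by rewrite /Y -(natr1 i); field; rewrite gt_eqF.
  rewrite !normrM -mulrDl [`|n%:R^-1|]ger0_norm ?invr_ge0 ?(ltW n0)//.
  by rewrite mulrA -/D ltr_pdivrMr// mul1r.
have all i : winding f Q x y = winding f Q (X i) (Y i).
  by elim: i => [|i ->]; [rewrite /X /Y !mul0r !addr0|exact: step].
by rewrite (all n) /X /Y divff ?gt_eqF// !mul1r !(addrC _ (_ - _)) !subrK.
Qed.

(* If the phases [th j] run along a closed curve in small steps [D j], then
   [\sum 2 pi i D j expi (th j)] is nearly the telescoping sum of
   [expi (th j.+1) - expi (th j)], hence nearly zero. *)
Lemma winding_far (th D : nat -> R) (Q : nat) (eta : R) : 0 <= eta ->
  (forall j, (j < Q)%N -> `|D j| <= eta) ->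
  (forall j, (j < Q)%N -> expi (th j.+1) = expi (th j + D j)) ->
  expi (th Q) = expi (th 0%N) ->
  `|\sum_(0 <= j < Q) D j| <= eta * \sum_(0 <= j < Q) cabs (1 - expi (th j))
     + expi_const R * Q%:R * eta ^+ 2.
Proof.
move=> eta0 De step closed.
pose E := \sum_(0 <= j < Q) (D j)%:C * expi (th j).
have p0 := pi_gt0 R; have p2 := pi_ge2 R.
have EE : (2 * pi)%:C * 'i%C * E = - \sum_(0 <= j < Q)
   (expi (th j + D j) - expi (th j) - (2 * pi * D j)%:C * 'i%C * expi (th j)).
  rewrite sumrB.
  have -> : \sum_(0 <= j < Q) (expi (th j + D j) - expi (th j)) = 0.
    rewrite (eq_big_nat _ _ (F2 := fun j => expi (th j.+1) - expi (th j))).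
      by rewrite telescope_sumr// closed subrr.
    by move=> j /andP[_ jQ]; rewrite step.
  rewrite sub0r opprK /E big_distrr/=; apply: eq_bigr => j _.
  by rewrite !rmorphM/=; ring.
have Eb : cabs E <= expi_const R * Q%:R * eta ^+ 2.
  have c1 : cabs ((2 * pi)%:C * 'i%C * E) = 2 * pi * cabs E.
    rewrite !cabsM cabs_real ger0_norm; last by rewrite mulr_ge0// ltW.
    have -> : cabs ('i%C : R[i]) = 1 by rewrite /cabs /= expr0n add0r expr1n sqrtr1.
    by rewrite mulr1.
  have c2 : 2 * pi * cabs E <= expi_const R * Q%:R * eta ^+ 2.
    rewrite -c1 EE cabsN; apply: (le_trans (cabs_sum _ _ _)).
    have -> : expi_const R * Q%:R * eta ^+ 2 = \sum_(0 <= j < Q) (expi_const R * eta ^+ 2).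
      by rewrite sumr_const_nat subn0 -[_ *+ Q]mulr_natl; ring.
    apply: ler_sum_nat => j /andP[_ jQ]; apply: (le_trans (expi_taylor_at _ _)).
    have k1 := expi_const_ge1 R; rewrite ler_wpM2l//; first lra.
    by rewrite -[D j ^+ 2]real_normK ?num_real// ler_sqr ?nnegrE// De.
  by have := cabs_ge0 E; nra.
have -> : `|\sum_(0 <= j < Q) D j| = cabs (\sum_(0 <= j < Q) (D j)%:C).
  by rewrite -rmorph_sum cabs_real.
have -> : \sum_(0 <= j < Q) (D j)%:C = \sum_(0 <= j < Q) (D j)%:C * (1 - expi (th j)) + E.
  by rewrite -big_split/=; apply: eq_bigr => j _; ring.
apply: (le_trans (cabsD _ _)); apply: lerD => //.
apply: (le_trans (cabs_sum _ _ _)); rewrite big_distrr/=.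
apply: ler_sum_nat => j /andP[_ jQ]; rewrite cabsM cabs_real ler_wpM2r ?cabs_ge0//.
exact: De.
Qed.

End winding.

(** * Simultaneous approximation and lower bounds along the orbit *)

Section dirichlet.
Variable R : realType.

(** Pigeonhole: of [K * K + 1] multiples of the pair, two fall into the same one of [K * K] cells of
    side [1 / K <= d]. *)
Lemma dirichlet2 (alpha beta d : R) : 0 < d ->
  exists t (A B : int), [/\ (0 < t)%N, `|t%:R * alpha - A%:~R| <= d & `|t%:R * beta - B%:~R| <= d].
Proof.
move=> d0; pose K := (Num.bound d^-1).+1.
have K0 : 0 < K%:R :> R by rewrite ltr0n.
have Kd : K%:R^-1 <= d.
  rewrite -[d]invrK lef_pV2 ?posrE ?invr_gt0//.
  apply/ltW/(lt_le_trans (archi_boundP _)); first by rewrite invr_ge0 ltW.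
  by rewrite ler_nat.
pose fr (x : R) := x - (Num.floor x)%:~R.
have fr0 x : 0 <= fr x < 1.
  have /andP[h1 h2] : (Num.floor x)%:~R <= x < (Num.floor x + 1)%:~R by exact: floor_itv.
  by rewrite intrD in h2; rewrite /fr; apply/andP; split; lra.
pose cell (x : R) := Num.truncn (K%:R * fr x).
have cellK x : (cell x < K)%N.
  have /andP[f0 f1] := fr0 x.
  have : K%:R * fr x < K%:R by rewrite -[ltRHS]mulr1 ltr_pM2l.
  have : (cell x)%:R <= K%:R * fr x.
    by have /andP[] := truncn_itv (mulr_ge0 (ltW K0) f0).
  by move=> h1 h2; rewrite -(ltr_nat R); exact: le_lt_trans h1 h2.
have cell_close x x' : cell x = cell x' -> `|fr x - fr x'| <= d.
  move=> h; apply: le_trans Kd; have /andP[f0 f1] := fr0 x; have /andP[f0' f1'] := fr0 x'.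
  have /andP[] := truncn_itv (mulr_ge0 (ltW K0) f0).
  have /andP[] := truncn_itv (mulr_ge0 (ltW K0) f0').
  rewrite -/(cell x) -/(cell x') h -natr1 => a1 a2 a3 a4.
  rewrite -(ler_pM2l K0) mulfV ?gt_eqF// -[X in X * `|_|]ger0_norm ?(ltW K0)// -normrM.
  by rewrite ler_norml; lra.
pose f (i : 'I_(K * K).+1) : 'I_K * 'I_K :=
  (Ordinal (cellK (i%:R * alpha)), Ordinal (cellK (i%:R * beta))).
have ninj : ~ injective f.
  by move=> /leq_card; rewrite card_prod !card_ord ltnn.
have [i [j [ij fij]]] : exists i j : 'I_(K * K).+1, (i < j)%N /\ f i = f j.
  apply: contrapT => H; apply: ninj => i j fij; apply: val_inj => /=.
  case: (ltngtP i j) => // h; exfalso; apply: H; first by exists i, j.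
  by exists j, i.
have [h1 h2] : cell (i%:R * alpha) = cell (j%:R * alpha) /\ cell (i%:R * beta) = cell (j%:R * beta).
  by case: fij.
exists (j - i)%N, (Num.floor (j%:R * alpha) - Num.floor (i%:R * alpha)),
  (Num.floor (j%:R * beta) - Num.floor (i%:R * beta)); split.
- by rewrite subn_gt0.
- have := cell_close _ _ h1; rewrite distrC /fr natrB ?(ltnW ij)//; congr (`|_| <= _).
  by rewrite intrB; ring.
- have := cell_close _ _ h2; rewrite distrC /fr natrB ?(ltnW ij)//; congr (`|_| <= _).
  by rewrite intrB; ring.
Qed.

End dirichlet.

Section lower_bounds.
Variable R : realType.
Local Notation "x %:C" := (real_complex _ x) (format "x %:C") : ring_scope.

(** The hypothesis is applied at every orbit point and summed over the window. By [weyl_shift], each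
    of the [Q] translates has nearly the same average as the untranslated function; half of [l] pays
    for the difference. *)
Lemma equidistributed_lower (alpha beta : R) (theta : R -> R -> R) (L l : R) (Q : nat) :
  (forall m l : int, (m != 0) || (l != 0) -> expi (m%:~R * alpha + l%:~R * beta) != 1) ->
  0 <= L -> circle_map L theta -> 0 < l -> (0 < Q)%N ->
  (forall x y, l * Q%:R <= \sum_(0 <= j < Q) cabs (1 - expi (theta (x + j%:R / Q%:R) y)) ^+ 2) ->
  exists N1, forall N, (N1 <= N)%N -> forall n0,
    l / 2 * N%:R <= \sum_(0 <= i < N) cabs (1 - expi (theta ((n0 + i)%:R * alpha) ((n0 + i)%:R * beta))) ^+ 2.
Proof.
move=> indep L0 ct l0 Q0 H; have Q0' : 0 < Q%:R :> R by rewrite ltr0n.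
pose r x y := cabs (1 - expi (theta x y)) ^+ 2.
pose phi x y := (r x y)%:C.
have b2 x y : cabs (1 - expi (theta x y)) <= 2.
  by apply: (le_trans (cabsB _ _)); rewrite cabs1 cabs_expi; lra.
have phiB x y : cabs (phi x y) <= 4.
  rewrite /phi cabs_real /r ger0_norm ?sqr_ge0//.
  by have := b2 x y; have := cabs_ge0 (1 - expi (theta x y)); nra.
have cphi : torus_continuous phi.
  move=> e e0; have e4 : 0 < e / 4 by lra.
  have [k k0 Hk] := circle_map_continuous L0 ct e4; exists k => // x y x' y' hx hy.
  have := Hk _ _ _ _ hx hy; rewrite /phi -rmorphB cabs_real /r.
  set u := expi (theta x y); set v := expi (theta x' y') => h.
  have d : `|cabs (1 - u) - cabs (1 - v)| <= e / 4.
    apply: (le_trans (cabs_dist_dist _ _)); have -> : 1 - u - (1 - v) = v - u by ring.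
    by rewrite cabsC.
  rewrite subr_sqr normrM.
  have s : `|cabs (1 - u) + cabs (1 - v)| <= 4.
    rewrite ger0_norm ?addr_ge0 ?cabs_ge0//.
    by have := b2 x y; have := b2 x' y'; rewrite -/u -/v; lra.
  have -> : e = e / 4 * 4 by field.
  by apply: ler_pM.
have W (j : nat) : exists N1, forall N, (N1 <= N)%N -> forall n0,
   `|\sum_(0 <= i < N) (r ((n0 + i)%:R * alpha + j%:R / Q%:R) ((n0 + i)%:R * beta)
      - r ((n0 + i)%:R * alpha) ((n0 + i)%:R * beta))| <= l / 2 * N%:R.
  have l2 : 0 < l / 2 by lra.
  have [N1 H1] := weyl_shift indep (j%:R / Q%:R) 0 cphi phiB l2.
  exists N1 => N hN n0; have := H1 N hN n0.
  rewrite -cabs_real rmorph_sum; congr (cabs _ <= _).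
  by apply: eq_bigr => i _; rewrite /phi addr0 rmorphB.
pose n1 j := projT1 (cid (W j)).
have n1P j N : (n1 j <= N)%N -> forall n0,
   `|\sum_(0 <= i < N) (r ((n0 + i)%:R * alpha + j%:R / Q%:R) ((n0 + i)%:R * beta)
      - r ((n0 + i)%:R * alpha) ((n0 + i)%:R * beta))| <= l / 2 * N%:R.
  by rewrite /n1; case: cid => ? /= h hN; exact: h.
exists (\max_(0 <= j < Q) n1 j)%N => N hN n0.
set S := \sum_(_ <= _ < _) _.
have E j : (j < Q)%N -> \sum_(0 <= i < N) r ((n0 + i)%:R * alpha + j%:R / Q%:R) ((n0 + i)%:R * beta)
    <= S + l / 2 * N%:R.
  move=> jQ; have hj : (n1 j <= N)%N.
    by apply: leq_trans hN; apply: (leq_bigmax_seq (F := n1) j) => //; rewrite mem_index_iota.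
  have := n1P j N hj n0; rewrite sumrB -/S ler_norml; lra.
have : Q%:R * (l * N%:R) <= Q%:R * (S + l / 2 * N%:R).
  have -> : Q%:R * (S + l / 2 * N%:R) = \sum_(0 <= j < Q) (S + l / 2 * N%:R).
    by rewrite sumr_const_nat subn0 -[(S + l / 2 * N%:R) *+ Q]mulr_natl.
  apply: (@le_trans _ _ (\sum_(0 <= j < Q) \sum_(0 <= i < N) r ((n0 + i)%:R * alpha + j%:R / Q%:R) ((n0 + i)%:R * beta))).
    rewrite exchange_big/=.
    have -> : Q%:R * (l * N%:R) = \sum_(0 <= i < N) (l * Q%:R).
      by rewrite sumr_const_nat subn0 -[(l * Q%:R) *+ N]mulr_natr; ring.
    by apply: ler_sum => i _; exact: H.
  by apply: ler_sum_nat => j /andP[_ jQ]; exact: E.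
by rewrite ler_pM2l//; lra.
Qed.

(** All translates of [f1] have the same winding number [K1], those of [f2] have [K2], so [theta]
    winds [m * (n1 * K1 - n2 * K2) - B2] times. Each translate is lifted separately: [Q] has to be
    large for [f1] and [f2] only, and the lifted steps add up to at most [Lam / Q], as [winding_far]
    requires. *)
Lemma winding_lower (f1 f2 : R -> R -> R) (L1 L2 : R) (u1 v1 u2 v2 : nat -> R)
    (n1 n2 Q : nat) (m A2 B2 : int) (k Lam : R) :
  0 <= L1 -> 0 <= L2 -> circle_map L1 f1 -> circle_map L2 f2 ->
  8 * L1 < Q%:R -> 8 * L2 < Q%:R ->
  `|m%:~R| * (n1%:R * L1 + n2%:R * L2) + `|B2%:~R| <= Lam ->
  let theta x y := m%:~R * (\sum_(0 <= i < n1) f1 (x + u1 i) (y + v1 i)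
                     - \sum_(0 <= i < n2) f2 (x + u2 i) (y + v2 i))
       + (A2%:~R * y - B2%:~R * x) + k in
  exists K1 K2 : int, forall x y,
    `|m%:~R * (n1%:R * K1%:~R - n2%:R * K2%:~R) - B2%:~R|
    <= Lam / Q%:R * \sum_(0 <= j < Q) cabs (1 - expi (theta (x + j%:R / Q%:R) y))
       + expi_const R * Q%:R * (Lam / Q%:R) ^+ 2.
Proof.
move=> L10 L20 c1 c2 Q1 Q2 hLam theta.
have Q0' : 0 < Q%:R :> R by lra.
have Q0 : (0 < Q)%N by rewrite -(ltr_nat R).
have [K1 hK1] := winding_int 0 0 c1 Q0; have [K2 hK2] := winding_int 0 0 c2 Q0.
exists K1, K2 => x y.
pose D j := m%:~R * (\sum_(0 <= i < n1) wstep f1 Q (x + u1 i) (y + v1 i) j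
   - \sum_(0 <= i < n2) wstep f2 Q (x + u2 i) (y + v2 i) j) - B2%:~R / Q%:R.
have SD : \sum_(0 <= j < Q) D j = m%:~R * (n1%:R * K1%:~R - n2%:R * K2%:~R) - B2%:~R.
  rewrite /D sumrB -big_distrr/= sumrB; congr (_ * (_ - _) - _).
  - rewrite exchange_big/= (eq_bigr (fun=> K1%:~R)); last first.
      by move=> i _; rewrite -hK1; exact: (winding_const _ _ _ _ L10 c1 Q1).
    by rewrite sumr_const_nat subn0 mulr_natl.
  - rewrite exchange_big/= (eq_bigr (fun=> K2%:~R)); last first.
      by move=> i _; rewrite -hK2; exact: (winding_const _ _ _ _ L20 c2 Q2).
    by rewrite sumr_const_nat subn0 mulr_natl.
  - by rewrite sumr_const_nat subn0 -[(_ / _) *+ Q]mulr_natl mulrC divfK// gt_eqF.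
have Lam0 : 0 <= Lam.
  by apply: le_trans hLam; rewrite addr_ge0// mulr_ge0// addr_ge0// mulr_ge0.
rewrite -SD; apply: (winding_far (th := fun j => theta (x + j%:R / Q%:R) y)).
- by rewrite divr_ge0// ltW.
- move=> j jQ.
  have s1 : `|\sum_(0 <= i < n1) wstep f1 Q (x + u1 i) (y + v1 i) j| <= n1%:R * (L1 / Q%:R).
    apply: (le_trans (ler_norm_sum _ _ _)).
    have -> : n1%:R * (L1 / Q%:R) = \sum_(0 <= i < n1) L1 / Q%:R by rewrite sumr_const_nat subn0 mulr_natl.
    by apply: ler_sum => i _; apply: wstep_le c1 _ => //; lra.
  have s2 : `|\sum_(0 <= i < n2) wstep f2 Q (x + u2 i) (y + v2 i) j| <= n2%:R * (L2 / Q%:R).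
    apply: (le_trans (ler_norm_sum _ _ _)).
    have -> : n2%:R * (L2 / Q%:R) = \sum_(0 <= i < n2) L2 / Q%:R by rewrite sumr_const_nat subn0 mulr_natl.
    by apply: ler_sum => i _; apply: wstep_le c2 _ => //; lra.
  rewrite /D; apply: (le_trans (ler_normB _ _)); rewrite !normrM [`|Q%:R^-1|]ger0_norm ?invr_ge0 ?(ltW Q0')//.
  apply: (@le_trans _ _ ((`|m%:~R| * (n1%:R * L1 + n2%:R * L2) + `|B2%:~R|) / Q%:R)); last first.
    by rewrite ler_wpM2r// invr_ge0 ltW.
  rewrite mulrDl lerD2r -mulrA ler_wpM2l//; apply: (le_trans (ler_normB _ _)).
  by rewrite mulrDl -!mulrA; apply: lerD.
- move=> j jQ; apply: nearZ0_expi.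
  have X1 : nearZ 0 (\sum_(0 <= i < n1) (f1 (x + u1 i + j.+1%:R / Q%:R) (y + v1 i) - f1 (x + u1 i + j%:R / Q%:R) (y + v1 i)
      - wstep f1 Q (x + u1 i) (y + v1 i) j)).
    have := nearZ_sum n1 (fun i => nearZ_cfrac (f1 (x + u1 i + j.+1%:R / Q%:R) (y + v1 i) - f1 (x + u1 i + j%:R / Q%:R) (y + v1 i))).
    by rewrite big1.
  have X2 : nearZ 0 (\sum_(0 <= i < n2) (f2 (x + u2 i + j.+1%:R / Q%:R) (y + v2 i) - f2 (x + u2 i + j%:R / Q%:R) (y + v2 i)
      - wstep f2 Q (x + u2 i) (y + v2 i) j)).
    have := nearZ_sum n2 (fun i => nearZ_cfrac (f2 (x + u2 i + j.+1%:R / Q%:R) (y + v2 i) - f2 (x + u2 i + j%:R / Q%:R) (y + v2 i))).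
    by rewrite big1.
  rewrite 2!sumrB in X1; rewrite 2!sumrB in X2.
  have C (n : nat) f (u v : nat -> R) (w : R) : \sum_(0 <= i < n) f (x + w + u i) (y + v i)
      = \sum_(0 <= i < n) f (x + u i + w) (y + v i) :> R.
    by apply: eq_bigr => i _; rewrite addrAC.
  have := nearZ_mulint m (nearZB X1 X2); rewrite addr0 mulr0; congr nearZ.
  rewrite /theta /D !C.
  have -> : B2%:~R * (x + j.+1%:R / Q%:R) = B2%:~R * (x + j%:R / Q%:R) + B2%:~R / Q%:R.
    by rewrite -(natr1 j) mulrDl mul1r; ring.
  ring.
- have per (f : R -> R -> R) (L : R) (cf : circle_map L f) z w : nearZ 0 (f (z + 1) w - f z w).
    by have [_ h] := cf; have := h z w 1 0; rewrite !addr0.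
  apply: nearZ0_expi; rewrite mul0r addr0 divff ?gt_eqF//.
  have X1 : nearZ 0 (\sum_(0 <= i < n1) (f1 (x + u1 i + 1) (y + v1 i) - f1 (x + u1 i) (y + v1 i))).
    by have := nearZ_sum n1 (fun i => per _ _ c1 (x + u1 i) (y + v1 i)); rewrite big1.
  have X2 : nearZ 0 (\sum_(0 <= i < n2) (f2 (x + u2 i + 1) (y + v2 i) - f2 (x + u2 i) (y + v2 i))).
    by have := nearZ_sum n2 (fun i => per _ _ c2 (x + u2 i) (y + v2 i)); rewrite big1.
  rewrite sumrB in X1; rewrite sumrB in X2.
  have C (n : nat) f (u v : nat -> R) (w : R) : \sum_(0 <= i < n) f (x + w + u i) (y + v i)
      = \sum_(0 <= i < n) f (x + u i + w) (y + v i) :> R.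
    by apply: eq_bigr => i _; rewrite addrAC.
  have := nearZB (nearZ_mulint m (nearZB X1 X2)) (nearZ_int R B2); rewrite !addr0 mulr0; congr nearZ.
  rewrite /theta !C; ring.
Qed.

End lower_bounds.

Section circle_map_more.
Variable R : realType.
Implicit Types (f g : R -> R -> R).

Lemma circle_map_shift L f (u v : R) : circle_map L f -> circle_map L (fun x y => f (x + u) (y + v)).
Proof.
move=> [hf pf]; split=> [x y x' y'|x y a b].
  have := hf (x + u) (y + v) (x' + u) (y' + v).
  have -> : x + u - (x' + u) = x - x' by ring.
  by have -> : y + v - (y' + v) = y - y' by ring.
by rewrite ![_ + _%:~R + _]addrAC.
Qed.

Lemma circle_mapB L L' f g : circle_map L f -> circle_map L' g ->
  circle_map (L + L') (fun x y => f x y - g x y).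
Proof.
move=> hf /(circle_map_mulint (- 1)); rewrite normrN1 mul1r => hg.
have := circle_mapD hf hg; congr circle_map.
by apply/funext => x; apply/funext => y; rewrite mulN1r.
Qed.

Lemma intr_norm_ge1 (a : int) : a != 0 -> 1 <= `|a%:~R| :> R.
Proof. by rewrite -intr_norm (ler_int R 1); case: a => [[|]|]. Qed.

(** Only the two end pieces of length [p] of the sum over [[0, N + p)] survive. This trades [N]
    differences over [p] steps for [p] differences over [N] steps, after which the orbit nearly
    returns. *)
Lemma sum_shift (V : zmodType) (G : nat -> V) (N p : nat) :
  \sum_(0 <= i < N) (G (p + i)%N - G i) = \sum_(0 <= i < p) (G (N + i)%N - G i).
Proof.
rewrite !sumrB.
have E (a b : nat) : \sum_(0 <= i < b) G (a + i)%N = \sum_(0 <= i < a + b) G i - \sum_(0 <= i < a) G i.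
  rewrite (big_cat_nat (n := a) (p := (a + b)%N))//= ?leq_addr// [X in _ = X]addrAC subrr add0r.
  by rewrite -{2}[a]add0n big_addn addKn; apply: eq_bigr => i _; rewrite addnC.
by rewrite !E addnC; rewrite -!addrA; congr (_ + _); rewrite addrC.
Qed.

End circle_map_more.

(** With [b = beta] and [e = t * beta - B], the inside is the winding number [t * K - 2 * w * B] up
    to the factor [M]. Its main term is at least [t * k0], and the condition on [d] keeps
    [2 * w * e] below [k0 / 2], hence below half of it. *)
Lemma far_from_integer (R : realType) (M D w b k0 d e t : R) (K : int) :
  1 <= M -> 1 <= t -> 0 <= k0 -> `|w| = D -> k0 <= `|K%:~R - 2 * w * b| -> `|e| <= d -> d * (4 * D) <= k0 ->
  t * k0 / 2 <= M * `|t * (K%:~R - 2 * w * b) + 2 * w * e|.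
Proof.
move=> M1 t1 k00 <- Kb ed dD; set x1 := t * (_ - _); set x2 := 2 * w * e.
have t0 : 0 <= t by lra.
have h1 : t * k0 <= `|x1| by rewrite /x1 normrM [`|t|]ger0_norm// ler_wpM2l.
have h2 : `|x2| <= 2 * `|w| * d.
  by rewrite /x2 !normrM [`|2|]ger0_norm// ler_wpM2l// mulr_ge0.
have h3 := ler_normB (x1 + x2) x2; rewrite addrK in h3.
have h4 : k0 <= t * k0 by rewrite ler_peMl.
have : t * k0 / 2 <= `|x1 + x2| by move: h1 h2 h3 h4 dD; clear; lra.
by move/le_trans; apply; rewrite ler_peMl.
Qed.

(** The condition on [Q] makes the quadratic term at most [t * k0 / 4], half of the left side. Then
    [t] cancels, as winding number and step size are both linear in it, and [lam] is independent of
    [t]. *)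
Lemma winding_mean_lower (R : realType) (t k0 C2 lam kappa Q S : R) :
  1 <= t -> 0 < C2 -> 0 < Q -> lam * (4 * C2) = k0 -> 4 * kappa * C2 ^+ 2 * t <= k0 * Q ->
  t * k0 / 2 <= C2 * t / Q * S + kappa * Q * (C2 * t / Q) ^+ 2 ->
  lam * Q <= S.
Proof.
move=> t1 C20 Q0 lamE h5 h; have t0 : 0 < t by apply: lt_le_trans t1.
have Lam0 : 0 < C2 * t by rewrite mulr_gt0.
rewrite -(ler_pM2l Lam0) -(ler_pM2l (_ : 0 < 4 :> R))//.
have h7 : t * (4 * kappa * C2 ^+ 2 * t) <= t * (k0 * Q) by rewrite ler_pM2l.
have := ler_wpM2r (ltW Q0) h.
have -> : (C2 * t / Q * S + kappa * Q * (C2 * t / Q) ^+ 2) * Q = C2 * t * S + kappa * (C2 * t) ^+ 2.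
  by field; rewrite gt_eqF.
have -> : 4 * (C2 * t * (lam * Q)) = t * (lam * (4 * C2)) * Q by ring.
rewrite lamE; move: h7; clear; lra.
Qed.

(** With [a = lam], it turns the lower bound [lam] for a mean into [lam ^ 2] for the mean square. *)
Lemma tangent_le_sqr (R : realType) (a b : R) : 2 * a * b - a ^+ 2 <= b ^+ 2.
Proof. have := sqr_ge0 (b - a); lra. Qed.

(** * Correlations along an orbit *)

Section correlation.
Variable R : realType.
Variables (alpha beta x0 y0 L : R) (hh : R -> R -> R) (fh : R -> R -> R -> R[i]).
Variables (m : int) (z : nat -> R) (B0 : R).
Hypothesis indep : forall m l : int, (m != 0) || (l != 0) ->
  expi (m%:~R * alpha + l%:~R * beta) != 1.
Hypothesis L0 : 0 <= L.
Hypothesis hhL : circle_map L hh.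
Hypothesis fhE : forall x y w s, fh x y (w + s) = expi (m%:~R * s) * fh x y w.
(** Right multiplication by the lattice element [(a, b, 0)]. The continuity assumption [fhU], in
    contrast, concerns left multiplication by a small [(d1, d2, 0)]: its twist [d1 * y - d2 * x]
    makes it compatible with [fhG] and so uniform over unbounded [x] and [y]. *)
Hypothesis fhG : forall x y w (a b : int),
  fh (x + a%:~R) (y + b%:~R) (w + (x * b%:~R - y * a%:~R)) = fh x y w.
Hypothesis fhU : forall e : R, 0 < e -> exists2 d : R, 0 < d & forall d1 d2 x y w,
  `|d1| <= d -> `|d2| <= d -> cabs (fh (x + d1) (y + d2) (w + (d1 * y - d2 * x)) - fh x y w) <= e.
Hypothesis fhB : forall x y w, cabs (fh x y w) <= B0.

Let X (n : nat) := x0 + n%:R * alpha.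
Let Y (n : nat) := y0 + n%:R * beta.
Hypothesis zS : forall n, z n.+1 = z n + hh (X n) (Y n) + (alpha * Y n - X n * beta).

Let F n := fh (X n) (Y n) (z n).

Lemma orbit_add n s :
  z (n + s)%N = z n + \sum_(0 <= i < s) hh (X (n + i)%N) (Y (n + i)%N)
     + s%:R * (alpha * Y n - X n * beta).
Proof.
elim: s => [|s IH]; first by rewrite addn0 big_geq// mul0r !addr0.
rewrite addnS zS IH big_nat_recr//= -(natr1 s) {3 4}/X {3 4}/Y /X /Y natrD.
ring.
Qed.

(* When [s (alpha, beta)] is close to the integer point [(A, B)], moving [s] steps
   along the orbit amounts to a small translation by [(d1, d2)] and this central
   shift, the lattice element with coordinates [(A, B)] having been removed. *)
Definition return_phase (n s : nat) (A B : int) :=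
  \sum_(0 <= i < s) hh (X (n + i)%N) (Y (n + i)%N) + 2 * A%:~R * Y n - 2 * B%:~R * X n
  + (A%:~R * (s%:R * beta - B%:~R) - B%:~R * (s%:R * alpha - A%:~R)).

Lemma orbit_return n s (A B : int) :
  let d1 := s%:R * alpha - A%:~R in let d2 := s%:R * beta - B%:~R in
  F (n + s)%N = expi (m%:~R * return_phase n s A B)
   * fh (X n + d1) (Y n + d2) (z n + (d1 * Y n - d2 * X n)).
Proof.
move=> d1 d2; rewrite -fhE -(fhG _ _ _ A B) /F orbit_add.
have -> : X (n + s)%N = X n + d1 + A%:~R by rewrite /X /d1 natrD; ring.
have -> : Y (n + s)%N = Y n + d2 + B%:~R by rewrite /Y /d2 natrD; ring.
congr (fh _ _ _); rewrite /return_phase.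
move: (\sum_(_ <= _ < _) _) => S; rewrite /d1 /d2; ring.
Qed.

Lemma correlation_null (p q : nat) : (0 < p)%N -> (0 < q)%N -> p != q -> m != 0 ->
  uniform_null (fun n => F (p * n)%N * conjc (F (q * n)%N)).
Proof.
move=> p0 q0 pq m0.
have B00 : 0 <= B0 by apply: le_trans (fhB 0 0 0); exact: cabs_ge0.
pose wi : int := p%:Z ^+ 2 - q%:Z ^+ 2.
pose w : R := wi%:~R.
have wE : w = p%:R ^+ 2 - q%:R ^+ 2 by rewrite /w /wi intrB !rmorphXn/= -!pmulrn.
have wi0 : wi != 0.
  rewrite subr_eq0; apply: contra pq => /eqP h.
  have : (p ^ 2 = q ^ 2)%N by apply/eqP; rewrite -(eqr_nat int) !natrX !natz h.
  by move/eqP; rewrite eqn_exp2r.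
clearbody wi.
pose M : R := `|m%:~R|; pose D : R := `|w|.
have M1 : 1 <= M by exact: intr_norm_ge1.
have D1 : 1 <= D by exact: intr_norm_ge1.
have M0 : 0 <= M by exact: normr_ge0.
have D0 : 0 <= D by exact: normr_ge0.
have P1 : 1 <= p%:R :> R by rewrite ler1n.
have Q1 : 1 <= q%:R :> R by rewrite ler1n.
(* [2 * w * beta] is not an integer, and its chord divided by [4 * pi] bounds its distance from the
   integers from below. *)
have [k0 k00 Hk0] : exists2 k0 : R, 0 < k0 & forall K : int, k0 <= `|K%:~R - 2 * w * beta|.
  have ne : expi ((0 : int)%:~R * alpha + (2 * wi)%:~R * beta) != 1.
    by apply: indep; rewrite mulf_neq0 ?orbT.
  rewrite mul0r add0r intrM -/w in ne; set s := 2%:~R * w * beta in ne.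
  have pi0 := pi_gt0 R.
  have c0 : 0 < cabs (expi s - 1).
    rewrite lt_def cabs_ge0 andbT; apply: contra ne => /eqP /cabs_eq0 /eqP.
    by rewrite subr_eq0.
  exists (cabs (expi s - 1) / (4 * pi)); first by rewrite divr_gt0// mulr_gt0.
  move=> K; rewrite ler_pdivrMr ?mulr_gt0// mulrC distrC.
  by have := expi_lip s 0 K; rewrite expi0 subr0.
(* [C2 * t] will bound the total step size [Lam]: the first summand comes from the [r * t]
   translates of maps with Lipschitz constant [r * L], the second from [B2 = 2 * m * w * B] with
   [|B| <= t * (|beta| + 1)]. *)
pose C2 := M * (p%:R ^+ 2 + q%:R ^+ 2) * L + 2 * M * D * (`|beta| + 1).
have C20 : 0 < C2.
  apply: ltr_wpDl.
    by rewrite (mulr_ge0 (mulr_ge0 M0 _)) ?addr_ge0 ?exprn_ge0.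
  have hb : 0 < `|beta| + 1 by have := normr_ge0 beta; lra.
  by rewrite (mulr_gt0 (mulr_gt0 (mulr_gt0 _ _) _) hb)//; lra.
pose lam := k0 / (4 * C2).
have lam0 : 0 < lam by rewrite divr_gt0// mulr_gt0.
(* [C3 * d] will bound the change of the phase from [n] to [n + 1]. *)
pose C3 := M * (2 * L * (p%:R ^+ 2 + q%:R ^+ 2) + 2 * D * (`|alpha| + `|beta|)).
have C30 : 0 <= C3.
  have := normr_ge0 alpha; have := normr_ge0 beta => hb ha.
  by apply: mulr_ge0 => //; apply: addr_ge0; rewrite ?mulr_ge0 ?addr_ge0 ?exprn_ge0.
apply: (@almost_period_null _ _ (B0 * B0) (lam ^+ 2 / 2)).
- by move=> n; rewrite cabsM cabs_conj; apply: ler_pM; rewrite ?cabs_ge0 ?fhB.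
- by rewrite divr_gt0// exprn_gt0.
move=> e e0.
have e'0 : 0 < e / (2 * (B0 + 1)) by rewrite divr_gt0// mulr_gt0//; lra.
have [dU dU0 HU] := fhU e'0.
have pi0 := pi_gt0 R.
(* In order: the displacements after [p * t] and [q * t] steps are within [dU]; the error in
   [far_from_integer] is small enough; [|B| <= t * (|beta| + 1)]; the factor [g] changes by at most
   [e] per step. *)
pose d := Num.min (dU / (p%:R + q%:R)) (Num.min (k0 / (4 * D)) (Num.min 1 (e / (4 * pi * (C3 + 1))))).
have d0 : 0 < d.
  rewrite !lt_min ltr01 !divr_gt0//; first by rewrite !mulr_gt0//; lra.
  - by rewrite mulr_gt0//; lra.
  - by lra.
have dd1 : d * (p%:R + q%:R) <= dU.
  by rewrite -ler_pdivlMr; [rewrite ge_min lexx|lra].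
have dd2 : d * (4 * D) <= k0.
  by rewrite -ler_pdivlMr; [rewrite !ge_min lexx ?orbT|lra].
have dd3 : d <= 1 by rewrite !ge_min lexx ?orbT.
have dd4 : 4 * pi * (C3 * d) <= e.
  have : d * (4 * pi * (C3 + 1)) <= e.
    by rewrite -ler_pdivlMr; [rewrite !ge_min lexx ?orbT|rewrite !mulr_gt0//; lra].
  have : 0 <= pi * d by rewrite mulr_ge0// ltW.
  lra.
have [t [A [B [t0 hA hB]]]] := dirichlet2 alpha beta d0.
have t1 : 1 <= t%:R :> R by rewrite ler1n.
set e1 := t%:R * alpha - A%:~R in hA; set e2 := t%:R * beta - B%:~R in hB.
have eP (r : nat) : (r * t)%:R * alpha - (r%:Z * A)%:~R = r%:R * e1.
  by rewrite natrM intrM -pmulrn /e1; ring.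
have eP' (r : nat) : (r * t)%:R * beta - (r%:Z * B)%:~R = r%:R * e2.
  by rewrite natrM intrM -pmulrn /e2; ring.
(* [hh] at the orbit point of index [r * n + i] is [f r] at [n] times the rotation vector,
   translated by [u r i] and [v r i]. So [g] samples one fixed function [expi] of [theta] along the
   rotation. *)
pose f (r : nat) := fun x y => hh (r%:R * x + 0) (r%:R * y + 0).
pose u (r : nat) i := (x0 + i%:R * alpha) / r%:R.
pose v (r : nat) i := (y0 + i%:R * beta) / r%:R.
(* The linear part of [return_phase] at time [r * n] has the coefficient [r * A] and the argument
   [r * n * beta], hence the factor [r ^ 2]; the difference over [p] and [q] is [wi]. [k] collects
   what does not depend on [n]. *)
pose A2 : int := 2 * m * wi * A; pose B2 : int := 2 * m * wi * B.
pose k : R := m%:~R * ((return_phase 0 (p * t) (p%:Z * A) (p%:Z * B)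
     - \sum_(0 <= i < p * t) hh (X (0 + i)%N) (Y (0 + i)%N))
   - (return_phase 0 (q * t) (q%:Z * A) (q%:Z * B)
     - \sum_(0 <= i < q * t) hh (X (0 + i)%N) (Y (0 + i)%N))).
pose theta x y := m%:~R * (\sum_(0 <= i < p * t) f p (x + u p i) (y + v p i)
                     - \sum_(0 <= i < q * t) f q (x + u q i) (y + v q i))
       + (A2%:~R * y - B2%:~R * x) + k.
pose g n := expi (theta (n%:R * alpha) (n%:R * beta)).
have fX (r : nat) n : (0 < r)%N -> \sum_(0 <= i < r * t) f r (n%:R * alpha + u r i) (n%:R * beta + v r i)
   = \sum_(0 <= i < r * t) hh (X (r * n + i)%N) (Y (r * n + i)%N).
  move=> r0; have r0' : r%:R != 0 :> R by rewrite pnatr_eq0 -lt0n.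
  apply: eq_bigr => i _; rewrite /f /u /v /X /Y natrD natrM; congr (hh _ _).
    by field.
  by field.
have thE n : theta (n%:R * alpha) (n%:R * beta)
   = m%:~R * return_phase (p * n) (p * t) (p%:Z * A) (p%:Z * B)
   - m%:~R * return_phase (q * n) (q * t) (q%:Z * A) (q%:Z * B).
  rewrite /theta !fX// /k /return_phase.
  move: (\sum_(0 <= i < p * t) hh (X (p * n + i)%N) _) (\sum_(0 <= i < q * t) hh (X (q * n + i)%N) _) => S1 S2.
  move: (\sum_(0 <= i < p * t) _) (\sum_(0 <= i < q * t) _) => S3 S4.
  rewrite /A2 /B2 /X /Y !intrM -/w wE !natrM -!pmulrn !mul0r !addr0; ring.
have cf (r : nat) : circle_map (r%:R * L) (f r) by exact: circle_map_affine.
have L1 : 0 <= p%:R * L by rewrite mulr_ge0.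
have L2 : 0 <= q%:R * L by rewrite mulr_ge0.
exists t, g; split.
- move=> n; rewrite !mulnDr (orbit_return (p * n) (p * t) (p%:Z * A) (p%:Z * B)).
  rewrite (orbit_return (q * n) (q * t) (q%:Z * A) (q%:Z * B)) !eP !eP' /g thE.
  set a1 := m%:~R * return_phase (p * n) _ _ _; set a2 := m%:~R * return_phase (q * n) _ _ _.
  set G1 := fh _ _ (z (p * n)%N + _); set G2 := fh _ _ (z (q * n)%N + _).
  have -> : expi a1 * G1 * conjc (expi a2 * G2) = expi (a1 - a2) * (G1 * conjc G2).
    by rewrite rmorphM/= -expiNr expiD; ring.
  have b r : (r <= p + q)%N -> `|r%:R * e1| <= dU /\ `|r%:R * e2| <= dU.
    move=> hr; have hr' : r%:R <= p%:R + q%:R :> R by rewrite -natrD ler_nat.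
    split; rewrite normrM ger0_norm//; apply: le_trans dd1; rewrite mulrC.
      by apply: ler_pM.
    by apply: ler_pM.
  have [bp1 bp2] := b p (leq_addr _ _); have [bq1 bq2] := b q (leq_addl _ _).
  have h1 : cabs (G1 - F (p * n)%N) <= e / (2 * (B0 + 1)) by exact: HU.
  have h2 : cabs (G2 - F (q * n)%N) <= e / (2 * (B0 + 1)) by exact: HU.
  rewrite -mulrBr cabsM cabs_expi mul1r.
  have -> : G1 * conjc G2 - F (p * n)%N * conjc (F (q * n)%N)
    = (G1 - F (p * n)%N) * conjc G2 + F (p * n)%N * conjc (G2 - F (q * n)%N).
    by rewrite rmorphB/=; ring.
  apply: (le_trans (cabsD _ _)); rewrite !cabsM !cabs_conj.
  apply: (@le_trans _ _ (e / (2 * (B0 + 1)) * B0 + B0 * (e / (2 * (B0 + 1))))).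
    by apply: lerD; apply: ler_pM; rewrite ?cabs_ge0 ?fhB.
  have : e / (2 * (B0 + 1)) * (2 * (B0 + 1)) = e by rewrite divfK// gt_eqF//; lra.
  have := e'0; move: (e / _) => s; lra.
- by move=> n; exact: cabs_expi.
(* When [n] grows by 1, a sum of [hh] over [r * t] orbit points is shifted by [r]; by [sum_shift]
   only [r] differences over [r * t] steps remain, each close to a lattice translation. The linear
   part changes by [A2 * beta - B2 * alpha], small since [A] and [B] are nearly proportional to
   [alpha] and [beta]. *)
- move=> n; apply: le_trans dd4; apply: nearZ_expi.
  have S (r : nat) : (0 < r)%N -> nearZ (r%:R * (L * (2 * r%:R * d)))
    (\sum_(0 <= i < r * t) f r (n.+1%:R * alpha + u r i) (n.+1%:R * beta + v r i)
     - \sum_(0 <= i < r * t) f r (n%:R * alpha + u r i) (n%:R * beta + v r i)).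
    move=> r0; rewrite !fX// -sumrB.
    pose G i := hh (X (r * n + i)%N) (Y (r * n + i)%N).
    rewrite (eq_bigr (fun i => G (r + i)%N - G i)); last first.
      by move=> i _; rewrite /G mulnS addnCA addnA.
    rewrite sum_shift.
    have -> : r%:R * (L * (2 * r%:R * d)) = \sum_(0 <= i < r) (L * (2 * r%:R * d)).
      by rewrite sumr_const_nat subn0 mulr_natl.
    apply: nearZ_sum => i; rewrite /G.
    have [hf pf] := hhL.
    have EX : X (r * n + (r * t + i))%N = X (r * n + i)%N + r%:R * e1 + (r%:Z * A)%:~R.
      by rewrite -eP /X !natrD; ring.
    have EY : Y (r * n + (r * t + i))%N = Y (r * n + i)%N + r%:R * e2 + (r%:Z * B)%:~R.
      by rewrite -eP' /Y !natrD; ring.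
    rewrite EX EY.
    set xx := X _; set yy := Y _.
    have := nearZD (pf (xx + r%:R * e1) (yy + r%:R * e2) (r%:Z * A) (r%:Z * B))
      (hf (xx + r%:R * e1) (yy + r%:R * e2) xx yy).
    have -> : xx + r%:R * e1 - xx = r%:R * e1 by ring.
    have -> : yy + r%:R * e2 - yy = r%:R * e2 by ring.
    rewrite addrA subrK add0r; apply: nearZW; rewrite ler_wpM2l// !normrM ger0_norm//.
    have := ler_wpM2l (ler0n R r) hA; have := ler_wpM2l (ler0n R r) hB; lra.
  have T1 := nearZ_mulint m (nearZB (S p p0) (S q q0)).
  have E : A2%:~R * beta - B2%:~R * alpha = 2 * m%:~R * w * (e2 * alpha - e1 * beta) :> R.
    by rewrite /A2 /B2 !intrM -/w /e1 /e2; ring.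
  have T2 : nearZ (2 * M * D * (d * (`|alpha| + `|beta|))) (A2%:~R * beta - B2%:~R * alpha).
    apply: nearZW (nearZ_norm _); rewrite E !normrM ger0_norm// -/M -/D ler_wpM2l//.
      by rewrite !mulr_ge0//; lra.
    apply: (le_trans (ler_normB _ _)); rewrite !normrM.
    have := ler_wpM2r (normr_ge0 alpha) hB; have := ler_wpM2r (normr_ge0 beta) hA; lra.
  have := nearZD T1 T2; rewrite -/M.
  have -> : M * (p%:R * (L * (2 * p%:R * d)) + q%:R * (L * (2 * q%:R * d)))
      + 2 * M * D * (d * (`|alpha| + `|beta|)) = C3 * d by rewrite /C3; ring.
  congr nearZ; rewrite /theta -!(natr1 n).
  move: (\sum_(_ <= _ < _) _) (\sum_(_ <= _ < _) _) (\sum_(_ <= _ < _) _) (\sum_(_ <= _ < _) _) => s1 s2 s3 s4.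
  ring.
- pose Lam := C2 * t%:R.
  have K1 := expi_const_ge1 R.
  (* The first two terms let both winding numbers be computed with [Q] points; the last is the
     condition on [Q] in [winding_mean_lower]. [Q] may depend on [t], as [lam] does not. *)
  pose Qr := 8 * (p%:R * L) + 8 * (q%:R * L) + 4 * expi_const R * C2 ^+ 2 * t%:R / k0.
  have h4 : 0 <= 4 * expi_const R * C2 ^+ 2 * t%:R / k0.
    have K0 : 0 <= expi_const R by apply: le_trans K1.
    apply: divr_ge0; last exact: ltW.
    by apply: mulr_ge0 => //; apply: mulr_ge0; rewrite ?exprn_ge0 ?(ltW C20)// mulr_ge0.
  have Qr0 : 0 <= Qr by rewrite /Qr !addr_ge0// !mulr_ge0.
  pose Q := (Num.bound Qr).+1.
  have QQ : Qr < Q%:R by apply: (lt_le_trans (archi_boundP Qr0)); rewrite ler_nat.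
  have Q0' : 0 < Q%:R :> R by [].
  have Bt : `|B%:~R| <= t%:R * (`|beta| + 1).
    have -> : B%:~R = t%:R * beta - e2 by rewrite /e2; ring.
    apply: (le_trans (ler_normB _ _)); rewrite normrM ger0_norm//.
    have := normr_ge0 beta; lra.
  have hLam : `|m%:~R| * ((p * t)%:R * (p%:R * L) + (q * t)%:R * (q%:R * L)) + `|B2%:~R| <= Lam.
    have -> : `|B2%:~R| = 2 * M * D * `|B%:~R| :> R.
      by rewrite /B2 !intrM !normrM -/w ger0_norm.
    have : 2 * M * D * `|B%:~R| <= 2 * M * D * (t%:R * (`|beta| + 1)).
      by rewrite ler_wpM2l// !mulr_ge0//; lra.
    rewrite -/M /Lam /C2 !natrM; lra.
  have q1 : 8 * (p%:R * L) < Q%:R.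
    by apply: le_lt_trans QQ; rewrite /Qr -addrA lerDl addr_ge0// !mulr_ge0.
  have q2 : 8 * (q%:R * L) < Q%:R.
    by apply: le_lt_trans QQ; rewrite /Qr addrAC lerDr addr_ge0// !mulr_ge0.
  have [KA [KB HW]] := winding_lower (u p) (v p) (u q) (v q) A2 k L1 L2 (cf p) (cf q) q1 q2 hLam.
  have Wlow : t%:R * k0 / 2 <= `|m%:~R * ((p * t)%:R * KA%:~R - (q * t)%:R * KB%:~R) - B2%:~R|.
    have -> : m%:~R * ((p * t)%:R * KA%:~R - (q * t)%:R * KB%:~R) - B2%:~R
      = m%:~R * (t%:R * ((p%:Z * KA - q%:Z * KB)%:~R - 2 * w * beta) + 2 * w * e2) :> R.
      by rewrite /B2 !natrM !(intrM, intrB) -!pmulrn -/w /e2; ring.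
    rewrite normrM; exact: (far_from_integer M1 t1 (ltW k00) erefl (Hk0 _) hB dd2).
  have [Lt [Lt0 ct]] : exists Lt, 0 <= Lt /\ circle_map Lt theta.
    exists (M * ((p * t)%:R * (p%:R * L) + (q * t)%:R * (q%:R * L)) + (`|A2%:~R| + `|(- B2)%:~R|) + 0).
    split.
      by rewrite addr0 addr_ge0 ?addr_ge0// mulr_ge0// addr_ge0// mulr_ge0.
    apply: circle_mapD; last exact: circle_map_cst.
    apply: circle_mapD.
      apply: circle_map_mulint; apply: circle_mapB.
        by apply: circle_map_sum => i; exact: circle_map_shift.
      by apply: circle_map_sum => i; exact: circle_map_shift.
    have [lf lp] := @circle_map_linear R (- B2) A2; rewrite [`|A2%:~R| + _]addrC.
    have E : (fun x y => A2%:~R * y - B2%:~R * x) = (fun x y => (- B2)%:~R * x + A2%:~R * y) :> (R -> R -> R).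
      by apply/funext => x; apply/funext => y; rewrite mulrNz mulNr addrC.
    by rewrite E.
  have lam2 : 0 < lam ^+ 2 by rewrite exprn_gt0.
  have Q00 : (0 < Q)%N by [].
  apply: (equidistributed_lower indep Lt0 ct lam2 Q00) => x y.
  have := HW x y; rewrite -/(theta _ _) => HWxy.
  pose S := \sum_(0 <= j < Q) cabs (1 - expi (theta (x + j%:R / Q%:R) y)).
  have SQ : lam * Q%:R <= S.
    apply: (winding_mean_lower t1 C20 Q0' _ _ (le_trans Wlow HWxy)).
      by rewrite /lam divfK// gt_eqF// mulr_gt0.
    rewrite mulrC [k0 * _]mulrC -ler_pdivrMr// mulrC (le_trans _ (ltW QQ))//.
    by rewrite /Qr lerDr addr_ge0// !mulr_ge0.
  have E : \sum_(0 <= j < Q) (2 * lam * cabs (1 - expi (theta (x + j%:R / Q%:R) y)) - lam ^+ 2)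
     = 2 * lam * S - lam ^+ 2 * Q%:R.
    by rewrite sumrB -big_distrr/= sumr_const_nat subn0 -[(lam ^+ 2) *+ Q]mulr_natr.
  apply: (@le_trans _ _ (2 * lam * S - lam ^+ 2 * Q%:R)).
    have := ler_wpM2l (ltW lam0) SQ; clear; lra.
  by rewrite -E; apply: ler_sum => j _; exact: tangent_le_sqr.
Qed.

End correlation.

(** * Vertical Fourier coefficients *)

Section limits.
Variable R : realType.
Implicit Types (u : nat -> R).

(** Defined for every sequence, so that Fourier coefficients are plain functions; on a Cauchy
    sequence it is the limit, quantitatively by [liminf_seq_near]. *)
Definition liminf_seq u : R := sup [set y | exists k0, forall k, (k0 <= k)%N -> y <= u k].

Lemma liminf_seq_near u (k0 : nat) (e : R) :
  (forall k, (k0 <= k)%N -> `|u k - u k0| <= e) ->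
  forall k, (k0 <= k)%N -> `|u k - liminf_seq u| <= 2 * e.
Proof.
move=> H k hk; rewrite /liminf_seq; set E := [set y | _].
have Ein : E (u k0 - e).
  by exists k0 => j /H; rewrite ler_norml; lra.
have Eup y : E y -> y <= u k0 + e.
  move=> [k1 h]; have := h (maxn k0 k1) (leq_maxr _ _).
  by have := H (maxn k0 k1) (leq_maxl _ _); rewrite ler_norml; lra.
have hs : has_sup E by split; [exists (u k0 - e)|exists (u k0 + e) => y /Eup].
have s1 : u k0 - e <= sup E by apply: ub_le_sup; [exact: hs.2|].
have s2 : sup E <= u k0 + e by apply: ge_sup; [exact: hs.1|move=> y /Eup].
by have := H k hk; rewrite !ler_norml; lra.
Qed.

Definition liminfc (u : nat -> R[i]) : R[i] :=
  Complex (liminf_seq (fun k => Re (u k))) (liminf_seq (fun k => Im (u k))).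

Lemma liminfc_near (u : nat -> R[i]) (k0 : nat) (e : R) :
  (forall k, (k0 <= k)%N -> cabs (u k - u k0) <= e) ->
  forall k, (k0 <= k)%N -> cabs (u k - liminfc u) <= 4 * e.
Proof.
move=> H k hk; apply: (le_trans (cabs_le_ReIm _)).
have hr : `|Re (u k) - liminf_seq (fun k => Re (u k))| <= 2 * e.
  apply: (@liminf_seq_near (fun k => Re (u k)) k0) => // j hj.
  apply: le_trans (H j hj); have := Re_le_cabs (u j - u k0).
  by case: (u j) => a b; case: (u k0).
have hi : `|Im (u k) - liminf_seq (fun k => Im (u k))| <= 2 * e.
  apply: (@liminf_seq_near (fun k => Im (u k)) k0) => // j hj.
  apply: le_trans (H j hj); have := Im_le_cabs (u j - u k0).
  by case: (u j) => a b; case: (u k0).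
move: hr hi; rewrite /liminfc; case: (u k) => a b /=; lra.
Qed.

End limits.

Section vertical_fourier.
Variable R : realType.
Local Notation "x %:C" := (real_complex _ x) (format "x %:C") : ring_scope.
Variables (fh : R -> R -> R -> R[i]) (B : R).
Hypothesis fhB : forall x y w, cabs (fh x y w) <= B.
Hypothesis fhG : forall x y w (a b c : int),
  fh (x + a%:~R) (y + b%:~R) (w + (x * b%:~R - y * a%:~R) + c%:~R) = fh x y w.
Hypothesis fhU : forall e : R, 0 < e -> exists2 d : R, 0 < d & forall d1 d2 d3 x y w,
  `|d1| <= d -> `|d2| <= d -> `|d3| <= d ->
  cabs (fh (x + d1) (y + d2) (w + (d1 * y - d2 * x) + d3) - fh x y w) <= e.

Lemma fh_bound_ge0 : 0 <= B.
Proof. by apply: le_trans (fhB 0 0 0); exact: cabs_ge0. Qed.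

Lemma fh_period x y w (c : int) : fh x y (w + c%:~R) = fh x y w.
Proof. by have := fhG x y w 0 0 c; rewrite !mulr0 subrr !addr0. Qed.

Lemma fh_vertical (e : R) : 0 < e -> exists2 d : R, 0 < d & forall s x y w,
  `|s| <= d -> cabs (fh x y (w + s) - fh x y w) <= e.
Proof.
move=> /fhU[d d0 H]; exists d => // s x y w hs.
have := H 0 0 s x y w; rewrite !mul0r subrr !addr0 normr0 => h.
by apply: h => //; exact: ltW.
Qed.

Definition vphase (m : int) x y w t : R[i] := fh x y (w + t) * expi (- (m%:~R * t)).

Lemma vphase_le m x y w t : cabs (vphase m x y w t) <= B.
Proof. by rewrite cabsM cabs_expi mulr1. Qed.

Lemma vphase_period m x y w t (c : int) : vphase m x y w (t + c%:~R) = vphase m x y w t.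
Proof.
rewrite /vphase addrA fh_period; congr (_ * _).
by apply: (@expi_eqmod _ _ _ (- (m * c))); rewrite mulrNz intrM; ring.
Qed.

Lemma vphase_unif (M : nat) (e : R) : 0 < e -> exists2 d : R, 0 < d & forall (m : int) x y w t s,
  (`|m| <= M)%N -> `|s| <= d -> cabs (vphase m x y w (t + s) - vphase m x y w t) <= e.
Proof.
move=> e0; have e2 : 0 < e / 2 by lra.
have [d d0 Hd] := fh_vertical e2.
have B0 := fh_bound_ge0; have p0 := pi_gt0 R.
have c0 : 0 < 8 * pi * (M%:R * B + 1) by rewrite !mulr_gt0// ltr_wpDl// mulr_ge0.
pose d' := Num.min d (e / (8 * pi * (M%:R * B + 1))).
have d'0 : 0 < d' by rewrite lt_min d0 divr_gt0.
exists d' => // m x y w t s mM; rewrite le_min => /andP[s1 s2].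
have -> : vphase m x y w (t + s) - vphase m x y w t
  = (fh x y (w + t + s) - fh x y (w + t)) * expi (- (m%:~R * (t + s)))
    + fh x y (w + t) * (expi (- (m%:~R * (t + s))) - expi (- (m%:~R * t))).
  by rewrite /vphase addrA; ring.
apply: (le_trans (cabsD _ _)); rewrite !cabsM cabs_expi mulr1.
have h1 := Hd s x y (w + t) s1.
have h2 : cabs (expi (- (m%:~R * (t + s))) - expi (- (m%:~R * t))) <= 4 * pi * (M%:R * `|s|).
  apply: (le_trans (expi_lip _ _ 0)); rewrite ler_wpM2l ?mulr_ge0 ?pi_ge0//.
  have -> : - (m%:~R * (t + s)) - - (m%:~R * t) - 0%:~R = - (m%:~R * s) :> R by ring.
  rewrite normrN normrM ler_wpM2r// -intr_norm.
  by rewrite -[M%:R]/(M%:Z%:~R) ler_int -abszE lez_nat.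
have h3 : cabs (fh x y (w + t)) * cabs (expi (- (m%:~R * (t + s))) - expi (- (m%:~R * t)))
   <= B * (4 * pi * (M%:R * `|s|)) by apply: ler_pM; rewrite ?cabs_ge0.
have h4 : `|s| * (8 * pi * (M%:R * B + 1)) <= e by rewrite -ler_pdivlMr.
have : 0 <= pi * `|s| by rewrite mulr_ge0// ltW.
lra.
Qed.

(** Dyadic grids are nested, so that two averages can be compared block by block. *)
Definition vaverage (m : int) (k : nat) x y w : R[i] :=
  (2 ^ k)%:R^-1 * \sum_(0 <= i < 2 ^ k) vphase m x y w (i%:R / (2 ^ k)%:R).

Let pow2_gt0 k : 0 < (2 ^ k)%:R :> R.
Proof. by rewrite ltr0n expn_gt0. Qed.

Lemma cabs_average (k : nat) (G : nat -> R[i]) (e : R) :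
  (forall i, (i < 2 ^ k)%N -> cabs (G i) <= e) ->
  cabs ((2 ^ k)%:R^-1 * \sum_(0 <= i < 2 ^ k) G i) <= e.
Proof.
move=> H; rewrite cabsM cabsV cabs_nat mulrC ler_pdivrMr ?pow2_gt0//.
apply: (le_trans (cabs_sum _ _ _)).
apply: (@le_trans _ _ (\sum_(0 <= i < 2 ^ k) e)).
  by apply: ler_sum_nat => i /andP[_]; exact: H.
by rewrite sumr_const_nat subn0 mulr_natr.
Qed.

Lemma small_pow2 (d : R) : 0 < d -> exists k0, forall k, (k0 <= k)%N -> (2 ^ k)%:R^-1 <= d.
Proof.
move=> d0; exists (Num.bound d^-1) => k hk.
rewrite -[d]invrK lef_pV2 ?posrE ?invr_gt0 ?pow2_gt0//.
apply/ltW/(lt_le_trans (archi_boundP _)); first by rewrite invr_ge0 ltW.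
rewrite ler_nat; apply: (leq_trans hk); exact/ltnW/ltn_expl.
Qed.

Lemma sum_blocks (V : nmodType) (a b : nat) (G : nat -> V) :
  \sum_(0 <= i < a * b) G i = \sum_(0 <= i < a) \sum_(0 <= r < b) G (i * b + r)%N.
Proof.
elim: a => [|a IH]; first by rewrite mul0n !big_geq.
rewrite big_nat_recr//= -IH mulSnr (big_cat_nat (n := (a * b)%N))//= ?leq_addr//; congr (_ + _).
by rewrite -{1}[(a * b)%N]add0n big_addn addKn; apply: eq_bigr => r _; rewrite addnC.
Qed.

Lemma vaverage_cauchy (M : nat) (e : R) : 0 < e -> exists k0, forall k (m : int) x y w,
  (`|m| <= M)%N -> (k0 <= k)%N -> cabs (vaverage m k x y w - vaverage m k0 x y w) <= e.
Proof.
move=> e0; have [d d0 Hd] := vphase_unif M e0; have [k0 Hk] := small_pow2 d0.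
exists k0 => k m x y w mM hk; rewrite -(subnKC hk); move: (k - k0)%N => j {k hk}.
have P0 : (2 ^ k0)%:R != 0 :> R by rewrite gt_eqF ?pow2_gt0.
have J0 : (2 ^ j)%:R != 0 :> R by rewrite gt_eqF ?pow2_gt0.
have J0c : (2 ^ j)%:R != 0 :> R[i] by rewrite pnatr_eq0 expn_eq0.
have E1 : vaverage m (k0 + j) x y w = (2 ^ k0)%:R^-1 * \sum_(0 <= i < 2 ^ k0)
    ((2 ^ j)%:R^-1 * \sum_(0 <= r < 2 ^ j) vphase m x y w (i%:R / (2 ^ k0)%:R + r%:R / (2 ^ j)%:R / (2 ^ k0)%:R)).
  rewrite /vaverage expnD natrM invfM sum_blocks -mulrA; congr (_ * _).
  rewrite big_distrr/=; apply: eq_bigr => i _; congr (_ * _); apply: eq_bigr => r _.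
  by congr vphase; rewrite natrD !natrM; field; rewrite P0 J0.
have E2 : vaverage m k0 x y w = (2 ^ k0)%:R^-1 * \sum_(0 <= i < 2 ^ k0)
    ((2 ^ j)%:R^-1 * \sum_(0 <= r < 2 ^ j) vphase m x y w (i%:R / (2 ^ k0)%:R)).
  rewrite /vaverage; congr (_ * _); apply: eq_bigr => i _.
  by rewrite sumr_const_nat subn0 -[vphase _ _ _ _ _ *+ _]mulr_natl mulKf.
rewrite E1 E2 -mulrBr -sumrB; apply: cabs_average => i _.
rewrite -mulrBr -sumrB; apply: cabs_average => r rj; apply: Hd => //.
rewrite ger0_norm ?divr_ge0//; apply: le_trans (Hk k0 (leqnn _)).
rewrite -[leRHS]mul1r ler_wpM2r ?invr_ge0//.
by rewrite ler_pdivrMr ?pow2_gt0// mul1r ler_nat ltnW.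
Qed.

(* The integral over [t] in [0, 1] of [fh x y (w + t) * expi (- m * t)], as a
   limit of dyadic Riemann sums: the sequence converges by [vaverage_cauchy], so
   that [liminfc] is its limit. *)
Definition fcoef (m : int) x y w := liminfc (fun k => vaverage m k x y w).

Lemma fcoef_near (M : nat) (e : R) : 0 < e -> exists k0, forall k, (k0 <= k)%N ->
  forall (m : int) x y w, (`|m| <= M)%N -> cabs (vaverage m k x y w - fcoef m x y w) <= e.
Proof.
move=> e0; have e4 : 0 < e / 4 by lra.
have [k0 H] := vaverage_cauchy M e4; exists k0 => k hk m x y w mM.
have -> : e = 4 * (e / 4) by field.
apply: (@liminfc_near _ (fun k => vaverage m k x y w) k0) => // j hj.
exact: H.
Qed.

Lemma sum_periodic_shift (P N : nat) (G : nat -> R[i]) : (forall i, G (i + P)%N = G i) ->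
  \sum_(0 <= i < P) G (i + N)%N = \sum_(0 <= i < P) G i.
Proof.
move=> per; elim: N => [|N IH]; first by apply: eq_bigr => i _; rewrite addn0.
rewrite -IH; apply/eqP; rewrite -subr_eq0 -sumrB.
under eq_bigr do rewrite addnS -addSn.
by rewrite (telescope_sumr (fun i => G (i + N)%N))// add0n addnC per subrr.
Qed.

(** [s] is rounded down to a grid point: translation by a grid point permutes the periodic sum, and
    the remainder is below the mesh [1 / P]. *)
Lemma vaverage_shift (m : int) (e : R) : 0 < e -> exists k0, forall k, (k0 <= k)%N ->
  forall x y w s, cabs (vaverage m k x y (w + s) - expi (m%:~R * s) * vaverage m k x y w) <= e.
Proof.
move=> e0; have [d d0 Hd] := vphase_unif `|m| e0; have [k0 Hk] := small_pow2 d0.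
exists k0 => k hk x y w s; set P := (2 ^ k)%N.
have P0 : (0 < P)%N by rewrite expn_gt0.
have P0' : 0 < P%:R :> R by rewrite ltr0n.
have E t : vphase m x y (w + s) t = expi (m%:~R * s) * vphase m x y w (s + t).
  rewrite /vphase addrA mulrCA -expiD; congr (_ * expi _); ring.
rewrite /vaverage; under eq_bigr do rewrite E.
rewrite -big_distrr/= mulrCA -mulrBr cabsM cabs_expi mul1r.
pose N := Num.floor (P%:R * s).
have /andP[N1 N2] : N%:~R <= P%:R * s < (N + 1)%:~R by exact: floor_itv.
rewrite intrD in N2.
pose n := `|(N %% P)%Z|%N.
have nE : n%:Z = (N %% P)%Z by rewrite /n gez0_abs// modz_ge0// eqz_nat -lt0n.
have NE : N%:~R = (N %/ P)%Z%:~R * P%:R + n%:R :> R.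
  by rewrite {1}(divz_eq N P) intrD intrM -nE.
pose r := s - N%:~R / P%:R.
have rd : `|r| <= d.
  apply: le_trans (Hk k hk); rewrite -/P.
  have rE : r = (P%:R * s - N%:~R) / P%:R by rewrite /r; field; rewrite gt_eqF.
  rewrite rE normrM [`|P%:R^-1|]ger0_norm ?invr_ge0 ?(ltW P0')//.
  by rewrite -[leRHS]mul1r ler_wpM2r ?invr_ge0 ?(ltW P0')// ger0_norm; lra.
pose G i := vphase m x y w (i%:R / P%:R).
have perG i : G (i + P)%N = G i.
  rewrite /G -[RHS](vphase_period m x y w _ 1); congr vphase.
  by rewrite natrD mulrDl divff// gt_eqF.
rewrite -(sum_periodic_shift n perG) -mulrBr -sumrB; apply: cabs_average => i _.
have -> : G (i + n)%N = vphase m x y w ((i%:R + N%:~R) / P%:R).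
  rewrite /G -(vphase_period m x y w _ (N %/ P)%Z); congr vphase.
  by rewrite NE natrD; field; rewrite gt_eqF.
have -> : s + i%:R / P%:R = (i%:R + N%:~R) / P%:R + r by rewrite /r; field; rewrite gt_eqF.
exact: Hd.
Qed.

Lemma cabs_le_lim (a : R[i]) (c : R) : (forall e : R, 0 < e -> cabs a <= c + e) -> cabs a <= c.
Proof. by move=> H; apply/ler_addgt0Pr => e /H. Qed.

Lemma fcoef_equivariant (m : int) x y w s :
  fcoef m x y (w + s) = expi (m%:~R * s) * fcoef m x y w.
Proof.
apply/eqP; rewrite -subr_eq0; apply/eqP/cabs_eq0/eqP; rewrite eq_le cabs_ge0 andbT.
apply: cabs_le_lim => e e0; rewrite add0r; have e3 : 0 < e / 3 by lra.
have [k1 H1] := fcoef_near `|m| e3; have [k2 H2] := vaverage_shift m e3.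
pose k := maxn k1 k2.
have h1 := H1 k (leq_maxl _ _) m x y (w + s) (leqnn _).
have h2 := H1 k (leq_maxl _ _) m x y w (leqnn _).
have h3 := H2 k (leq_maxr _ _) x y w s.
have -> : fcoef m x y (w + s) - expi (m%:~R * s) * fcoef m x y w
  = (vaverage m k x y (w + s) - expi (m%:~R * s) * vaverage m k x y w)
    - (vaverage m k x y (w + s) - fcoef m x y (w + s))
    + expi (m%:~R * s) * (vaverage m k x y w - fcoef m x y w) by ring.
apply: (le_trans (cabsD _ _)); rewrite cabsM cabs_expi mul1r.
have := cabsB (vaverage m k x y (w + s) - expi (m%:~R * s) * vaverage m k x y w)
  (vaverage m k x y (w + s) - fcoef m x y (w + s)).
lra.
Qed.

Lemma fcoef_lattice (m : int) x y w (a b : int) :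
  fcoef m (x + a%:~R) (y + b%:~R) (w + (x * b%:~R - y * a%:~R)) = fcoef m x y w.
Proof.
rewrite /fcoef; congr liminfc; apply/funext => k; rewrite /vaverage; congr (_ * _).
apply: eq_bigr => i _; rewrite /vphase; congr (_ * _).
by rewrite -[RHS](fhG _ _ _ a b 0) addr0 addrAC.
Qed.

Lemma fcoef_le (m : int) x y w : cabs (fcoef m x y w) <= B.
Proof.
apply: cabs_le_lim => e e0; have [k H] := fcoef_near `|m| e0.
have h1 := H k (leqnn _) m x y w (leqnn _).
have h2 : cabs (vaverage m k x y w) <= B by apply: cabs_average => i _; exact: vphase_le.
rewrite -[fcoef m x y w](subKr (vaverage m k x y w)).
by apply: (le_trans (cabsB _ _)); apply: lerD.
Qed.

Lemma fcoef_unif (m : int) (e : R) : 0 < e -> exists2 d : R, 0 < d & forall d1 d2 x y w,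
  `|d1| <= d -> `|d2| <= d ->
  cabs (fcoef m (x + d1) (y + d2) (w + (d1 * y - d2 * x)) - fcoef m x y w) <= e.
Proof.
move=> e0; have e3 : 0 < e / 3 by lra.
have [d d0 Hd] := fhU e3; exists d => // d1 d2 x y w hd1 hd2.
have [k H] := fcoef_near `|m| e3.
have h1 := H k (leqnn _) m (x + d1) (y + d2) (w + (d1 * y - d2 * x)) (leqnn _).
have h2 := H k (leqnn _) m x y w (leqnn _).
have h3 : cabs (vaverage m k (x + d1) (y + d2) (w + (d1 * y - d2 * x)) - vaverage m k x y w) <= e / 3.
  rewrite /vaverage -mulrBr -sumrB; apply: cabs_average => i _.
  rewrite /vphase -mulrBl cabsM cabs_expi mulr1 addrAC.
  by have := Hd d1 d2 0 x y (w + i%:R / (2 ^ k)%:R) hd1 hd2; rewrite !addr0 normr0 => h; apply: h; exact: ltW.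
move: h1 h2 h3; set f1 := fcoef _ _ _ _; set f2 := fcoef _ _ _ _; set v1 := vaverage _ _ _ _ _; set v2 := vaverage _ _ _ _ _.
move=> h1 h2 h3; have -> : f1 - f2 = (v1 - v2) - (v1 - f1) + (v2 - f2) by ring.
apply: (le_trans (cabsD _ _)); have := cabsB (v1 - v2) (v1 - f1); lra.
Qed.

(** The double sum is the Fejer mean, with weight [1 - |m| / Q] on the frequency [m]. For a dyadic
    average the Fejer mean is exactly a discrete convolution with the kernel ([E]), to which
    [fejer_average] applies; the averages are then replaced by their limits. *)
Lemma fcoef_fejer (e : R) : 0 < e -> exists2 Q, (0 < Q)%N & forall x y w,
  cabs (fh x y w - Q%:R^-1 * \sum_(0 <= j < Q) \sum_(0 <= k < Q) fcoef (j%:Z - k%:Z) x y w) <= e.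
Proof.
move=> e0; have e4 : 0 < e / 4 by lra.
have [d d0 Hd] := fh_vertical e4; have [ka ka0 Hka] := expi_near_int d0.
have B0 := fh_bound_ge0.
pose B' := 2 * B / ka; have B'0 : 0 <= B' by rewrite divr_ge0 ?mulr_ge0// ltW.
pose Q := (Num.bound (16 * B' / e)).+1.
have Q0 : (0 < Q)%N by [].
have Q0' : 0 < Q%:R :> R by rewrite ltr0n.
have QE : 4 * B' / Q%:R <= e / 4.
  rewrite ler_pdivrMr// mulrC.
  have h : 16 * B' / e < Q%:R.
    apply: (lt_le_trans (archi_boundP _)); last by rewrite ler_nat /Q.
    by apply: divr_ge0; [apply: mulr_ge0|exact: ltW].
  by move: h; rewrite ltr_pdivrMr//; lra.
exists Q => // x y w.
(* [Q * Q] coefficients enter with the weight [1 / Q], so each may be off by [e / 4 / Q]. *)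
have e'0 : 0 < e / 4 / Q%:R by rewrite divr_gt0.
have [k0 Hk] := fcoef_near Q e'0.
pose N := maxn k0 Q; pose P := (2 ^ N)%N.
have QP : (Q <= P)%N by apply: (leq_trans (leq_maxr k0 Q)); exact/ltnW/ltn_expl.
have near : cabs (P%:R^-1 * \sum_(0 <= i < P) fh x y (w + i%:R / P%:R)
     * (fejer_kernel Q (0 - i%:R / P%:R))%:C - fh x y w) <= e / 4 + 4 * B' / Q%:R.
  apply: (@fejer_average _ Q P 0 (fun i => fh x y (w + i%:R / P%:R))) => // i iP.
  have s0 : 0 <= B' * cabs (expi (0 - i%:R / P%:R) - 1) ^+ 2 by rewrite mulr_ge0// sqr_ge0.
  case: (ltP (cabs (expi (0 - i%:R / P%:R) - 1) ^+ 2) ka) => h.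
    have [c hc] := Hka _ h; rewrite sub0r in hc.
    have := Hd (i%:R / P%:R + c%:~R) x y w; rewrite addrA fh_period => h'.
    have : `|i%:R / P%:R + c%:~R| <= d by rewrite -normrN opprD; exact: ltW.
    by move/h'; lra.
  have : 2 * B <= B' * cabs (expi (0 - i%:R / P%:R) - 1) ^+ 2.
    by rewrite /B' mulrAC ler_pdivlMr// ler_wpM2l// mulr_ge0.
  have := cabsB (fh x y (w + i%:R / P%:R)) (fh x y w).
  have := fhB x y w; have := fhB x y (w + i%:R / P%:R); lra.
have E : P%:R^-1 * \sum_(0 <= i < P) fh x y (w + i%:R / P%:R) * (fejer_kernel Q (0 - i%:R / P%:R))%:C
   = Q%:R^-1 * \sum_(0 <= j < Q) \sum_(0 <= k < Q) vaverage (j%:Z - k%:Z) N x y w.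
  under eq_bigr do rewrite fejer_kernelE mulrCA.
  rewrite -big_distrr/= mulrCA; congr (_ * _).
  rewrite /vaverage -/P; under [RHS]eq_bigr do rewrite -big_distrr/=.
  rewrite -big_distrr/=; congr (_ * _).
  under eq_bigr do rewrite big_distrr/=.
  rewrite exchange_big/=; apply: eq_bigr => j _.
  under eq_bigr do rewrite big_distrr/=.
  rewrite exchange_big/=; apply: eq_bigr => k _; apply: eq_bigr => i _.
  by rewrite /vphase sub0r mulrN.
rewrite E in near.
have diff : cabs (Q%:R^-1 * \sum_(0 <= j < Q) \sum_(0 <= k < Q) vaverage (j%:Z - k%:Z) N x y w
   - Q%:R^-1 * \sum_(0 <= j < Q) \sum_(0 <= k < Q) fcoef (j%:Z - k%:Z) x y w) <= e / 4.
  rewrite -mulrBr -sumrB cabsM cabsV cabs_nat mulrC ler_pdivrMr//.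
  apply: (le_trans (cabs_sum _ _ _)).
  have -> : e / 4 * Q%:R = \sum_(0 <= j < Q) (e / 4) by rewrite sumr_const_nat subn0 mulr_natr.
  apply: ler_sum_nat => j /andP[_ jQ]; rewrite -sumrB; apply: (le_trans (cabs_sum _ _ _)).
  apply: (@le_trans _ _ (\sum_(0 <= k < Q) (e / 4 / Q%:R))); last first.
    by rewrite sumr_const_nat subn0 -[(e / 4 / Q%:R) *+ Q]mulr_natr divfK// gt_eqF.
  apply: ler_sum_nat => k /andP[_ kQ]; apply: Hk; first exact: leq_maxl.
  by lia.
move: near diff; set a1 := Q%:R^-1 * _.
set a2 := Q%:R^-1 * \sum_(0 <= j < Q) \sum_(0 <= k < Q) fcoef _ _ _ _ => near diff.
have -> : fh x y w - a2 = (a1 - a2) - (a1 - fh x y w) by ring.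
apply: (le_trans (cabsB _ _)); lra.
Qed.

End vertical_fourier.

(** * The nilmanifold *)

Section torus_lift.
Local Open Scope quotient_scope.
Variable R : realType.

Lemma rat_independent3_expi (alpha beta : R) : rat_independent3 alpha beta 1 ->
  forall m l : int, (m != 0) || (l != 0) -> expi (m%:~R * alpha + l%:~R * beta) != 1.
Proof.
move=> H m l ml; apply/eqP => /expi_eq1[k hk].
have [] := H m%:~R l%:~R (- k)%:~R.
  by rewrite !ratr_int mulr1 hk mulrNz subrr.
move=> /eqP; rewrite intr_eq0 => /eqP m0 /eqP; rewrite intr_eq0 => /eqP l0 _.
by move: ml; rewrite m0 l0 eqxx.
Qed.

Lemma mx_entry_le (d : nat) (u : 'rV[R]_d) i : `|u 0 i| <= `|u|.
Proof.
rewrite [leRHS]/Num.norm/= mx_normrE.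
exact: (le_bigmax _ (fun ij : 'I_1 * 'I_d => `|u ij.1 ij.2|) (0, i)).
Qed.

Lemma plane_pt_dist (x y x' y' : R) :
  `|plane_pt x y - plane_pt x' y'| <= `|x - x'| + `|y - y'|.
Proof.
rewrite [leLHS]/Num.norm/= mx_normrE; apply: bigmax_le; first by rewrite addr_ge0.
move=> [i j] _ /=; rewrite !mxE; case: ifP => _.
  by rewrite lerDl.
by rewrite lerDr.
Qed.

(** Exactly periodic but possibly discontinuous, since [repr] chooses arbitrary representatives;
    only its values modulo 1 are controlled. *)
Definition torus_lift (h : torus R 2 -> torus R 1) (x y : R) : R :=
  repr (h (\pi_(torus R 2) (plane_pt x y))) 0 0.

Lemma torus_lift_period h x y (a b : int) :
  torus_lift h (x + a%:~R) (y + b%:~R) = torus_lift h x y.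
Proof.
rewrite /torus_lift; congr (repr (h _) 0 0); apply/pi_torusP/mxOverP => i j.
by rewrite !mxE; case: ifP => _; rewrite addrC addKr intr_int.
Qed.

Lemma torus_lift_pi h x y :
  \pi_(torus R 1) (const_mx (torus_lift h x y)) = h (\pi_(torus R 2) (plane_pt x y)).
Proof.
rewrite -[RHS]reprK; congr (\pi_(_) _); apply/matrixP => i j.
by rewrite mxE /torus_lift !ord1.
Qed.

(** Representatives [u] and [v] come within any positive error of the infimum that defines the
    distance of [h p] and [h p']. The error taken is [D] itself, so [D = 0] is treated apart. *)
Lemma torus_lift_circle_map h : torus_lipschitz h ->
  exists2 L, 0 <= L & circle_map L (torus_lift h).
Proof.
move=> [L HL]; exists (2 * (`|L| + 1)); first by rewrite mulr_ge0// addr_ge0.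
split=> [x y x' y'|x y a b]; last by rewrite torus_lift_period subrr; exact: (nearZ_int R 0).
set D := `|x - x'| + `|y - y'|.
have D0 : 0 <= D by rewrite addr_ge0.
case: (eqVneq D 0) => [DE|Dn].
  have /eqP xx : x - x' == 0.
    by rewrite -normr_eq0 eq_le normr_ge0 andbT -DE lerDl.
  have /eqP yy : y - y' == 0.
    by rewrite -normr_eq0 eq_le normr_ge0 andbT -DE lerDr.
  have -> : x = x' by apply/eqP; rewrite -subr_eq0 xx.
  have -> : y = y' by apply/eqP; rewrite -subr_eq0 yy.
  by rewrite DE mulr0 subrr; exact: (nearZ_int R 0).
have Dp : 0 < D by rewrite lt_def Dn.
set p := \pi_(torus R 2) (plane_pt x y); set p' := \pi_(torus R 2) (plane_pt x' y').
have d1 : torus_dist p p' <= D.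
  apply: le_trans (plane_pt_dist x y x' y'); apply: ge_inf.
    by exists 0 => r [u _ [v _ <-]].
  by exists (plane_pt x y) => //; exists (plane_pt x' y').
have d0 : 0 <= torus_dist p p'.
  apply: lb_le_inf; first by exists `|plane_pt x y - plane_pt x' y'|, (plane_pt x y) => //; exists (plane_pt x' y').
  by move=> r [u _ [v _ <-]].
have d2 : torus_dist (h p) (h p') <= `|L| * D.
  apply: (le_trans (HL p p')); apply: (@le_trans _ _ (`|L| * torus_dist p p')).
    by rewrite ler_wpM2r// ler_norm.
  by rewrite ler_wpM2l.
pose E := [set `|u - v| | u in [set u | \pi_(torus R 1) u = h p] & v in [set v | \pi_(torus R 1) v = h p']].
have hE : has_inf E.
  split; last by exists 0 => r [u _ [v _ <-]].
  by exists `|repr (h p) - repr (h p')|, (repr (h p)); [exact: reprK|exists (repr (h p')); [exact: reprK|]].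
have [r [u uh [v vh <-]] ruv] := inf_adherent Dp hE.
have uv : `|u 0 0 - v 0 0| <= 2 * (`|L| + 1) * D.
  have := mx_entry_le (u - v) 0; rewrite !mxE => h1.
  move: ruv; rewrite -/(torus_dist (h p) (h p')) => h2.
  have : 0 <= `|L| * D by rewrite mulr_ge0.
  lra.
have int_diff (w : 'rV[R]_1) (q : torus R 1) : \pi_(torus R 1) w = q -> exists k : int, repr q 0 0 - w 0 0 = k%:~R.
  move=> hw; have /pi_torusP/mxOverP/(_ 0 0) : \pi_(torus R 1) (repr q) = \pi_(torus R 1) w by rewrite reprK.
  by rewrite !mxE => /intrP[k hk]; exists k.
have [k1 hk1] := int_diff _ _ uh; have [k2 hk2] := int_diff _ _ vh.
exists (k1 - k2); rewrite /torus_lift -/p -/p' intrB -hk1 -hk2.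
have -> : repr (h p) 0 0 - repr (h p') 0 0 - (repr (h p) 0 0 - u 0 0 - (repr (h p') 0 0 - v 0 0)) = u 0 0 - v 0 0 by ring.
exact: uv.
Qed.

End torus_lift.

Section nilmanifold_functions.
Local Open Scope quotient_scope.
Variable R : realType.
Local Notation G := (heisenberg R).
Local Notation X := (nilmanifold R).

Lemma nilmanifold_lattice (x y w : R) (a b c : int) :
  \pi_X ((x + a%:~R, y + b%:~R, w + (x * b%:~R - y * a%:~R) + c%:~R) : G) = \pi_X ((x, y, w) : G).
Proof.
apply/esym/pi_nilmanifoldP; rewrite inE /=.
have -> : - x + (x + a%:~R) = a%:~R by ring.
have -> : - y + (y + b%:~R) = b%:~R by ring.
have -> : - w + (w + (x * b%:~R - y * a%:~R) + c%:~R) + (- x * (y + b%:~R) - (x + a%:~R) * - y) = c%:~R by ring.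
by rewrite !intr_int.
Qed.

Fixpoint orbit_z (alpha beta x0 y0 z0 : R) (hh : R -> R -> R) (n : nat) : R :=
  if n is n'.+1 then orbit_z alpha beta x0 y0 z0 hh n'
    + hh (x0 + n'%:R * alpha) (y0 + n'%:R * beta)
    + (alpha * (y0 + n'%:R * beta) - (x0 + n'%:R * alpha) * beta)
  else z0.

Lemma iter_skew_product (alpha beta x0 y0 z0 : R) (h : torus R 2 -> torus R 1) n :
  iter n (skew_product alpha beta h) (\pi_X ((x0, y0, z0) : G))
  = \pi_X ((x0 + n%:R * alpha, y0 + n%:R * beta, orbit_z alpha beta x0 y0 z0 (torus_lift h) n) : G).
Proof.
elim: n => [|n IH]; first by rewrite /= !mul0r !addr0.
rewrite iterS IH; set g : G := (_, _, _).
rewrite (@skew_productE _ _ _ _ g (torus_lift h (x0 + n%:R * alpha) (y0 + n%:R * beta))); last first.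
  exact: torus_lift_pi.
congr (\pi_(_) _); rewrite -[LHS]/(heis_mul (alpha, beta, _) g) /g /= -(natr1 n).
by congr (_, _, _); ring.
Qed.

Variable f : X -> R[i]^o.
Hypothesis fcont : continuous f.

Definition nil_fun (x y w : R) : R[i] := f (\pi_X ((x, y, w) : G)).

Let Fun (g : R * R * R) : R[i]^o := nil_fun g.1.1 g.1.2 g.2.

Lemma nil_fun_continuous : continuous Fun.
Proof.
move=> g; have -> : Fun = f \o (\pi_X : G -> X).
  by apply/funext => -[[x y] w].
apply: continuous_comp; first exact: (@pi_continuous G).
exact: fcont.
Qed.

Lemma nil_fun_near (g : R * R * R) (e : R) : 0 < e ->
  \forall g' \near g, cabs (Fun g - Fun g') < e.
Proof.
move=> e0; have ec : 0 < (e%:C)%C by rewrite ltcR.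
apply: filterS (cvgr_dist_lt Fun (Fun g) (@nil_fun_continuous g) _ ec) => g' /=.
by rewrite cabsE ltcR.
Qed.

Definition unit_cube : set (R * R * R) := (`[0, 1] `*` `[0, 1]) `*` `[0, 1].

Lemma unit_cube_compact : compact unit_cube.
Proof. by do 2 (apply: compact_setX; last exact: segment_compact); exact: segment_compact. Qed.

Lemma nil_fun_cube (x y w : R) : exists (a b c : int) (x' y' w' : R),
  [/\ unit_cube (x', y', w'), x = x' + a%:~R, y = y' + b%:~R &
      w = w' + (x' * b%:~R - y' * a%:~R) + c%:~R].
Proof.
have fr (t : R) : t - (Num.floor t)%:~R \in `[0, 1].
  have /andP[h1 h2] : (Num.floor t)%:~R <= t < (Num.floor t + 1)%:~R by exact: floor_itv.
  by rewrite intrD in h2; rewrite in_itv/=; apply/andP; split; lra.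
set a := Num.floor x; set b := Num.floor y.
pose v := w - ((x - a%:~R) * b%:~R - (y - b%:~R) * a%:~R).
exists a, b, (Num.floor v), (x - a%:~R), (y - b%:~R), (v - (Num.floor v)%:~R); split.
- by split; [split|]; exact: fr.
- by rewrite subrK.
- by rewrite subrK.
- by rewrite /v; ring.
Qed.

Lemma nil_fun_lattice (x y w : R) (a b c : int) :
  nil_fun (x + a%:~R) (y + b%:~R) (w + (x * b%:~R - y * a%:~R) + c%:~R) = nil_fun x y w.
Proof. by rewrite /nil_fun nilmanifold_lattice. Qed.

Lemma nil_fun_bounded : exists B : R, forall x y w, cabs (nil_fun x y w) <= B.
Proof.
have := unit_cube_compact; rewrite compact_near_coveringP => /(_ R +oo (fun B g => cabs (Fun g) <= B) _).
case=> [g _|B [_ HB]].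
  near=> g' B.
  have h : cabs (Fun g - Fun g') < 1 by near: g'; exact: (nil_fun_near g ltr01).
  have hB : cabs (Fun g) + 1 <= B by near: B; apply: nbhs_pinfty_ge; exact: num_real.
  have h2 : cabs (Fun g') <= cabs (Fun g) + cabs (Fun g - Fun g').
    by have := cabsB (Fun g) (Fun g - Fun g'); rewrite (subKr (Fun g : R[i])).
  by apply: (le_trans h2); apply: le_trans hB; rewrite lerD2l ltW.
exists (B + 1) => x y w; have [a [b [c [x' [y' [w' [cube -> -> ->]]]]]]] := nil_fun_cube x y w.
rewrite nil_fun_lattice; apply: (HB (B + 1)) cube; lra.
Unshelve. all: by end_near. Qed.

(** Left translation commutes with the right action of the lattice, so points of the unit cube
    suffice; there compactness turns continuity into a uniform estimate. *)
Lemma nil_fun_unif (e : R) : 0 < e -> exists2 d : R, 0 < d & forall d1 d2 d3 x y w,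
  `|d1| <= d -> `|d2| <= d -> `|d3| <= d ->
  cabs (nil_fun (x + d1) (y + d2) (w + (d1 * y - d2 * x) + d3) - nil_fun x y w) <= e.
Proof.
move=> e0; have e2 : 0 < e / 2 by lra.
have := unit_cube_compact; rewrite compact_near_coveringP.
move=> /(_ R (0 : R)^'+ (fun d g => forall d1 d2 d3 : R, `|d1| <= d -> `|d2| <= d -> `|d3| <= d ->
  cabs (Fun (g.1.1 + d1, g.1.2 + d2, g.2 + (d1 * g.1.2 - d2 * g.1.1) + d3) - Fun g) <= e) _).
case=> [g _|].
  have /nbhs_ballP[del /= del0 Hdel] := nil_fun_near g e2.
  have del2 : 0 < del / 2 by lra.
  (* For [g'] near [g], a left translation of size [d] moves the third coordinate by at most
     [d * C], and the others by [d <= d * C]. *)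
  set C := `|g.1.1| + `|g.1.2| + del + 1.
  have C0 : 0 < C by rewrite /C; have := normr_ge0 g.1.1; have := normr_ge0 g.1.2; lra.
  have dC : 0 < del / 2 / C by rewrite divr_gt0.
  near=> g' d => d1 d2 d3 hd1 hd2 hd3.
  have [[/= gx gy] /= gz] : ball g (del / 2) g' by near: g'; exact: nbhsx_ballx.
  have d0 : 0 < d by near: d; exact: nbhs_right_gt.
  have dd : d < del / 2 / C by near: d; exact: nbhs_right_lt.
  have dCd : d * C < del / 2 by rewrite -ltr_pdivlMr.
  move: gx gy gz; rewrite /ball/= => gx gy gz.
  have hg' : cabs (Fun g - Fun g') < e / 2.
    by apply: Hdel; split; [split|]; rewrite /ball/=; lra.
  have hs : cabs (Fun g - Fun (g'.1.1 + d1, g'.1.2 + d2, g'.2 + (d1 * g'.1.2 - d2 * g'.1.1) + d3)) < e / 2.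
    have nx : `|g'.1.1| <= `|g.1.1| + del / 2.
      have := ler_normB g.1.1 (g.1.1 - g'.1.1); rewrite subKr; lra.
    have ny : `|g'.1.2| <= `|g.1.2| + del / 2.
      have := ler_normB g.1.2 (g.1.2 - g'.1.2); rewrite subKr; lra.
    have dxy : `|d1 * g'.1.2 - d2 * g'.1.1 + d3| <= d * C.
      apply: (le_trans (ler_normD _ _)); apply: (le_trans (lerD (ler_normB _ _) hd3)).
      rewrite !normrM; apply: (@le_trans _ _ (d * `|g'.1.2| + d * `|g'.1.1| + d)).
        by rewrite lerD2r; apply: lerD; rewrite ler_wpM2r.
      have -> : d * `|g'.1.2| + d * `|g'.1.1| + d = d * (`|g'.1.2| + `|g'.1.1| + 1) by ring.
      by rewrite ler_pM2l// /C; lra.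
    have dle : d <= d * C.
      rewrite ler_peMr ?(ltW d0)//.
      rewrite /C; have := normr_ge0 g.1.1; have := normr_ge0 g.1.2; lra.
    have shift (u u' v : R) : `|u - u'| < del / 2 -> `|v| <= d * C -> `|u - (u' + v)| < del.
      move=> hu hv; have := ler_normB (u - u') v; rewrite -addrA -opprD; lra.
    apply: Hdel; split; [split|]; rewrite /ball/=.
    + by apply: shift => //; apply: le_trans dle.
    + by apply: shift => //; apply: le_trans dle.
    + by rewrite -addrA; apply: shift.
  have := cabsB (Fun g - Fun g') (Fun g - Fun (g'.1.1 + d1, g'.1.2 + d2, g'.2 + (d1 * g'.1.2 - d2 * g'.1.1) + d3)).
  set u := Fun g; set v := Fun g'; set t := Fun (_, _, _).
  have -> : u - v - (u - t) = t - v :> R[i] by rewrite opprB addrC subrKA.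
  move=> h; apply: (le_trans h); rewrite (splitr e); apply: lerD; exact: ltW.
move=> r /= r0 Hr; have r2 : 0 < r / 2 by lra.
have {}Hr : unit_cube `<=` _ := Hr (r / 2) _ r2.
exists (r / 2) => // d1 d2 d3 x y w h1 h2 h3.
have [a [b [c [x' [y' [w' [cube xE yE wE]]]]]]] := nil_fun_cube x y w.
have -> : nil_fun x y w = nil_fun x' y' w' by rewrite xE yE wE nil_fun_lattice.
have -> : nil_fun (x + d1) (y + d2) (w + (d1 * y - d2 * x) + d3)
   = nil_fun (x' + d1) (y' + d2) (w' + (d1 * y' - d2 * x') + d3).
  rewrite -(nil_fun_lattice (x' + d1) _ _ a b c) xE yE wE; congr (nil_fun _ _ _); ring.
apply: Hr cube d1 d2 d3 h1 h2 h3.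
by rewrite /= sub0r normrN gtr0_norm; lra.
Unshelve. all: by end_near. Qed.

Variables (alpha beta x0 y0 z0 : R) (h : torus R 2 -> torus R 1).
Hypothesis indep : rat_independent3 alpha beta 1.
Hypothesis hlip : torus_lipschitz h.

Let z := orbit_z alpha beta x0 y0 z0 (torus_lift h).

Lemma nil_fun_mobius :
  mobius_null (fun n => nil_fun (x0 + n%:R * alpha) (y0 + n%:R * beta) (z n)).
Proof.
have [B fB] := nil_fun_bounded; have [L L0 hL] := torus_lift_circle_map hlip.
have ind := rat_independent3_expi indep.
have vB := fcoef_le fB nil_fun_unif.
have vE := fcoef_equivariant fB nil_fun_lattice nil_fun_unif.
have vG := fcoef_lattice nil_fun_lattice.
have vU := fcoef_unif fB nil_fun_unif.
have coef m : mobius_null (fun n => fcoef nil_fun m (x0 + n%:R * alpha) (y0 + n%:R * beta) (z n)).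
  case: (eqVneq m 0) => [->|m0]; last first.
    apply: (katai_bounded (B := B)) => [n|p q pp pq pqN]; first exact: vB.
    apply: uniform_null_mean.
    exact: (correlation_null ind L0 hL (vE m) (vG m) (vU m) (vB m) (fun n => erefl) (prime_gt0 pp) (prime_gt0 pq) pqN m0).
  (* For [m = 0], equivariance makes the coefficient constant in the third variable; [vG] then gives
     periodicity in the plane and [vU] continuity. *)
  pose phi x y := fcoef nil_fun 0 x y 0.
  have phiE x y w : fcoef nil_fun 0 x y w = phi x y.
    by rewrite -[w]add0r vE mul0r expi0 mul1r.
  under eq_fun do rewrite phiE.
  apply: (mobius_null_torus (B := B) ind) => [e e0|x y]; last exact: vB.
  have [d d0 Hd] := vU 0 e e0; have [k k0 Hk] := expi_near_int d0.
  exists k => // x y x' y' /Hk[a ha] /Hk[b hb].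
  have := Hd (x - x' - a%:~R) (y - y' - b%:~R) x' y' 0 (ltW ha) (ltW hb).
  rewrite !phiE; have := vG 0 (x - a%:~R) (y - b%:~R) 0 a b; rewrite !subrK !phiE => ->.
  have -> : x' + (x - x' - a%:~R) = x - a%:~R by ring.
  by have -> : y' + (y - y' - b%:~R) = y - b%:~R by ring.
apply: mobius_null_approx => e e0.
have [Q Q0 HQ] := fcoef_fejer fB nil_fun_lattice nil_fun_unif e0.
exists (fun n => Q%:R^-1 * \sum_(0 <= j < Q) \sum_(0 <= k < Q)
  fcoef nil_fun (j%:Z - k%:Z) (x0 + n%:R * alpha) (y0 + n%:R * beta) (z n)) => [|n]; last exact: HQ.
by apply: mobius_null_scale; do 2 apply: mobius_null_sum => ?; exact: coef.
Qed.

End nilmanifold_functions.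

Theorem theorem1p1 (R : realType) (alpha beta : R)
    (h : torus R 2 -> torus R 1)
    (indep : rat_independent3 alpha beta 1)
    (hlip : torus_lipschitz h)
    (x : nilmanifold R) (f : nilmanifold R -> R[i]^o) (fcont : continuous f) :
  N%:R^-1 * (\sum_(1 <= n < N.+1)
     f (iter n (skew_product alpha beta h) x) * (mobius n)%:~R)
  @[N --> \oo] --> (0 : R[i]^o).
Proof.
rewrite -[x]reprK; case: (repr x : heisenberg R) => [[x0 y0] z0].
(* Positivity in [R[i]] forces the imaginary part to vanish, so the tolerance is a positive real. *)
apply/cvgrPdist_le => /= -[e1 e2]; rewrite ltcE /= => /andP[/eqP -> e0].
have [N0 HN] := nil_fun_mobius fcont x0 y0 z0 indep hlip e0.
near=> N.
have N1 : (0 < N)%N by near: N; exact: nbhs_infty_ge.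
have hN : (N0 <= N)%N by near: N; exact: nbhs_infty_ge.
rewrite sub0r normrN cabsE lecR cabsM cabsV.
have -> : cabs (N%:R : R[i]) = N%:R by rewrite -(rmorph_nat (real_complex R)) cabs_real normr_nat.
rewrite ler_pdivrMl ?ltr0n// mulrC; apply: le_trans (HN N hN).
by rewrite le_eqVlt; apply/orP; left; apply/eqP; congr cabs; apply: eq_bigr => n _; rewrite iter_skew_product.
Unshelve. all: by end_near. Qed.
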